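(* Let $k,\ell\ge1$ be integers and let $U\subset\mathbb{R}^2$ be a non-empty open set. Suppose $f\in\mathcal{E}'(S^k\times S^\ell)$ satisfies $f|_U=\mathrm{d}'u+\lambda w'$ (restricted to $U$) for some $u\in\mathcal{E}'(S^{k-1}\times S^\ell)$ and $w'\in\mathcal{E}'(S^{k-1}\times S^{\ell-1})$, and the normal operator $N_{k,\ell}f$ vanishes to infinite order at some point $x_0\in U$. Then there exist $\tilde u\in\mathcal{E}'(S^{k-1}\times S^\ell)$ and $w\in\mathcal{E}'(S^{k-1}\times S^{\ell-1})$ such that $f=\mathrm{d}'\tilde u+\lambda w$.
   Context: $\mathcal{E}'(S^k\times S^\ell)$ denotes $(k+\ell)$-tensor fields on $\mathbb{R}^2$, symmetric in the first $k$ indices and symmetric in the last $\ell$ indices, whose components are compactly supported distributions. Repeated indices are summed over $\{1,2\}$. $\sigma(i_1,\dots,i_p)$ denotes symmetrization over the indicated indices (average over all permutations). Operators (acting on smooth or distributional tensor fields): $(\mathrm{d}'u)_{i_1\dots i_kj_1\dots j_\ell}=\sigma(i_1,\dots,i_k)\,\partial_{x^{i_1}}u_{i_2\dots i_kj_1\dots j_\ell}$ and $(\lambda w)_{i_1\dots i_kj_1\dots j_\ell}=\sigma(i_1,\dots,i_k)\sigma(j_1,\dots,j_\ell)\,\delta_{i_1j_1}w_{i_2\dots i_kj_2\dots j_\ell}$. For smooth compactly supported $f$ the mixed ray transform is $L_{k,\ell}f(x,\xi)=\int_{-\infty}^\infty f_{i_1\dots i_kj_1\dots j_\ell}(x+t\xi)\,\xi^{i_1}\cdots\xi^{i_k}\eta^{j_1}\cdots\eta^{j_\ell}\,dt$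 for $\xi\in\mathbb{S}^1$, $\langle x,\xi\rangle=0$, $\eta=(-\xi_2,\xi_1)$; its formal $L^2$ adjoint is $((L_{k,\ell})^*g)_{i_1\dots i_kj_1\dots j_\ell}(x)=\int_{\mathbb{S}^1}\xi^{i_1}\cdots\xi^{i_k}\eta^{j_1}\cdots\eta^{j_\ell}\,g(x-\langle x,\xi\rangle\xi,\xi)\,dS_\xi$, and $N_{k,\ell}=(L_{k,\ell})^*L_{k,\ell}$. It is given by, and extended to $f\in\mathcal{E}'(S^k\times S^\ell)$ through, the formula (sum over all $m$'s and $n$'s, $*$ denoting convolution) $$(N_{k,\ell}f)_{i_1\dots i_kj_1\dots j_\ell}=2\,f_{m_1\dots m_kn_1\dots n_\ell}*(-1)^{J_1+N_1}\frac{x_1^{I_1+J_2+M_1+N_2}\,x_2^{I_2+J_1+M_2+N_1}}{|x|^{2k+2\ell+1}},$$ where $I_1,J_1,M_1,N_1$ (resp. $I_2,J_2,M_2,N_2$) are the numbers of $1$'s (resp. $2$'s) in $(i_1,\dots,i_k)$, $(j_1,\dots,j_\ell)$, $(m_1,\dots,m_k)$, $(n_1,\dots,n_\ell)$ respectively. A function $\phi$ vanishes to infinite order at $x_0$ if $\phi$ is smooth in a neighborhood of $x_0$ and $\partial^\alpha\phi(x_0)=0$ for all multi-indices $\alpha$; for tensor fields this is required of every component. *)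

(* Defs.v *)
From HB Require Import structures.
From mathcomp Require Import all_boot all_order all_algebra all_fingroup.
From mathcomp Require Import all_classical all_reals all_analysis.

Set Implicit Arguments.
Unset Strict Implicit.
Unset Printing Implicit Defensive.

Import Order.TTheory GRing.Theory Num.Theory.
Import numFieldNormedType.Exports.

Local Open Scope classical_set_scope.
Local Open Scope ring_scope.

Section Distributions.
Context {R : realType}.

(* Tensor indices 1, 2 are encoded as 0, 1 : 'I_2. *)
Definition basis2 (i : 'I_2) : R * R := if i == 0 then (1, 0) else (0, 1).

Definition partial (i : 'I_2) (g : R * R -> R) : R * R -> R :=
  fun x => 'D_(basis2 i) g x.

Definition partials (s : seq 'I_2) (g : R * R -> R) : R * R -> R :=
  foldr partial g s.

Definition pderiv (a b : nat) (g : R * R -> R) : R * R -> R :=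
  partials (nseq a 0 ++ nseq b 1) g.

(* All iterated partial derivatives exist and are continuous on A; meaningful
   for open A. *)
Definition smooth_on (A : set (R * R)) (g : R * R -> R) : Prop :=
  forall s x, A x -> {for x, continuous (partials s g)} /\
    forall i, derivable (partials s g) x (basis2 i).

Definition smooth (g : R * R -> R) : Prop := smooth_on setT g.

Definition supp (g : R * R -> R) : set (R * R) :=
  closure [set x | g x != 0].

Definition test_fun (A : set (R * R)) (phi : R * R -> R) : Prop :=
  [/\ smooth phi, compact (supp phi) & supp phi `<=` A].

(* A functional is defined on all functions, but only its values on smooth
   ones (on test functions, for distributions that need not have compact
   support) are meaningful: equality of functionals is tested there. *)
Definition functional : Type := (R * R -> R) -> R.

(* Compactly supported distributions: the continuous linear forms on the
   Frechet space of smooth functions on the plane. *)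
Definition cs_distribution (T : functional) : Prop :=
  (forall (c : R) phi psi, smooth phi -> smooth psi ->
     T (fun x => c * phi x + psi x) = c * T phi + T psi) /\
  exists (K : set (R * R)) (n : nat) (C : R), compact K /\
    forall phi, smooth phi ->
      `|T phi| <= C * \sum_(a < n.+1) \sum_(b < n.+1 | (a + b <= n)%N)
                        sup [set `|pderiv a b phi x| | x in K].

Definition dpartial (i : 'I_2) (T : functional) : functional :=
  fun phi => - T (partial i phi).

Definition lebesgue2 := (@lebesgue_measure R \x @lebesgue_measure R)%E.

(* (T * h)(phi) = T_y (int h(x - y) phi(x) dx), for T compactly supported, h
   locally integrable and phi a test function: the argument of T is then smooth.
   The value of h at a single point is irrelevant. *)
Definition convolution (T : functional) (h : R * R -> R) : functional :=
  fun phi => T (fun y => \int[lebesgue2]_x (h (x - y) * phi x)).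

(* T agrees near x0 with a smooth function g that is flat at x0. *)
Definition vanishes_infinite_order (T : functional) (x0 : R * R) : Prop :=
  exists (V : set (R * R)) (g : R * R -> R),
    [/\ open V, V x0, smooth_on V g,
        forall phi, test_fun V phi -> T phi = \int[lebesgue2]_x (g x * phi x)
      & forall a b, pderiv a b g x0 = 0].

Definition tensor (k l : nat) : Type :=
  k.-tuple 'I_2 -> l.-tuple 'I_2 -> functional.

Definition perm_idx (k : nat) (s : 'S_k) (i : k.-tuple 'I_2) :
  k.-tuple 'I_2 := [tuple tnth i (s p) | p < k].

Definition cs_sym_tensor (k l : nat) (f : tensor k l) : Prop :=
  (forall i j, cs_distribution (f i j)) /\
  forall (s : 'S_k) (t : 'S_l) i j phi, smooth phi ->
    f (perm_idx s i) (perm_idx t j) phi = f i j phi.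

Definition symmetrize (k : nat) (F : k.-tuple 'I_2 -> R) (i : k.-tuple 'I_2) :
  R := (k`!%:R)^-1 * \sum_(s : 'S_k) F (perm_idx s i).

(* Used for k >= 1 only (also l >= 1 for lambda): the default value of head is
   then irrelevant. *)
Definition dprime (k l : nat) (u : tensor k.-1 l) : tensor k l :=
  fun i j phi =>
    symmetrize (fun i' => dpartial (head 0 i') (u (behead_tuple i') j) phi) i.

Definition lambda (k l : nat) (w : tensor k.-1 l.-1) : tensor k l :=
  fun i j phi =>
    symmetrize (fun i' =>
      symmetrize (fun j' => (head 0 i' == head 0 j')%:R *
                            w (behead_tuple i') (behead_tuple j') phi) j) i.

Definition euclid_norm (x : R * R) : R := Num.sqrt (x.1 ^+ 2 + x.2 ^+ 2).

(* Index value 1 is 0 : 'I_2, index value 2 is 1 : 'I_2. *)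
Definition count1 (k : nat) (i : k.-tuple 'I_2) : nat := count_mem 0 i.
Definition count2 (k : nat) (i : k.-tuple 'I_2) : nat := count_mem 1 i.

Definition normal_kernel (k l : nat) (i : k.-tuple 'I_2) (j : l.-tuple 'I_2)
  (m : k.-tuple 'I_2) (n : l.-tuple 'I_2) (x : R * R) : R :=
  (-1) ^+ (count1 j + count1 n)
  * (x.1 ^+ (count1 i + count2 j + count1 m + count2 n)
     * x.2 ^+ (count2 i + count1 j + count2 m + count1 n)
     / euclid_norm x ^+ (2 * k + 2 * l + 1)).

(* The normal operator of the mixed ray transform, extended to compactly
   supported distributional tensor fields by its convolution formula. *)
Definition normal_op (k l : nat) (f : tensor k l) : tensor k l :=
  fun i j phi =>
    2 * \sum_(m : k.-tuple 'I_2) \sum_(n : l.-tuple 'I_2)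
          convolution (f m n) (normal_kernel i j m n) phi.

End Distributions.

Arguments tensor R k l : clear implicits.

(* Main.v *)
(* Write r = k + l. A symmetric tensor is of the form d'u + lambda w if and only if the scalar
   S = sum (-1)^M2 d1^(M2+N1) d2^(M1+N2) f_(m,n), a derivative of order r of f, vanishes:
   sufficiency comes from removing the potentials one antidiagonal at a time. The kernels of the
   normal operator being derivatives of |x|^(2r-1), each component of N f is, up to a constant,
   a derivative of order r of S * |x|^(2r-1). As S vanishes on U, flatness of N f at x0 means
   that S annihilates all derivatives of order at least r of y |-> |x0 - y|^(2r-1), cut off near
   x0. These span all p(x0 - y) / |x0 - y|^(2n+1) with p homogeneous of degree n, that is, after
   the inversion z = (x0 - y) / |x0 - y|^2, all |x0 - y|^-1 p(z) with p a polynomial in z.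
   Polynomials are dense in the smooth functions, hence S = 0. *)

(* The signs of S are dictated by d' and lambda. Prefixing the first group by 1 with d1, or by 2
   with d2, yields the same derivative of order r with opposite signs; so does adding the pair 11 or
   the pair 22 to the two groups. Conversely, lambda moves coefficients freely along an antidiagonal
   (number of 2's in the first group plus number of 1's in the second held constant), so modulo
   lambda only the antidiagonal sums of f matter, and S = 0 is one scalar relation between these. N
   f is a priori only a distribution and its kernel is singular, so derivatives at x0 cannot be
   obtained by evaluation: they are tested on bumps shrinking to x0. Since S vanishes near x0, only
   the values of the kernel away from its singularity count. A single point x0 suffices because
   inversion sends x0 to infinity and the support of S into a bounded set, on which polynomials can
   approximate. The approximation has to hold in C^n, n being the order of S; it is obtained by
   approximating a high derivative uniformly and integrating back. *)
Require Import Defs.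
From mathcomp Require Import all_boot all_order all_algebra all_fingroup.
From mathcomp Require Import all_classical all_reals all_analysis.
From mathcomp Require Import measurable_realfun ring lra zify.
Set Implicit Arguments.
Unset Strict Implicit.
Unset Printing Implicit Defensive.
Import Order.TTheory GRing.Theory Num.Theory.
Import numFieldNormedType.Exports.
Local Open Scope classical_set_scope.
Local Open Scope ring_scope.

(** * Partial derivatives in the plane: classes C^n, chain rule, symmetry of mixed derivatives *)

Section Calculus.
Context {R : realType}.
Implicit Types (A B : set (R * R)) (f g : R * R -> R) (x y p : R * R).

Notation e_ := (@basis2 R).

Lemma slice1 f a b d :
  is_derive (a, b) (e_ 0) f d <-> is_derive a 1 (fun t => f (t, b)) d.
Proof.
have E : (fun h : R => h^-1 *: ((f \o shift (a, b)) (h *: e_ 0) - f (a, b))) =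
         (fun h : R => h^-1 *: (((fun t => f (t, b)) \o shift a) (h *: 1) - f (a, b))).
  apply/funext => h /=; rewrite /basis2 eqxx /=.
  by rewrite -[h *: (1, 0) + _]/(h *: 1 + a, h *: 0 + b) scaler0 add0r.
split=> -[dx dE]; split.
- by rewrite /derivable -E.
- by rewrite /derive -E.
- by rewrite /derivable E.
- by rewrite /derive E.
Qed.

Lemma slice2 f a b d :
  is_derive (a, b) (e_ 1) f d <-> is_derive b 1 (fun t => f (a, t)) d.
Proof.
have E : (fun h : R => h^-1 *: ((f \o shift (a, b)) (h *: e_ 1) - f (a, b))) =
         (fun h : R => h^-1 *: (((fun t => f (a, t)) \o shift b) (h *: 1) - f (a, b))).
  apply/funext => h /=; rewrite /basis2 /=.
  by rewrite -[h *: (0, 1) + _]/(h *: 0 + a, h *: 1 + b) scaler0 add0r.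
split=> -[dx dE]; split.
- by rewrite /derivable -E.
- by rewrite /derive -E.
- by rewrite /derivable E.
- by rewrite /derive E.
Qed.

(* Unlike [smooth_on], this asks for some partial derivatives rather than for [partial]
   itself, which makes closure under the operations an induction on [n]. *)
Fixpoint Cn (n : nat) A f : Prop :=
  (forall x, A x -> {for x, continuous f}) /\
  (if n is m.+1 then exists f' : 'I_2 -> R * R -> R,
     (forall i x, A x -> is_derive x (e_ i) f (f' i x)) /\
     forall i, Cn m A (f' i)
   else True).
Arguments Cn : simpl never.

Lemma Cn_cont n A f x : Cn n A f -> A x -> {for x, continuous f}.
Proof. by case: n => [|n] [+ _]; apply. Qed.

Lemma Cn0I A f : (forall x, A x -> {for x, continuous f}) -> Cn 0 A f.
Proof. by []. Qed.

Lemma CnSI n A f (f' : 'I_2 -> R * R -> R) : (forall x, A x -> {for x, continuous f}) ->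
  (forall i x, A x -> is_derive x (e_ i) f (f' i x)) ->
  (forall i, Cn n A (f' i)) -> Cn n.+1 A f.
Proof. by move=> cf df cf'; split => //; exists f'. Qed.

Lemma CnSE n A f : Cn n.+1 A f -> exists f' : 'I_2 -> R * R -> R,
  (forall i x, A x -> is_derive x (e_ i) f (f' i x)) /\
  (forall i, Cn n A (f' i)).
Proof. by case. Qed.

Lemma CnW n A f : Cn n.+1 A f -> Cn n A f.
Proof.
elim: n f => [|n IH] f Hf; first by apply: Cn0I => x; exact: Cn_cont Hf.
have [f' [df cf']] := CnSE Hf.
by apply: CnSI df _ => [x|i]; [exact: Cn_cont Hf|exact: IH].
Qed.

Lemma near_open A x : open A -> A x -> \near x, A x.
Proof. by move=> oA Ax; apply: open_nbhs_nbhs; split. Qed.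

Lemma is_derive_eq_on A f g v x d : open A -> A x -> {in A, f =1 g} ->
  is_derive x v f d -> is_derive x v g d.
Proof.
move=> oA Ax fg; apply: near_eq_is_derive.
by near=> y; apply: fg; rewrite inE; near: y; exact: near_open.
Unshelve. all: by end_near. Qed.

Lemma continuous_eq_on A f g x : open A -> A x -> {in A, f =1 g} ->
  {for x, continuous f} -> {for x, continuous g}.
Proof.
move=> oA Ax fg cf; rewrite /prop_for /continuous_at -fg ?inE//.
apply: cvg_trans cf; apply: near_eq_cvg.
by near=> y; apply: fg; rewrite inE; near: y; exact: near_open.
Unshelve. all: by end_near. Qed.

Lemma Cn_eq n A f g : open A -> {in A, f =1 g} -> Cn n A f -> Cn n A g.
Proof.
move=> oA fg; have cg m : Cn m A f -> forall x, A x -> {for x, continuous g}.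
  by move=> Hf x Ax; apply: (continuous_eq_on oA Ax fg); exact: Cn_cont Hf Ax.
case: n => [|n] Hf; first exact: Cn0I (cg _ Hf).
have [f' [df cf']] := CnSE Hf.
apply: CnSI (cg _ Hf) _ cf' => i x Ax.
by apply: (is_derive_eq_on oA Ax fg); exact: df.
Qed.

Lemma CnD n A f g : Cn n A f -> Cn n A g -> Cn n A (fun x => f x + g x).
Proof.
elim: n f g => [|n IH] f g Hf Hg; have cfg : forall x, A x ->
    {for x, continuous (fun x => f x + g x)} by
  move=> x Ax; apply: continuousD; [exact: Cn_cont Hf _|exact: Cn_cont Hg _].
  exact: Cn0I.
have [f' [df cf']] := CnSE Hf; have [g' [dg cg']] := CnSE Hg.
apply: (CnSI (f' := fun i x => f' i x + g' i x)) cfg _ _ => [i x Ax|i];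
  last exact: IH.
by have := df i x Ax; have := dg i x Ax => ? ?; apply: is_deriveD.
Qed.

Lemma Cn_cst n A (c : R) : Cn n A (fun=> c).
Proof.
elim: n c => [|n IH] c; first by apply: Cn0I => x _; exact: cst_continuous.
have dc i x : A x -> is_derive x (e_ i) (fun=> c : R) (0 : R).
  by move=> _; exact: is_derive_cst.
by apply: CnSI _ dc _ => [x _|i]; [exact: cst_continuous|exact: IH].
Qed.

Lemma CnM n A f g : Cn n A f -> Cn n A g -> Cn n A (fun x => f x * g x).
Proof.
elim: n f g => [|n IH] f g Hf Hg; have cfg : forall x, A x ->
    {for x, continuous (fun x => f x * g x)} by
  move=> x Ax; apply: continuousM; [exact: Cn_cont Hf _|exact: Cn_cont Hg _].
  exact: Cn0I.
have [f' [df cf']] := CnSE Hf; have [g' [dg cg']] := CnSE Hg.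
apply: (CnSI (f' := fun i x => f x * g' i x + g x * f' i x)) cfg _ _ => [i x Ax|i].
  by have := df i x Ax; have := dg i x Ax => ? ?; apply: is_deriveM.
by apply: CnD; apply: IH => //; exact: CnW.
Qed.

Lemma CnZ n A c f : Cn n A f -> Cn n A (fun x => c * f x).
Proof. by move=> cf; apply: CnM => //; exact: Cn_cst. Qed.

Lemma cont_fst x : {for x, continuous (fst : R * R -> R)}.
Proof. exact: cvg_fst. Qed.

Lemma cont_snd x : {for x, continuous (snd : R * R -> R)}.
Proof. exact: cvg_snd. Qed.

Lemma I2_ind (P : 'I_2 -> Prop) : P 0 -> P 1 -> forall i, P i.
Proof.
move=> P0 P1 [[|[|//]] lti].
- by have -> : Ordinal lti = 0 by exact: val_inj.
- by have -> : Ordinal lti = 1 by exact: val_inj.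
Qed.

Lemma is_derive_fst i x : is_derive x (e_ i) (fst : R * R -> R) (i == 0)%:R.
Proof.
case: x => a b; move: i; apply: I2_ind.
- by apply/slice1; exact: is_derive_id.
- by apply/slice2; exact: is_derive_cst.
Qed.

Lemma is_derive_snd i x : is_derive x (e_ i) (snd : R * R -> R) (i == 1)%:R.
Proof.
case: x => a b; move: i; apply: I2_ind.
- by apply/slice1; exact: is_derive_cst.
- by apply/slice2; exact: is_derive_id.
Qed.

Lemma Cn_fst n A : Cn n A fst.
Proof.
case: n => [|n]; first by apply: Cn0I => x _; exact: cont_fst.
apply: CnSI => [x _|i x _|i]; [exact: cont_fst|exact: is_derive_fst|].
exact: Cn_cst.
Qed.

Lemma Cn_snd n A : Cn n A snd.
Proof.
case: n => [|n]; first by apply: Cn0I => x _; exact: cont_snd.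
apply: CnSI => [x _|i x _|i]; [exact: cont_snd|exact: is_derive_snd|].
exact: Cn_cst.
Qed.

(** The derivatives hidden in [Cn] agree with [partial] on [A] only; openness of [A] lets [Cn_eq]
    carry regularity across that agreement, and the induction on the word of derivatives goes
    through. *)
Lemma smooth_onP A f : open A -> smooth_on A f <-> forall n, Cn n A f.
Proof.
move=> oA; split.
  move=> sf n; have : forall s, Cn n A (partials s f).
    elim: n => [|n IH] s; first by apply: Cn0I => x Ax; have [] := sf s x Ax.
    apply: (CnSI (f' := fun i => partials (i :: s) f)) => [x Ax|i x Ax|i].
    - by have [] := sf s x Ax.
    - by apply/derivableP; have [_] := sf s x Ax.
    - exact: IH.
  by move=> /(_ [::]).
move=> cf s.
have cs : forall n, Cn n A (partials s f).
  elim: s => // i s IH n; have [g [dg cg]] := CnSE (IH n.+1).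
  apply: Cn_eq (cg i) => // x; rewrite inE => Ax.
  by have [_ <-] := dg i x Ax.
move=> x Ax; split; first exact: Cn_cont (cs 0%N) Ax.
by move=> i; have [g [dg _]] := CnSE (cs 1%N); have [] := dg i x Ax.
Qed.

Lemma partials_rcons s i f : partials (rcons s i) f = partials s (partial i f).
Proof. by rewrite /partials foldr_rcons. Qed.

Lemma smooth_on_partial A i f : smooth_on A f -> smooth_on A (partial i f).
Proof. by move=> sf s x Ax; have := sf (rcons s i) x Ax; rewrite partials_rcons. Qed.

Lemma smooth_on_derive A i f x : smooth_on A f -> A x ->
  is_derive x (e_ i) f (partial i f x).
Proof. by move=> sf Ax; apply/derivableP; have [_] := sf [::] x Ax. Qed.

Lemma smooth_on_cont A f x : smooth_on A f -> A x -> {for x, continuous f}.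
Proof. by move=> sf Ax; have [] := sf [::] x Ax. Qed.

Lemma partials_eq_on A s f g : open A -> {in A, f =1 g} ->
  {in A, partials s f =1 partials s g}.
Proof.
move=> oA fg; elim: s => //= i s IH x; rewrite inE => Ax.
rewrite /partial; apply: near_eq_derive.
by near=> y; apply: IH; rewrite inE; near: y; exact: near_open.
Unshelve. all: by end_near. Qed.

Lemma smooth_on_eq A f g : open A -> {in A, f =1 g} -> smooth_on A f ->
  smooth_on A g.
Proof.
move=> oA fg /smooth_onP sf; apply/smooth_onP => // n.
by apply: Cn_eq fg _ => //; exact: sf.
Qed.

Lemma smooth_onS A B f : B `<=` A -> smooth_on A f -> smooth_on B f.
Proof. by move=> BA sf s x /BA; exact: sf. Qed.

Lemma smooth_onU A B f : smooth_on A f -> smooth_on B f -> smooth_on (A `|` B) f.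
Proof. by move=> sA sB s x []; [exact: sA|exact: sB]. Qed.

Lemma smooth_onD A f g : open A -> smooth_on A f -> smooth_on A g ->
  smooth_on A (fun x => f x + g x).
Proof.
by move=> oA /smooth_onP sf /smooth_onP sg; apply/smooth_onP => // n;
  apply: CnD; [exact: sf|exact: sg].
Qed.

Lemma smooth_onM A f g : open A -> smooth_on A f -> smooth_on A g ->
  smooth_on A (fun x => f x * g x).
Proof.
by move=> oA /smooth_onP sf /smooth_onP sg; apply/smooth_onP => // n;
  apply: CnM; [exact: sf|exact: sg].
Qed.

Lemma smooth_on_cst A c : open A -> smooth_on A (fun=> c).
Proof. by move=> oA; apply/smooth_onP => // n; exact: Cn_cst. Qed.

Lemma smooth_onZ A c f : open A -> smooth_on A f -> smooth_on A (fun x => c * f x).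
Proof. by move=> oA sf; exact: (smooth_onM oA (smooth_on_cst c oA) sf). Qed.

Lemma smooth_on_fst A : open A -> smooth_on A fst.
Proof. by move=> oA; apply/smooth_onP => // n; exact: Cn_fst. Qed.

Lemma smooth_on_snd A : open A -> smooth_on A snd.
Proof. by move=> oA; apply/smooth_onP => // n; exact: Cn_snd. Qed.

Lemma smooth_onX A f n : open A -> smooth_on A f -> smooth_on A (fun x => f x ^+ n).
Proof.
move=> oA sf; elim: n => [|n IH]; first exact: smooth_on_cst.
under eq_fun do rewrite exprS.
exact: (smooth_onM oA sf IH).
Qed.

Lemma smooth_onN A f : open A -> smooth_on A f -> smooth_on A (fun x => - f x).
Proof.
move=> oA sf; under eq_fun do rewrite -mulN1r.
exact: (smooth_onZ (-1) oA sf).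
Qed.

Lemma smooth_onB A f g : open A -> smooth_on A f -> smooth_on A g ->
  smooth_on A (fun x => f x - g x).
Proof. by move=> oA sf sg; exact: (smooth_onD oA sf (smooth_onN oA sg)). Qed.

Lemma partialD A i f g x : smooth_on A f -> smooth_on A g -> A x ->
  partial i (fun x => f x + g x) x = partial i f x + partial i g x.
Proof.
move=> sf sg Ax; have := smooth_on_derive i sf Ax; have := smooth_on_derive i sg Ax.
by move=> dg df; have [_] := is_deriveD df dg.
Qed.

Lemma partialM A i f g x : smooth_on A f -> smooth_on A g -> A x ->
  partial i (fun x => f x * g x) x = f x * partial i g x + partial i f x * g x.
Proof.
move=> sf sg Ax; have := smooth_on_derive i sf Ax; have := smooth_on_derive i sg Ax.
move=> dg df; have [_] := is_deriveM df dg.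
by rewrite /partial => ->; congr (_ + _); exact: mulrC.
Qed.

Lemma partialZ A i c f x : smooth_on A f -> A x ->
  partial i (fun x => c * f x) x = c * partial i f x.
Proof.
move=> sf Ax; have := smooth_on_derive i sf Ax.
by move=> df; have [_] := is_deriveZ c df.
Qed.

(** The interval between two points in either order, so that increments may have any sign. *)
Definition bet (a b z : R) := (a <= z <= b) || (b <= z <= a).

Lemma bet_dist (a b z : R) : bet a b z -> `|z - a| <= `|b - a|.
Proof.
move=> /orP[] /andP[h1 h2]; first by rewrite !ger0_norm; lra.
by rewrite !ler0_norm; lra.
Qed.

Lemma mean_value (f df : R -> R) (a b : R) :
  (forall z, bet a b z -> is_derive z 1 f (df z)) ->
  exists2 z, bet a b z & f b - f a = df z * (b - a).
Proof.
move=> D; have C z : bet a b z -> {for z, continuous f}.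
  by move=> /D[dz _]; apply: differentiable_continuous; apply/derivable1_diffP.
have [ab|ba] := leP a b.
- have [z||z] := @MVT_segment R f df a b ab.
  + by rewrite in_itv/= => /andP[z1 z2]; apply: D; rewrite /bet (ltW z1) (ltW z2).
  + apply: continuous_in_subspaceT => z; rewrite inE/= in_itv/= => h.
    by apply: C; rewrite /bet h.
  + by rewrite in_itv/= => h e; exists z => //; rewrite /bet h.
- have [z||z] := @MVT_segment R f df b a (ltW ba).
  + by rewrite in_itv/= => /andP[z1 z2]; apply: D; rewrite /bet (ltW z1) (ltW z2) orbT.
  + apply: continuous_in_subspaceT => z; rewrite inE/= in_itv/= => h.
    by apply: C; rewrite /bet h orbT.
  + rewrite in_itv/= => h e; exists z; first by rewrite /bet h orbT.
    by rewrite -opprB e -mulrN opprB.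
Qed.

Lemma ball2E (a b x1 x2 e : R) :
  ball ((a, b) : R * R) e ((x1, x2) : R * R) <-> `|a - x1| < e /\ `|b - x2| < e.
Proof. by []. Qed.

Lemma cont2P f (p : R * R) : {for p, continuous f} <->
  forall e : R, 0 < e -> exists2 r : R, 0 < r &
    forall x1 x2 : R, `|p.1 - x1| < r -> `|p.2 - x2| < r -> `|f p - f (x1, x2)| < e.
Proof.
case: p => a b; rewrite /prop_for /continuous_at; split.
- move=> /cvgrPdist_lt cf e /cf /nbhs_ballP[r /= r0 h]; exists r => // x1 x2 h1 h2.
  exact: h.
- move=> h; apply/cvgrPdist_lt => e /h[r r0 {}h].
  have : nbhs (a, b) (ball (a, b) r) by exact: nbhsx_ballx.
  by apply: filterS => -[x1 x2] /ball2E[]; exact: h.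
Qed.

Lemma open2P A a b : open A -> A (a, b) -> exists2 r : R, 0 < r &
  forall x1 x2 : R, `|a - x1| < r -> `|b - x2| < r -> A (x1, x2).
Proof.
move=> oA Ap; have /nbhs_ballP[r /= r0 rA] : nbhs (a, b) A by exact: near_open.
by exists r => // x1 x2 h1 h2; apply: rA; apply/ball2E.
Qed.

(* A Hadamard-type factorisation with continuous slopes: it gives the chain rule along any path. *)
Lemma slopes A (f1 f2 : R * R -> R) f p : open A -> A p ->
  (forall x, A x -> is_derive x (e_ 0) f (f1 x)) ->
  (forall x, A x -> is_derive x (e_ 1) f (f2 x)) ->
  {for p, continuous f1} -> {for p, continuous f2} ->
  exists q1 q2 : R * R -> R, [/\ {for p, continuous q1}, {for p, continuous q2},
    q1 p = f1 p, q2 p = f2 p &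
    forall x, f x - f p = q1 x * (x.1 - p.1) + q2 x * (x.2 - p.2)].
Proof.
case: p => a b oA Ap df1 df2 cf1 cf2.
have [r r0 rA] := open2P oA Ap.
(* The path from p to x runs vertically along x.1 = a, then horizontally. Each slope is the
   difference quotient on its leg, replaced by the derivative at p where the leg degenerates. *)
pose q1 x := if x.1 == a then f1 (a, b) else (f x - f (a, x.2)) / (x.1 - a).
pose q2 x := if x.2 == b then f2 (a, b) else (f (a, x.2) - f (a, b)) / (x.2 - b).
have mvt1 (x1 x2 : R) : `|a - x1| < r -> `|b - x2| < r ->
    exists2 z, `|z - a| <= `|x1 - a| & q1 (x1, x2) = f1 (z, x2) \/ q1 (x1, x2) = f1 (a, b).
  move=> h1 h2; rewrite /q1 /=; case: eqVneq => [->|x1a].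
    by exists a => //; right.
  have [|z hz e] := @mean_value (fun t => f (t, x2)) (fun z => f1 (z, x2)) a x1.
    move=> z /bet_dist hz; apply/slice1/df1/rA => //.
    by rewrite distrC (le_lt_trans hz)// distrC.
  exists z; first exact: bet_dist.
  by left; rewrite e mulfK// subr_eq0.
have mvt2 (x2 : R) : `|b - x2| < r ->
    exists2 z, `|z - b| <= `|x2 - b| & forall x1 : R, q2 (x1, x2) = f2 (a, z).
  move=> h2; rewrite /q2 /=; case: eqVneq => [->|x2b].
    by exists b.
  have [|z hz e] := @mean_value (fun t => f (a, t)) (fun z => f2 (a, z)) b x2.
    move=> z /bet_dist hz; apply/slice2/df2/rA => //; first by rewrite subrr normr0.
    by rewrite distrC (le_lt_trans hz)// distrC.
  exists z; first exact: bet_dist.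
  by rewrite e mulfK// subr_eq0.
have q1p : q1 (a, b) = f1 (a, b) by rewrite /q1 eqxx.
have q2p : q2 (a, b) = f2 (a, b) by rewrite /q2 eqxx.
exists q1, q2; split => //.
- apply/cont2P => e e0 /=; have /cont2P/(_ e e0)[s s0 /= hs] := cf1.
  exists (Num.min r s); first by rewrite lt_min r0.
  move=> x1 x2; rewrite !lt_min => /andP[h1 h1'] /andP[h2 h2'].
  have [z hz [->|->]] := mvt1 x1 x2 h1 h2; rewrite q1p; last by rewrite subrr normr0.
  by apply: hs => //; rewrite distrC (le_lt_trans hz)// distrC.
- apply/cont2P => e e0 /=; have /cont2P/(_ e e0)[s s0 /= hs] := cf2.
  exists (Num.min r s); first by rewrite lt_min r0.
  move=> x1 x2; rewrite !lt_min => /andP[h1 h1'] /andP[h2 h2'].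
  have [z hz ->] := mvt2 x2 h2; rewrite q2p.
  apply: hs => //; first by rewrite subrr normr0.
  by rewrite distrC (le_lt_trans hz)// distrC.
- move=> [x1 x2]; rewrite /q1 /q2 /=; case: eqVneq => [->|x1a];
    case: eqVneq => [->|x2b]; rewrite ?subrr ?mulr0 ?add0r ?addr0 ?mulfVK ?subr_eq0//.
  by rewrite addrA subrK.
Qed.

(** Divide the identity of [slopes] by h: the difference quotients of [z1] and [z2] are multiplied
    by slopes that converge, because a directional derivative along [v] already forces continuity
    along that line. *)
Lemma chain_rule A (f1 f2 : R * R -> R) f (z1 z2 : R * R -> R) x v (d1 d2 : R) :
  open A -> A (z1 x, z2 x) ->
  (forall x, A x -> is_derive x (e_ 0) f (f1 x)) ->
  (forall x, A x -> is_derive x (e_ 1) f (f2 x)) ->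
  {for (z1 x, z2 x), continuous f1} -> {for (z1 x, z2 x), continuous f2} ->
  is_derive x v z1 d1 -> is_derive x v z2 d2 ->
  is_derive x v (fun y => f (z1 y, z2 y))
    (f1 (z1 x, z2 x) * d1 + f2 (z1 x, z2 x) * d2).
Proof.
move=> oA Ap df1 df2 cf1 cf2 [dz1 <-] [dz2 <-].
have [q1 [q2 [cq1 cq2 <- <- fE]]] := slopes oA Ap df1 df2 cf1 cf2.
have dn (z : R * R -> R) : derivable z x v ->
    z (h *: v + x) @[h --> 0^'] --> z x.
  move=> dz; have -> : (fun h : R => z (h *: v + x)) =
      (fun h : R => h * (h^-1 * (z (h *: v + x) - z x)) + z x) :> (R -> R).
    apply/funext => h; have [->|h0] := eqVneq h 0.
      by rewrite scale0r add0r subrr !(mul0r, mulr0) add0r.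
    by rewrite mulrA divff// mul1r subrK.
  rewrite -[X in _ --> X]add0r -[X in X + _](mul0r ('D_v z x)).
  apply: cvgD; last exact: cvg_cst.
  apply: cvgM; last exact: dz.
  exact: (@cvg_within _ (nbhs (0 : R))).
have cz (q : R * R -> R) : {for (z1 x, z2 x), continuous q} ->
    q (z1 (h *: v + x), z2 (h *: v + x)) @[h --> 0^'] --> q (z1 x, z2 x).
  move=> cq; apply: (@cvg_comp _ _ _ (fun h : R => (z1 (h *: v + x), z2 (h *: v + x))) q _
    (nbhs (z1 x, z2 x))) => //.
  exact: (cvg_pair (dn _ dz1) (dn _ dz2)).
have L : h^-1 *: (f (z1 (h *: v + x), z2 (h *: v + x)) - f (z1 x, z2 x)) @[h --> 0^'] -->
    q1 (z1 x, z2 x) * 'D_v z1 x + q2 (z1 x, z2 x) * 'D_v z2 x.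
  have -> : (fun h : R => h^-1 *: (f (z1 (h *: v + x), z2 (h *: v + x)) - f (z1 x, z2 x)))
     = (fun h => q1 (z1 (h *: v + x), z2 (h *: v + x)) * (h^-1 *: (z1 (h *: v + x) - z1 x))
        + q2 (z1 (h *: v + x), z2 (h *: v + x)) * (h^-1 *: (z2 (h *: v + x) - z2 x))).
    apply/funext => h; rewrite fE /= scalerDr; congr (_ + _).
    - by rewrite /GRing.scale/= mulrCA.
    - by rewrite /GRing.scale/= mulrCA.
  by apply: cvgD; apply: cvgM; [exact: cz|exact: dz1|exact: cz|exact: dz2].
apply: DeriveDef; first by apply/cvg_ex; eexists; exact: L.
exact: (cvg_lim (@Rhausdorff R) L).
Qed.

(** Schwarz's theorem through the double difference of f over a square of side e: the mean value
    theorem applied twice, in either order, writes it as e^2 times one of the mixed derivatives at a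
    point of the square, and continuity at the corner concludes. *)
Lemma partialC A i j f x : open A -> A x -> smooth_on A f ->
  partial i (partial j f) x = partial j (partial i f) x.
Proof.
move=> oA; wlog: i j / i = 0 /\ j = 1.
  move=> H Ax sf; move: i; apply: I2_ind; move: j; apply: I2_ind.
  - by [].
  - exact: (H _ _ (conj erefl erefl) Ax sf).
  - exact: (esym (H _ _ (conj erefl erefl) Ax sf)).
  - by [].
case: x => a b [-> ->] Ax sf {i j}.
have [r r0 rA] := open2P oA Ax.
have sf0 := smooth_on_partial 0 sf; have sf1 := smooth_on_partial 1 sf.
have sf01 := smooth_on_partial 0 sf1; have sf10 := smooth_on_partial 1 sf0.
have aux (t1 t2 t3 t4 e p q : R) : e != 0 -> t1 - t2 - (t3 - t4) = p * e * e ->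
    t1 - t3 - (t2 - t4) = q * e * e -> q = p.
  move=> e0 e1 e2; apply: (@mulIf _ (e * e)); first by rewrite mulf_neq0.
  by rewrite !mulrA -e1 -e2; ring.
have aux2 (t1 t2 t3 t4 e : R) : t3 = t4 -> `|t2 - t4| < e / 2 ->
    `|t1 - t3| < e / 2 -> `|t1 - t2| <= e.
  move=> ->; rewrite !ltr_norml => /andP[? ?] /andP[? ?].
  by rewrite ler_norml; apply/andP; split; lra.
have key (e : R) : 0 < e -> e < r -> exists x1 x2 y1 y2 : R, [/\ `|a - x1| <= e, `|b - x2| <= e,
    `|a - y1| <= e, `|b - y2| <= e &
    partial 0 (partial 1 f) (x1, x2) = partial 1 (partial 0 f) (y1, y2)].
  move=> e0 er.
  have ae z : bet a (a + e) z -> `|a - z| <= e.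
    by move=> /bet_dist; rewrite addrAC subrr add0r (gtr0_norm e0) distrC.
  have be z : bet b (b + e) z -> `|b - z| <= e.
    by move=> /bet_dist; rewrite addrAC subrr add0r (gtr0_norm e0) distrC.
  have eb : `|b - (b + e)| < r by rewrite opprD addrA subrr add0r normrN gtr0_norm.
  have ea : `|a - (a + e)| < r by rewrite opprD addrA subrr add0r normrN gtr0_norm.
  have bb : `|b - b| < r by rewrite subrr normr0.
  have aa : `|a - a| < r by rewrite subrr normr0.
  have [z hz|y1 hy1 e1] := @mean_value (fun t => f (t, b + e) - f (t, b))
      (fun t => partial 0 f (t, b + e) - partial 0 f (t, b)) a (a + e).
    have h := le_lt_trans (ae _ hz) er.
    by apply: is_deriveB; apply/slice1; apply: smooth_on_derive sf _; apply: rA.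
  have h1 := le_lt_trans (ae _ hy1) er.
  have [z hz|y2 hy2 e2] := @mean_value (fun t => partial 0 f (y1, t))
      (fun t => partial 1 (partial 0 f) (y1, t)) b (b + e).
    have h := le_lt_trans (be _ hz) er.
    by apply/slice2; apply: smooth_on_derive sf0 _; apply: rA.
  have [z hz|x2 hx2 e3] := @mean_value (fun t => f (a + e, t) - f (a, t))
      (fun t => partial 1 f (a + e, t) - partial 1 f (a, t)) b (b + e).
    have h := le_lt_trans (be _ hz) er.
    by apply: is_deriveB; apply/slice2; apply: smooth_on_derive sf _; apply: rA.
  have h2 := le_lt_trans (be _ hx2) er.
  have [z hz|x1 hx1 e4] := @mean_value (fun t => partial 1 f (t, x2))
      (fun t => partial 0 (partial 1 f) (t, x2)) a (a + e).
    have h := le_lt_trans (ae _ hz) er.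
    by apply/slice1; apply: smooth_on_derive sf1 _; apply: rA.
  exists x1, x2, y1, y2; split; [exact: ae|exact: be|exact: ae|exact: be|].
  move: e1 e3; rewrite e2 e4 ![_ + e]addrC !addrK.
  by apply: aux; rewrite gt_eqF.
apply/eqP; rewrite -subr_eq0 -normr_le0; apply/ler_addgt0Pl => e e0; rewrite addr0.
have e2 : 0 < e / 2 by rewrite divr_gt0.
have /cont2P/(_ _ e2)[r1 r10 h1] := smooth_on_cont sf01 Ax.
have /cont2P/(_ _ e2)[r2 r20 h2] := smooth_on_cont sf10 Ax.
pose s := Num.min r (Num.min r1 r2) / 2.
have m0 : 0 < Num.min r (Num.min r1 r2) by rewrite !lt_min r0 r10 r20.
have s0 : 0 < s by rewrite divr_gt0.
have : s < Num.min r (Num.min r1 r2) by rewrite /s ltr_pdivrMr// ltr_pMr// ltr1n.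
rewrite !lt_min => /andP[sr /andP[sr1 sr2]].
have [x1 [x2 [y1 [y2 [ax bx ay by_ E]]]]] := key s s0 sr.
have := h1 x1 x2 (le_lt_trans ax sr1) (le_lt_trans bx sr1).
have := h2 y1 y2 (le_lt_trans ay sr2) (le_lt_trans by_ sr2).
exact: aux2 E.
Qed.

End Calculus.

(** * Smooth compositions, cut-offs and the homogeneous kernels *)

Section SmoothMore.
Context {R : realType}.
Implicit Types (A B : set (R * R)) (f g : R * R -> R) (x y p : R * R).

Notation e_ := (@basis2 R).

Lemma smooth_partials f s : smooth f -> smooth (partials s f).
Proof. by move=> sf; elim: s => [//|i s]; exact: (@smooth_on_partial _ setT). Qed.

Lemma smooth_partialC i j f : smooth f ->
  partial i (partial j f) = partial j (partial i f).
Proof. by move=> sf; apply/funext => x; apply: partialC sf; [exact: openT|]. Qed.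

Lemma partials_cat s t f : partials (s ++ t) f = partials s (partials t f).
Proof. by rewrite /partials foldr_cat. Qed.

Lemma partials_comm s i f : smooth f ->
  partial i (partials s f) = partials s (partial i f).
Proof.
move=> sf; elim: s => [//|j s /= <-].
by rewrite (smooth_partialC _ _ (smooth_partials s sf)).
Qed.

Lemma partials_pderiv s f : smooth f ->
  partials s f = pderiv (count_mem 0 s) (count_mem 1 s) f.
Proof.
move=> sf; elim: s => // i s /= ->; move: i; apply: I2_ind; first by [].
rewrite /pderiv !partials_cat partials_comm; last exact: smooth_partials.
by rewrite add0n.
Qed.

(** The induction on the order quantifies over f, since differentiating the composite replaces f by
    its partial derivatives while the inner map stays the same. *)
Lemma smooth_on_comp A B f (z1 z2 : R * R -> R) : open A -> open B ->
  smooth_on B f -> smooth_on A z1 -> smooth_on A z2 ->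
  (forall x, A x -> B (z1 x, z2 x)) -> smooth_on A (fun x => f (z1 x, z2 x)).
Proof.
move=> oA oB sf sz1 sz2 AB; apply/smooth_onP => // n.
elim: n f sf => [|n IH] f sf; have cf x : A x ->
    {for x, continuous (fun x => f (z1 x, z2 x))} by
  move=> Ax; apply: (@continuous_comp _ _ _ (fun x => (z1 x, z2 x)) f);
    [exact: (cvg_pair (smooth_on_cont sz1 Ax) (smooth_on_cont sz2 Ax))
    |exact: smooth_on_cont sf (AB _ Ax)].
  exact: Cn0I.
apply: (CnSI (f' := fun i x => partial 0 f (z1 x, z2 x) * partial i z1 x
  + partial 1 f (z1 x, z2 x) * partial i z2 x)) => // [i x Ax|i].
- apply: (chain_rule oB (AB _ Ax)).
  + by move=> y; exact: smooth_on_derive.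
  + by move=> y; exact: smooth_on_derive.
  + exact: smooth_on_cont (smooth_on_partial _ sf) (AB _ Ax).
  + exact: smooth_on_cont (smooth_on_partial _ sf) (AB _ Ax).
  + exact: smooth_on_derive sz1 Ax.
  + exact: smooth_on_derive sz2 Ax.
- have s1 := smooth_on_partial i sz1; have s2 := smooth_on_partial i sz2.
  apply: CnD; apply: CnM.
  + exact: IH (smooth_on_partial _ sf).
  + by move/smooth_onP: s1; exact.
  + exact: IH (smooth_on_partial _ sf).
  + by move/smooth_onP: s2; exact.
Qed.

Lemma partial_comp A B i f (z1 z2 : R * R -> R) x : open B ->
  smooth_on B f -> smooth_on A z1 -> smooth_on A z2 ->
  A x -> B (z1 x, z2 x) -> partial i (fun x => f (z1 x, z2 x)) x =
  partial 0 f (z1 x, z2 x) * partial i z1 x + partial 1 f (z1 x, z2 x) * partial i z2 x.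
Proof.
move=> oB sf sz1 sz2 Ax Bx.
have [] // := chain_rule oB Bx (fun y => @smooth_on_derive R B 0 f y sf)
  (fun y => @smooth_on_derive R B 1 f y sf)
  (smooth_on_cont (smooth_on_partial _ sf) Bx)
  (smooth_on_cont (smooth_on_partial _ sf) Bx)
  (smooth_on_derive i sz1 Ax) (smooth_on_derive i sz2 Ax).
Qed.

Lemma smooth_onV A g : open A -> smooth_on A g -> (forall x, A x -> g x != 0) ->
  smooth_on A (fun x => (g x)^-1).
Proof.
move=> oA sg g0; apply/smooth_onP => // n.
have cg x : A x -> {for x, continuous (fun x => (g x)^-1)}.
  by move=> Ax; apply: continuousV; [exact: g0|exact: smooth_on_cont sg Ax].
elim: n => [|n IH]; first exact: Cn0I.
apply: (CnSI (f' := fun i x => -1 * (((g x)^-1 * (g x)^-1) * partial i g x))) => // [i x Ax|i].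
  have dg := smooth_on_derive i sg Ax.
  case: dg => dg dE; apply: DeriveDef; first by apply: derivableV => //; exact: g0.
  by rewrite deriveV ?g0// dE mulN1r -mulNr -exprVn expr2.
apply: CnZ; apply: CnM; first exact: CnM.
by move/smooth_onP: (smooth_on_partial i sg); exact.
Qed.

Lemma is_derive_comp1 (h h' : R -> R) (g : R * R -> R) x v d (oA : set R) :
  open oA -> oA (g x) ->
  (forall t, oA t -> is_derive t 1 h (h' t)) -> {for g x, continuous h'} ->
  is_derive x v g d -> is_derive x v (fun y => h (g y)) (h' (g x) * d).
Proof.
move=> op Ag dh ch dg.
pose F := fun y : R * R => h y.1; pose F1 := fun y : R * R => h' y.1.
have oB : open [set y : R * R | oA y.1].
  by apply: (@open_comp _ _ fst) => // y _; exact: cont_fst.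
have := @chain_rule R _ F1 (fun=> 0) F g (fun=> 0) x v d 0 oB Ag.
rewrite mul0r addr0; apply => //.
- by move=> [a b] /= Aa; apply/slice1/dh.
- by move=> [a b] /= Aa; apply/slice2; exact: (is_derive_cst (h a)).
- exact: (@continuous_comp _ _ _ fst h' _ (@cont_fst R (g x, 0)) ch).
- exact: cst_continuous.
Qed.

(* The flat functions t^-n exp(-1/t), extended by 0 to t <= 0, form a family closed under
   differentiation. *)
Definition flat (n : nat) (t : R) : R := if 0 < t then t ^- n * expR (- t^-1) else 0.

Lemma flat_ge0 n t : 0 <= flat n t.
Proof.
by rewrite /flat; case: ifPn => // t0; rewrite mulr_ge0 ?expR_ge0// invr_ge0 exprn_ge0// ltW.
Qed.

Lemma flat_gt0 n t : 0 < t -> 0 < flat n t.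
Proof. by move=> t0; rewrite /flat t0 mulr_gt0 ?expR_gt0// invr_gt0 exprn_gt0. Qed.

Lemma flat_le0 n t : t <= 0 -> flat n t = 0.
Proof. by move=> t0; rewrite /flat ltNge t0. Qed.

(** With m = n + 2, exp(1/t) is the m-th power of exp(1/(m t)) >= 1/(m t). The exponent n + 2 leaves
    a factor t^2, which is what the derivative at 0 requires. *)
Lemma flat_le n t : flat n t <= n.+2%:R ^+ n.+2 * t ^+ 2.
Proof.
rewrite /flat; case: ifPn => [t0|_]; last by rewrite mulr_ge0 ?sqr_ge0// exprn_ge0.
have m0 : 0 < n.+2%:R :> R by [].
have u0 : 0 < t^-1 / n.+2%:R by rewrite divr_gt0 ?invr_gt0.
have H : (t^-1 / n.+2%:R) ^+ n.+2 <= expR t^-1.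
  have -> : t^-1 = n.+2%:R * (t^-1 / n.+2%:R) by rewrite mulrC mulfVK// gt_eqF.
  rewrite expRM_natl; apply: lerXn2r; rewrite ?nnegrE ?expR_ge0 ?(mulrC n.+2%:R) ?mulfVK ?gt_eqF ?ltW//.
  by apply: lt_le_trans (expR_ge1Dx _); rewrite ltrDr.
rewrite expRN ler_pdivrMr ?exprn_gt0//.
have -> : t ^- n = n.+2%:R ^+ n.+2 * t ^+ 2 * (t^-1 / n.+2%:R) ^+ n.+2.
  rewrite exprMn !exprVn; have t1 : t ^+ n != 0 by rewrite expf_neq0// gt_eqF.
  have c1 : n.+2%:R ^+ n.+2 != 0 :> R by rewrite expf_neq0// gt_eqF.
  have t2 : t ^+ 2 != 0 by rewrite expf_neq0// gt_eqF.
  have -> : t ^- n.+2 = (t ^+ n * t ^+ 2)^-1 by rewrite -exprD addn2.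
  move: c1 t1 t2; move: (n.+2%:R ^+ n.+2) (t ^+ n) (t ^+ 2) => c tn t2 c0 tn0 t20.
  by field; rewrite tn0 c0 t20.
  by apply: ler_wpM2l H; rewrite mulr_ge0 ?sqr_ge0// exprn_ge0.
exact: expR_gt0.
Qed.

Lemma is_derive_flat n (t : R) :
  is_derive t 1 (flat n) (- n%:R * flat n.+1 t + flat n.+2 t).
Proof.
have [t0|t0|->] := ltgtP t 0.
- rewrite !(flat_le0 _ (ltW t0)) mulr0 addr0.
  apply: (@near_eq_is_derive R R R (fun=> 0) (flat n) t 1 0 _ (is_derive_cst _ _ _)).
  by near=> y; rewrite flat_le0// ltW//; near: y; exact: lt_nbhsl.
- have tn0 : t != 0 by rewrite gt_eqF.
  have dV : is_derive t 1 (fun t : R => t^-1) (- t ^- 2).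
    by have := is_deriveV tn0 (is_derive_id t 1); rewrite /GRing.scale/= mulr1.
  have dn : is_derive t 1 (fun t : R => (t^-1) ^+ n) (n%:R * (t^-1) ^+ n.-1 * - t ^- 2).
    by have := is_deriveX n dV; rewrite exprfctE.
  have de : is_derive t 1 (fun t : R => expR (- t^-1)) (expR (- t^-1) * t ^- 2).
    have := @is_derive1_comp R expR (fun t => - t^-1) t _ _ (is_derive_expR (- t^-1))
      (is_deriveN dV).
    by rewrite opprK.
  have D := is_deriveM dn de.
  have E : (t^-1) ^+ n *: (expR (- t^-1) * t ^- 2) +
      expR (- t^-1) *: (n%:R * (t^-1) ^+ n.-1 * - t ^- 2) =
      - n%:R * flat n.+1 t + flat n.+2 t.
    rewrite /flat t0 /GRing.scale/= !exprVn; case: n {D dn} => [|n] /=.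
      by rewrite oppr0 !mul0r mulr0 addr0 add0r expr0 invr1 mul1r mulrC.
    rewrite !exprS; have : t ^+ n != 0 by rewrite expf_neq0.
    by move: (t ^+ n) (expR (- t^-1)) => tn u tn1; field; rewrite tn1 tn0.
  rewrite E in D; apply: (@near_eq_is_derive R R R _ (flat n) t 1 _ _ D).
  by near=> y; rewrite /flat ifT /GRing.mul/= ?exprVn//; near: y; exact: lt_nbhsr.
(* At t = 0 the quadratic bound of [flat_le] makes the difference quotient O(|h|). *)
- rewrite !flat_le0// mulr0 addr0.
  have L : h^-1 *: (flat n (h *: 1 + 0) - flat n 0) @[h --> 0^'] --> (0 : R).
    apply/cvgrPdist_lt => e e0.
    have c0 : 0 < n.+2%:R ^+ n.+2 :> R by rewrite exprn_gt0.
    near=> h; have h0 : h != 0 by near: h; exact: nbhs_dnbhs_neq.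
    rewrite sub0r normrN /GRing.scale/= addr0 mulr1 (flat_le0 _ (lexx 0)) subr0.
    rewrite normrM normfV ltr_pdivrMl ?normr_gt0// (ger0_norm (flat_ge0 _ _)).
    apply: (le_lt_trans (flat_le n h)).
    have -> : h ^+ 2 = `|h| * `|h| by rewrite -expr2 real_normK ?num_real.
    rewrite mulrCA ltr_pM2l ?normr_gt0// mulrC -ltr_pdivlMr//.
    by near: h; apply: dnbhs0_lt; exact: divr_gt0.
  apply: DeriveDef; first by apply/cvg_ex; eexists; exact: L.
  exact: (cvg_lim (@Rhausdorff R) L).
Unshelve. all: by end_near. Qed.

Lemma flat_cont n t : {for t, continuous (flat n)}.
Proof.
have [d _] := is_derive_flat n t.
by apply: differentiable_continuous; apply/derivable1_diffP.
Qed.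

Lemma smooth_on_flat A g n : open A -> smooth_on A g ->
  smooth_on A (fun x => flat n (g x)).
Proof.
move=> oA sg; apply/smooth_onP => // m.
elim: m n => [|m IH] n; have cf x : A x ->
    {for x, continuous (fun x => flat n (g x))} by
  move=> Ax; apply: (@continuous_comp _ _ _ g (flat n));
    [exact: smooth_on_cont sg Ax|exact: flat_cont].
  exact: Cn0I.
apply: (CnSI (f' := fun i x => (- n%:R * flat n.+1 (g x) + flat n.+2 (g x)) * partial i g x)) => // [i x Ax|i].
  apply: (@is_derive_comp1 (flat n) (fun t => - n%:R * flat n.+1 t + flat n.+2 t)
    g x _ _ setT openT) => // [t _||]; first exact: is_derive_flat.
    by apply: continuousD; [apply: continuousM; [exact: cst_continuous|]|]; exact: flat_cont.
  exact: smooth_on_derive sg Ax.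
apply: CnM; first by apply: CnD; [apply: CnZ|]; exact: IH.
by move/smooth_onP: (smooth_on_partial i sg); exact.
Qed.

Definition sqd p x : R := (x.1 - p.1) ^+ 2 + (x.2 - p.2) ^+ 2.

Lemma sqd_ge0 p x : 0 <= sqd p x.
Proof. by rewrite addr_ge0 ?sqr_ge0. Qed.

Lemma smooth_on_sqd A p : open A -> smooth_on A (sqd p).
Proof.
move=> oA.
have s1 : smooth_on A (fun x => x.1 - p.1).
  exact: (smooth_onB oA (smooth_on_fst oA) (smooth_on_cst p.1 oA)).
have s2 : smooth_on A (fun x => x.2 - p.2).
  exact: (smooth_onB oA (smooth_on_snd oA) (smooth_on_cst p.2 oA)).
exact: (smooth_onD oA (smooth_onX 2 oA s1) (smooth_onX 2 oA s2)).
Qed.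

Lemma continuous_sqd p : continuous (sqd p).
Proof. by move=> x; apply: (smooth_on_cont (smooth_on_sqd p openT)). Qed.

(** A smooth transition from 0 (for sqd <= s) to 1 (for sqd >= t). Using the squared distance keeps
    the square root, singular at [p], out of the construction. *)
Definition cutoff p (s t : R) x : R :=
  flat 0 (sqd p x - s) / (flat 0 (sqd p x - s) + flat 0 (t - sqd p x)).

Lemma cutoff0 p s t x : sqd p x <= s -> cutoff p s t x = 0.
Proof. by move=> h; rewrite /cutoff flat_le0 ?mul0r// subr_le0. Qed.

Lemma cutoff1 p s t x : s < t -> t <= sqd p x -> cutoff p s t x = 1.
Proof.
move=> st h; rewrite /cutoff [flat 0 (t - _)]flat_le0 ?subr_le0// addr0 divff//.
by rewrite gt_eqF// flat_gt0// subr_gt0 (lt_le_trans st).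
Qed.

Lemma smooth_cutoff p s t : s < t -> smooth (cutoff p s t).
Proof.
move=> st; have sq := smooth_on_sqd p openT.
have s1 := smooth_on_flat 0 openT (smooth_onB openT sq (smooth_on_cst s openT)).
have s2 := smooth_on_flat 0 openT (smooth_onB openT (smooth_on_cst t openT) sq).
have s3 := smooth_onD openT s1 s2.
apply: (smooth_onM openT s1 (smooth_onV openT s3 _)) => x _.
rewrite gt_eqF//; have [h|h] := leP (sqd p x) s.
  by rewrite ltr_wpDl ?flat_ge0// flat_gt0// subr_gt0 (le_lt_trans h).
by rewrite ltr_pwDl ?flat_ge0// flat_gt0// subr_gt0.
Qed.

Notation nrm := (@euclid_norm R).

Definition off0 : set (R * R) := [set x | x != 0].

Lemma sqd0E x : sqd 0 x = x.1 ^+ 2 + x.2 ^+ 2.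
Proof. by rewrite /sqd !subr0. Qed.

Lemma sqd0_gt0 x : (0 < sqd 0 x) = (x != 0).
Proof.
rewrite lt_neqAle sqd_ge0 andbT eq_sym sqd0E paddr_eq0 ?sqr_ge0// !sqrf_eq0.
by case: x.
Qed.

Lemma open_off0 : open off0.
Proof.
have -> : off0 = sqd 0 @^-1` [set t : R | 0 < t].
  by apply/seteqP; split => x; rewrite /off0 /= sqd0_gt0.
by apply: open_comp => [x _|]; [exact: continuous_sqd|exact: open_gt].
Qed.

Lemma nrmE x : nrm x = Num.sqrt (sqd 0 x).
Proof. by rewrite sqd0E. Qed.

Lemma nrm_gt0 x : (0 < nrm x) = (x != 0).
Proof. by rewrite nrmE sqrtr_gt0 sqd0_gt0. Qed.

Lemma nrm_sq x : nrm x ^+ 2 = x.1 ^+ 2 + x.2 ^+ 2.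
Proof. by rewrite sqr_sqrtr// addr_ge0 ?sqr_ge0. Qed.

Definition coo (i : 'I_2) x : R := if i == 0 then x.1 else x.2.

Lemma is_derive_nrm i x : x != 0 -> is_derive x (e_ i) nrm (coo i x / nrm x).
Proof.
move=> x0; have sq := smooth_on_derive i (smooth_on_sqd 0 openT) (I : setT x).
have E : partial i (sqd 0) x = 2 * coo i x.
  have d : is_derive x (e_ i) (sqd 0) (2 * coo i x).
    have -> : sqd 0 = (fst * fst + snd * snd : R * R -> R).
      by apply/funext => y; rewrite sqd0E !expr2.
    have := is_deriveD (is_deriveM (is_derive_fst i x) (is_derive_fst i x))
      (is_deriveM (is_derive_snd i x) (is_derive_snd i x)).
    move=> D; apply: (is_derive_eq D); rewrite /coo /GRing.scale/=.
    by move: i {sq D}; apply: I2_ind => /=; ring.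
  by case: d.
have Q0 : 0 < sqd 0 x by rewrite sqd0_gt0.
have -> : nrm = (fun y => Num.sqrt (sqd 0 y)) by apply/funext => y; exact: nrmE.
have := @is_derive_comp1 Num.sqrt (fun t => (2 * Num.sqrt t)^-1) (sqd 0) x (e_ i) _
  [set t : R | 0 < t] (@open_gt R 0) Q0 _ _ sq.
rewrite E => H; apply: is_derive_eq; first apply: H.
- apply: continuousV; first by rewrite mulf_neq0// gt_eqF// sqrtr_gt0.
  by apply: continuousM; [exact: cst_continuous|exact: sqrt_continuous].
- have : Num.sqrt (sqd 0 x) != 0 by rewrite gt_eqF// sqrtr_gt0.
  by move: (Num.sqrt _) (coo i x) => u v u0; field.
Qed.

Lemma nrm_cont x : {for x, continuous nrm}.
Proof.
have -> : nrm = (fun y => Num.sqrt (sqd 0 y)) by apply/funext => y; exact: nrmE.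
by apply: (@continuous_comp _ _ _ (sqd 0) Num.sqrt); [exact: continuous_sqd|exact: sqrt_continuous].
Qed.

Lemma smooth_nrm : smooth_on off0 nrm.
Proof.
apply/smooth_onP; first exact: open_off0.
have C x : off0 x -> {for x, continuous nrm} by move=> _; exact: nrm_cont.
have sco i n : Cn n off0 (coo i).
  by move: i; apply: I2_ind; [exact: Cn_fst|exact: Cn_snd].
(* Writing 1/|x| as |x|/|x|^2 expresses the gradient through [nrm] itself and smooth factors, so the
   induction on the order closes. *)
have D i x : off0 x -> is_derive x (e_ i) nrm (coo i x * (nrm x * (sqd 0 x)^-1)).
  move=> x0; apply: (is_derive_eq (is_derive_nrm i x0)).
  by rewrite sqd0E -nrm_sq; field; rewrite gt_eqF// nrm_gt0.
elim=> [|n IH]; first exact: Cn0I.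
apply: CnSI C D _ => i; apply: CnM => //; apply: CnM => //.
have /smooth_onP := smooth_onV open_off0 (smooth_on_sqd 0 open_off0)
  (fun x (x0 : off0 x) => lt0r_neq0 (etrans (sqd0_gt0 x) x0)).
by apply; exact: open_off0.
Qed.

Definition ker (a b s : nat) x : R := x.1 ^+ a * x.2 ^+ b / nrm x ^+ s.

Lemma smooth_ker a b s : smooth_on off0 (ker a b s).
Proof.
have o0 := open_off0.
apply: (smooth_onM o0).
  apply: (smooth_onM o0).
    exact: (smooth_onX _ o0 (smooth_on_fst o0)).
  exact: (smooth_onX _ o0 (smooth_on_snd o0)).
apply: (smooth_onV o0 (smooth_onX s o0 smooth_nrm)) => x x0.
by rewrite expf_neq0// gt_eqF// nrm_gt0.
Qed.

Lemma partial_nrmX i s x : x != 0 ->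
  partial i (fun x => (nrm x ^+ s)^-1) x = - s%:R * coo i x / nrm x ^+ s.+2.
Proof.
move=> x0; have n0 : nrm x != 0 by rewrite gt_eqF// nrm_gt0.
have [] // : is_derive x (e_ i) (fun x => (nrm x ^+ s)^-1) (- s%:R * coo i x / nrm x ^+ s.+2).
have D0 : is_derive x (e_ i) (fun x => nrm x ^+ s) (s%:R * nrm x ^+ s.-1 * (coo i x / nrm x)).
  by have := is_deriveX s (is_derive_nrm i x0); rewrite exprfctE.
have ns : nrm x ^+ s != 0 by rewrite expf_neq0.
have D : is_derive x (e_ i) (fun x => (nrm x ^+ s)^-1)
    (- (nrm x ^+ s) ^- 2 *: (s%:R * nrm x ^+ s.-1 * (coo i x / nrm x))).
  case: D0 => d1 d2; apply: DeriveDef; first exact: derivableV.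
  by rewrite deriveV// d2.
apply: (is_derive_eq D); rewrite /GRing.scale/=; case: s {D D0} ns => [|s] ns.
  by rewrite /= !(mulr0n, mul0r, mulr0, oppr0).
rewrite /= !exprS; have : nrm x ^+ s != 0 by rewrite expf_neq0.
by move: (nrm x ^+ s) (nrm x) (coo i x) n0 => u v w v0 u0; field; rewrite u0 v0.
Qed.

Lemma partial_ker0 a b s x : x != 0 ->
  partial 0 (ker a b s) x = a%:R * ker a.-1 b s x - s%:R * ker a.+1 b s.+2 x.
Proof.
move=> x0; have o0 := open_off0.
have s1 := smooth_onX a o0 (smooth_on_fst o0).
have s2 := smooth_onX b o0 (smooth_on_snd o0).
have s3 := smooth_onV o0 (smooth_onX s o0 smooth_nrm)
  (fun x (x0 : off0 x) => expf_neq0 s (lt0r_neq0 (etrans (nrm_gt0 x) x0))).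
rewrite (partialM 0 (smooth_onM o0 s1 s2) s3 x0) (partialM 0 s1 s2 x0) partial_nrmX//.
have -> : partial 0 (fun x : R * R => x.1 ^+ a) x = a%:R * x.1 ^+ a.-1.
  have := is_deriveX a (is_derive_fst 0 x); rewrite exprfctE /= => -[_].
  by rewrite /partial => ->; rewrite /GRing.scale/= mulr1.
have -> : partial 0 (fun x : R * R => x.2 ^+ b) x = 0.
  have := is_deriveX b (is_derive_snd 0 x); rewrite exprfctE /= => -[_].
  by rewrite /partial => ->; rewrite scaler0.
rewrite /ker /coo /= (exprS x.1); ring.
Qed.

Lemma partial_ker1 a b s x : x != 0 ->
  partial 1 (ker a b s) x = b%:R * ker a b.-1 s x - s%:R * ker a b.+1 s.+2 x.
Proof.
move=> x0; have o0 := open_off0.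
have s1 := smooth_onX a o0 (smooth_on_fst o0).
have s2 := smooth_onX b o0 (smooth_on_snd o0).
have s3 := smooth_onV o0 (smooth_onX s o0 smooth_nrm)
  (fun x (x0 : off0 x) => expf_neq0 s (lt0r_neq0 (etrans (nrm_gt0 x) x0))).
rewrite (partialM 1 (smooth_onM o0 s1 s2) s3 x0) (partialM 1 s1 s2 x0) partial_nrmX//.
have -> : partial 1 (fun x : R * R => x.1 ^+ a) x = 0.
  have := is_deriveX a (is_derive_fst 1 x); rewrite exprfctE /= => -[_].
  by rewrite /partial => ->; rewrite scaler0.
have -> : partial 1 (fun x : R * R => x.2 ^+ b) x = b%:R * x.2 ^+ b.-1.
  have := is_deriveX b (is_derive_snd 1 x); rewrite exprfctE /= => -[_].
  by rewrite /partial => ->; rewrite /GRing.scale/= mulr1.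
rewrite /ker /coo /= (exprS x.2); ring.
Qed.

Lemma ker_raise a b s x : x != 0 ->
  ker a b s x = ker a.+2 b s.+2 x + ker a b.+2 s.+2 x.
Proof.
move=> x0; have n0 : nrm x != 0 by rewrite gt_eqF// nrm_gt0.
rewrite /ker -mulrDl.
have -> : x.1 ^+ a.+2 * x.2 ^+ b + x.1 ^+ a * x.2 ^+ b.+2 =
    x.1 ^+ a * x.2 ^+ b * nrm x ^+ 2 by rewrite nrm_sq !exprS; ring.
rewrite -(addn2 s) exprD; have : nrm x ^+ s != 0 by rewrite expf_neq0.
by move: (nrm x ^+ s) => u u0; field; rewrite u0 n0.
Qed.

End SmoothMore.

(** * Lebesgue integration on the plane, with an integrable point singularity *)

Section PlaneIntegral.
Context {R : realType}.
Implicit Types (A B : set (R * R)) (f g : R * R -> R) (x y p : R * R).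

Notation e_ := (@basis2 R).
Notation mu := (@lebesgue_measure R).
Notation mu2 := (@lebesgue2 R).
Notation mR := (measurableTypeR R).

Definition mfun f := measurable_fun [set: mR * mR] (f : mR * mR -> mR).
Definition intg f := mu2.-integrable [set: mR * mR] (EFin \o f).

(** The sigma-algebra is the product one, generated by rectangles; an open set is therefore
    exhausted by the countably many squares with rational centre and half-side that it contains. *)
Lemma open_measurable2 A : open A -> measurable (A : set (mR * mR)).
Proof.
move=> oA.
pose bx (q : rat * rat * rat) : set (R * R) :=
  `](ratr q.1.1 - ratr q.2 : R), (ratr q.1.1 + ratr q.2)[ `*`
  `](ratr q.1.2 - ratr q.2 : R), (ratr q.1.2 + ratr q.2)[.
have mbx q : measurable (bx q : set (mR * mR)) by apply: measurableX; exact: measurable_itv.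
pose F a b c : set (R * R) := if `[< bx (a, b, c) `<=` A >] then bx (a, b, c) else set0.
have mF a b c : measurable (F a b c : set (mR * mR)).
  by rewrite /F; case: asboolP => _; [exact: mbx|exact: measurable0].
suff -> : A = \bigcup_a \bigcup_b \bigcup_c F a b c.
  by do 3 (apply: bigcupT_measurable_rat => ?); exact: mF.
apply/seteqP; split; last first.
  by move=> x [a _ [b _ [c _]]]; rewrite /F; case: asboolP => // H; exact: H.
case=> x1 x2 Ax; have [r r0 rA] := open2P oA Ax.
have [c] := rat_in_itvoo (divr_gt0 r0 (ltr0n R 2) : 0 < r / 2).
rewrite in_itv/= => /andP[c0 cr].
have xc (z : R) : z - ratr c < z + ratr c by lra.
have [a] := rat_in_itvoo (xc x1); rewrite in_itv/= => /andP[a1 a2].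
have [b] := rat_in_itvoo (xc x2); rewrite in_itv/= => /andP[b1 b2].
exists a => //; exists b => //; exists c => //.
rewrite /F; case: asboolP => [_|[]].
  by split; rewrite /= in_itv/=; apply/andP; split; lra.
case=> y1 y2 [] /=; rewrite !in_itv/= => /andP[h1 h2] /andP[h3 h4].
by apply: rA; rewrite ltr_norml; apply/andP; split; lra.
Qed.

Lemma mfun_on A f : open A -> (forall x, A x -> {for x, continuous f}) ->
  measurable_fun (A : set (mR * mR)) (f : mR * mR -> mR).
Proof.
move=> oA cf; apply: (measurability _ (measurable_realfun.RGenOpens.measurableE R)).
move=> _ [_ [a [b ->] <-]]; apply: open_measurable2.
have : open (f @^-1` `]a, b[ `&` A).
  rewrite openE => x [fx Ax]; apply: filterI; last exact: near_open.
  apply: cf => //; apply: open_nbhs_nbhs; split => //; exact: interval_open.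
by rewrite setIC.
Qed.

Lemma mfun_cont f : continuous f -> mfun f.
Proof. by move=> cf; apply: (@mfun_on setT) => [|x _]; [exact: openT|exact: cf]. Qed.

Lemma open_neq2 y : open [set x : R * R | x != y].
Proof.
have -> : [set x | x != y] = (fun x => sqd y x) @^-1` [set t : R | 0 < t].
  apply/seteqP; split => -[x1 x2]; case: y => y1 y2 /=;
    rewrite /sqd /= lt0r paddr_eq0 ?sqr_ge0// addr_ge0 ?sqr_ge0// andbT;
    by rewrite !sqrf_eq0 !subr_eq0.
by apply: open_comp => [x _|]; [exact: continuous_sqd|exact: open_gt].
Qed.

Lemma measurable_set1_2 y : measurable ([set y] : set (mR * mR)).
Proof.
have -> : [set y] = ~` [set x | x != y].
  by apply/seteqP; split => x /=; [move=> -> /=; rewrite eqxx|move/negP; rewrite negbK => /eqP].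
by apply: measurableC; apply: open_measurable2; exact: open_neq2.
Qed.

Lemma mfun_off y f : (forall x, x != y -> {for x, continuous f}) -> mfun f.
Proof.
move=> cf; have E : [set: mR * mR] = [set x | x != y] `|` [set y].
  apply/seteqP; split => // x _; have [->|h] := eqVneq x y; [by right|by left].
rewrite /mfun E; apply/measurable_funU; [|exact: measurable_set1_2|split].
- by apply: open_measurable2; exact: open_neq2.
- by apply: mfun_on cf; exact: open_neq2.
- exact: measurable_fun_set1.
Qed.

Definition box (M : R) : set (R * R) := [set x | `|x.1| <= M /\ `|x.2| <= M].

Lemma boxE M : box M = `[-M, M] `*` `[-M, M].
Proof. by apply/seteqP; split => x; rewrite /box /= !in_itv/= !ler_norml. Qed.

Lemma measurable_box M : measurable (box M : set (mR * mR)).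
Proof. by rewrite boxE; apply: measurableX; exact: measurable_itv. Qed.

Lemma box_fin M : (mu2 (box M) < +oo)%E.
Proof.
rewrite boxE /lebesgue2 product_measure1E; [|exact: measurable_itv..].
have h : (mu `[(- M)%R, M]%classic < +oo)%E.
  by rewrite lebesgue_measure_itv/=; case: ifP => _; rewrite -?EFinB ltry.
by apply: lte_mul_pinfty => //; rewrite ge0_fin_numE.
Qed.

Lemma intg_bounded f (M C : R) : mfun f -> (forall x, `|f x| <= C) ->
  (forall x, ~ box M x -> f x = 0) -> intg f.
Proof.
move=> mf fC f0.
have H : mu2.-integrable (box M : set (mR * mR)) (EFin \o f).
  apply: measurable_bounded_integrable; [exact: measurable_box|exact: box_fin| |].
    exact: measurable_funS mf.
  by exists C; split => [|y Cy x _]; [exact: num_real|exact: (le_trans (fC x) (ltW Cy))].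
suff E : EFin \o f = (EFin \o f) \_ (box M : set (mR * mR)).
  rewrite /intg E; apply/integrable_restrict => //; first exact: measurable_box.
  by rewrite setTI.
apply/funext => x; rewrite /patch; case: ifPn => //; rewrite notin_setE => h.
by rewrite /= f0.
Qed.

(* |x|^-1 <= isq 0 x.1 * isq 0 x.2: integrability of the singular kernels then follows from
   that of one-variable functions. *)
Definition isq (c t : R) : R := (Num.sqrt `|t - c|)^-1.

(** Monotone convergence along closed intervals exhausting ]c, d], on each of which the primitive 2
    sqrt(t - c) is available. *)
Lemma isq_int_right (c d : R) : c < d ->
  (\int[mu]_(t in `]c, d]) (isq c t)%:E <= (2 * Num.sqrt (d - c))%:E)%E.
Proof.
move=> cd.
(* The shift [n.+2] keeps the interval nondegenerate already at n = 0, as the fundamental theorem of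
   calculus demands. *)
pose F n : set mR := [set` `[c + (d - c) / n.+2%:R, d]%R].
have dc : 0 < d - c by rewrite subr_gt0.
have cn n : c < c + (d - c) / n.+2%:R by rewrite ltrDl divr_gt0.
have nd n : c + (d - c) / n.+2%:R < d.
  by rewrite -ltrBrDl ltr_pdivrMr// ltr_pMr// ltr1n.
have D t : c < t -> is_derive t 1 (fun t => 2 * Num.sqrt (t - c)) (isq c t).
  move=> ct; have h : 0 < t - c by rewrite subr_gt0.
  have d1 : is_derive t 1 (fun t : R => t - c) 1.
    by have := is_deriveB (is_derive_id t 1) (is_derive_cst c t 1); rewrite subr0.
  have := @is_derive1_comp R Num.sqrt (fun t => t - c) t _ _ (is_derive1_sqrt h) d1.
  move=> d2; have d3 := is_deriveZ 2 d2.
  apply: (is_derive_eq d3); rewrite /isq gtr0_norm// /GRing.scale/= mulr1.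
  have : Num.sqrt (t - c) != 0 by rewrite gt_eqF// sqrtr_gt0.
  by move: (Num.sqrt _) => u u0; field.
have C t : c < t -> {for t, continuous (isq c)}.
  move=> ct; have h : 0 < t - c by rewrite subr_gt0.
  apply: continuousV; first by rewrite gt_eqF// sqrtr_gt0 gtr0_norm.
  apply: (@continuous_comp _ _ _ (fun t => `|t - c|) Num.sqrt); last exact: sqrt_continuous.
  apply: (@continuous_comp _ _ _ (fun t => t - c) Num.norm); last exact: norm_continuous.
  by apply: continuousB; [exact: cvg_id|exact: cst_continuous].
have FE n : (\int[mu]_(t in F n) (isq c t)%:E <= (2 * Num.sqrt (d - c))%:E)%E.
  rewrite /F (@continuous_FTC2 _ (isq c) (fun t => 2 * Num.sqrt (t - c)))//.
  - rewrite lee_fin lerBlDr lerDl mulr_ge0// sqrtr_ge0.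
  - apply: continuous_in_subspaceT => t; rewrite inE/= in_itv/= => /andP[h _].
    by apply: C; apply: lt_le_trans h.
  - have cF t : c < t -> {for t, continuous (fun t => 2 * Num.sqrt (t - c))}.
      by move=> /D[dd _]; apply: differentiable_continuous; apply/derivable1_diffP.
    split.
    + by move=> t; rewrite in_itv/= => /andP[h _]; have [] := D t (lt_trans (cn n) h).
    + by apply: cvg_at_right_filter; apply: cF.
    + by apply: cvg_at_left_filter; apply: cF.
  - move=> t; rewrite in_itv/= => /andP[h _].
    by rewrite derive1E; have [] := D t (lt_trans (cn n) h).
have UF : \bigcup_n F n = [set` `]c, d]%R].
  apply/seteqP; split => t.
    by move=> [n _]; rewrite /F/= !in_itv/= => /andP[h ->]; rewrite (lt_le_trans (cn n)).
  rewrite /= in_itv/= => /andP[ct td].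
  have tc : 0 < t - c by rewrite subr_gt0.
  have [n hn] : exists n, (d - c) / (t - c) < n.+2%:R.
    exists (Num.Def.archi_bound ((d - c) / (t - c))).
    apply: (lt_trans (archi_boundP _)); first by rewrite divr_ge0// ltW.
    by rewrite ltr_nat ltnS leqnSn.
  exists n => //; rewrite /F/= in_itv/= td andbT.
  rewrite -lerBrDl ler_pdivrMr// mulrC -ler_pdivrMr//; exact: ltW.
rewrite -UF.
have mF n : measurable (F n) by exact: measurable_itv.
have mfF n : measurable_fun (F n) (fun t : mR => (isq c t)%:E).
  apply/measurable_EFinP; apply: (@measurable_funS _ _ _ _ `]c, +oo[).
  - exact: measurable_itv.
  - by move=> t; rewrite /F/= !in_itv/= => /andP[h _]; rewrite (lt_le_trans (cn n)).
  - apply: open_continuous_measurable_fun => // t; rewrite inE/= in_itv/= andbT; exact: C.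
have nF : {homo F : n m / (n <= m)%N >-> (n <= m)%O}.
  move=> n m nm; apply/subsetPset => t; rewrite /F/= !in_itv/= => /andP[h ->].
  rewrite andbT (le_trans _ h)// lerD2l ler_pM2l// lef_pV2 ?posrE//.
  by rewrite ler_nat !ltnS.
have cv := @ge0_nondecreasing_set_cvg_integral _ _ R F (fun t : mR => (isq c t)%:E) mu nF mF mfF _.
rewrite -(cvg_lim _ (cv _))//; last by move=> n t _; rewrite lee_fin invr_ge0 sqrtr_ge0.
apply: lime_le.
  apply/cvg_ex; eexists; apply: cv.
  by move=> n t _; rewrite lee_fin invr_ge0 sqrtr_ge0.
by apply: nearW.
Qed.

Lemma isq_int_left (c d : R) : d < c ->
  (\int[mu]_(t in `[d, c[) (isq c t)%:E <= (2 * Num.sqrt (c - d))%:E)%E.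
Proof.
move=> dc'.
pose F n : set mR := [set` `[d, c - (c - d) / n.+2%:R]%R].
have dc : 0 < c - d by rewrite subr_gt0.
have cn n : c - (c - d) / n.+2%:R < c by rewrite ltrBlDr ltrDl divr_gt0.
have nd n : d < c - (c - d) / n.+2%:R.
  by rewrite ltrBrDr -ltrBrDl ltr_pdivrMr// ltr_pMr// ltr1n.
have D t : t < c -> is_derive t 1 (fun t => - 2 * Num.sqrt (c - t)) (isq c t).
  move=> ct; have h : 0 < c - t by rewrite subr_gt0.
  have d1 : is_derive t 1 (fun t : R => c - t) (-1).
    by have := is_deriveB (is_derive_cst c t 1) (is_derive_id t 1); rewrite sub0r.
  have := @is_derive1_comp R Num.sqrt (fun t => c - t) t _ _ (is_derive1_sqrt h) d1.
  move=> d2; have d3 := is_deriveZ (- 2) d2.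
  apply: (is_derive_eq d3); rewrite /isq distrC gtr0_norm// /GRing.scale/=.
  have : Num.sqrt (c - t) != 0 by rewrite gt_eqF// sqrtr_gt0.
  by move: (Num.sqrt _) => u u0; field.
have C t : t < c -> {for t, continuous (isq c)}.
  move=> ct; have h : 0 < c - t by rewrite subr_gt0.
  apply: continuousV; first by rewrite gt_eqF// sqrtr_gt0 distrC gtr0_norm.
  apply: (@continuous_comp _ _ _ (fun t => `|t - c|) Num.sqrt); last exact: sqrt_continuous.
  apply: (@continuous_comp _ _ _ (fun t => t - c) Num.norm); last exact: norm_continuous.
  by apply: continuousB; [exact: cvg_id|exact: cst_continuous].
have FE n : (\int[mu]_(t in F n) (isq c t)%:E <= (2 * Num.sqrt (c - d))%:E)%E.
  rewrite /F (@continuous_FTC2 _ (isq c) (fun t => - 2 * Num.sqrt (c - t)))//.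
  - by rewrite lee_fin !mulNr opprK addrC lerBlDr lerDl mulr_ge0// sqrtr_ge0.
  - apply: continuous_in_subspaceT => t; rewrite inE/= in_itv/= => /andP[_ h].
    by apply: C; apply: le_lt_trans h _.
  - have cF t : t < c -> {for t, continuous (fun t => - 2 * Num.sqrt (c - t))}.
      by move=> /D[dd _]; apply: differentiable_continuous; apply/derivable1_diffP.
    split.
    + by move=> t; rewrite in_itv/= => /andP[_ h]; have [] := D t (lt_trans h (cn n)).
    + by apply: cvg_at_right_filter; apply: cF.
    + by apply: cvg_at_left_filter; apply: cF.
  - move=> t; rewrite in_itv/= => /andP[_ h].
    by rewrite derive1E; have [] := D t (lt_trans h (cn n)).
have UF : \bigcup_n F n = [set` `[d, c[%R].
  apply/seteqP; split => t.
    by move=> [n _]; rewrite /F/= !in_itv/= => /andP[-> h]; rewrite (le_lt_trans h).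
  rewrite /= in_itv/= => /andP[td ct].
  have tc : 0 < c - t by rewrite subr_gt0.
  have [n hn] : exists n, (c - d) / (c - t) < n.+2%:R.
    exists (Num.Def.archi_bound ((c - d) / (c - t))).
    apply: (lt_trans (archi_boundP _)); first by rewrite divr_ge0// ltW.
    by rewrite ltr_nat ltnS leqnSn.
  exists n => //; rewrite /F/= in_itv/= td /=.
  rewrite lerBrDr -lerBrDl ler_pdivrMr// mulrC -ler_pdivrMr//; exact: ltW.
rewrite -UF.
have mF n : measurable (F n) by exact: measurable_itv.
have mfF n : measurable_fun (F n) (fun t : mR => (isq c t)%:E).
  apply/measurable_EFinP; apply: (@measurable_funS _ _ _ _ `]-oo, c[).
  - exact: measurable_itv.
  - by move=> t; rewrite /F/= !in_itv/= => /andP[_ h]; rewrite (le_lt_trans h).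
  - apply: open_continuous_measurable_fun => // t; rewrite inE/= in_itv/=; exact: C.
have nF : {homo F : n m / (n <= m)%N >-> (n <= m)%O}.
  move=> n m nm; apply/subsetPset => t; rewrite /F/= !in_itv/= => /andP[-> h].
  rewrite (le_trans h)// lerD2l lerN2 ler_pM2l// lef_pV2 ?posrE//.
  by rewrite ler_nat !ltnS.
have cv := @ge0_nondecreasing_set_cvg_integral _ _ R F (fun t : mR => (isq c t)%:E) mu nF mF mfF _.
rewrite -(cvg_lim _ (cv _))//; last by move=> n t _; rewrite lee_fin invr_ge0 sqrtr_ge0.
apply: lime_le.
  apply/cvg_ex; eexists; apply: cv.
  by move=> n t _; rewrite lee_fin invr_ge0 sqrtr_ge0.
by apply: nearW.
Qed.

Lemma isq_ge0 c t : 0 <= isq c t.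
Proof. by rewrite invr_ge0 sqrtr_ge0. Qed.

Lemma isq_measurable c : measurable_fun [set: mR] (isq c : mR -> mR).
Proof.
have E : [set: mR] = [set t | t != c] `|` [set c].
  apply/seteqP; split => // t _; have [->|h] := eqVneq t c; [by right|by left].
have oc : open [set t : R | t != c] by exact: open_neq.
rewrite E; apply/measurable_funU; [exact: measurable_realfun.open_measurable|exact: measurable_set1|].
split; last exact: measurable_fun_set1.
apply: open_continuous_measurable_fun => // t; rewrite inE/= => tc.
rewrite -[continuous_at _ _]/({for t, continuous (isq c)}).
apply: continuousV; first by rewrite gt_eqF// sqrtr_gt0 normr_gt0 subr_eq0.
apply: (@continuous_comp _ _ _ (fun t => `|t - c|) Num.sqrt); last exact: sqrt_continuous.
apply: (@continuous_comp _ _ _ (fun t => t - c) Num.norm); last exact: norm_continuous.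
by apply: continuousB; [exact: cvg_id|exact: cst_continuous].
Qed.

Lemma isq_int_fin (c M : R) : (\int[mu]_(t in `[(- M)%R, M]) (isq c t)%:E < +oo)%E.
Proof.
pose L := `|M| + `|c| + 1.
have L0 : 0 < L by rewrite /L; have := normr_ge0 M; have := normr_ge0 c; lra.
have c1 : c < c + L by rewrite ltrDl.
have c2 : c - L < c by rewrite ltrBlDr ltrDl.
pose A : set mR := [set` `[c - L, c]%R]; pose B : set mR := [set` `]c, c + L]%R].
have sub : [set` `[- M, M]%R] `<=` A `|` B.
  move=> t; rewrite /= !in_itv/= => /andP[h1 h2].
  have := ler_norm M; have := ler_norm c; have := ler_norm (- c); have := ler_norm (- M).
  rewrite !normrN => h3 h4 h5 h6.
  have [tc|tc] := leP t c; [left|right]; rewrite /A /B /= in_itv/= tc ?andbT /L; lra.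
have m1 : measurable_fun [set: mR] (fun t : mR => (isq c t)%:E) by apply/measurable_EFinP; exact: isq_measurable.
have mA : measurable A by exact: measurable_itv.
have mB : measurable B by exact: measurable_itv.
apply: le_lt_trans.
  apply: (@ge0_subset_integral _ _ _ mu _ (A `|` B)) sub => //.
  - exact: measurableU.
  - exact: measurable_funS m1.
  - by move=> t _; rewrite lee_fin isq_ge0.
rewrite ge0_integral_setU//.
- apply: lte_add_pinfty.
    rewrite /A -integral_itv_bndo_bndc; last by apply: measurable_funS m1.
    by apply: le_lt_trans (isq_int_left c2) _; rewrite ltry.
  by apply: le_lt_trans (isq_int_right c1) _; rewrite ltry.
- exact: measurable_funS m1.
- by move=> t _; rewrite lee_fin isq_ge0.
- apply/disj_setPS => t []; rewrite /A /B /= !in_itv/= => /andP[_ h1] /andP[h2 _].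
  by have := lt_le_trans h2 h1; rewrite ltxx.
Qed.

(** This is |x1| |x2| <= x1^2 + x2^2 after taking square roots and inverses. *)
Lemma nrm_isq (x : R * R) : x.1 != 0 -> x.2 != 0 ->
  (euclid_norm x)^-1 <= isq 0 x.1 * isq 0 x.2.
Proof.
move=> h1 h2; rewrite /isq !subr0 -invfM lef_pV2 ?posrE; last 2 first.
- by rewrite nrm_gt0; apply: contra h1 => /eqP ->.
- by rewrite mulr_gt0// sqrtr_gt0 normr_gt0.
rewrite -sqrtrM ?normr_ge0// /euclid_norm ler_sqrt ?addr_ge0 ?sqr_ge0//.
rewrite -(real_normK (num_real x.1)) -(real_normK (num_real x.2)).
by have := sqr_ge0 (`|x.1| - `|x.2|); have := normr_ge0 x.1; have := normr_ge0 x.2; nra.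
Qed.

(** Off the two coordinate lines through y, a null set, [nrm_isq] bounds f by a product of
    one-variable functions; Tonelli reduces integrability to [isq_int_fin]. *)
Lemma intg_singular f (y : R * R) (M C : R) : mfun f ->
  (forall x, x != y -> `|f x| <= C / euclid_norm (x - y)) ->
  (forall x, ~ box M x -> f x = 0) -> intg f.
Proof.
move=> mf fC f0.
pose L : set (mR * mR) := ([set y.1] `*` setT) `|` (setT `*` [set y.2]).
have mL1 : measurable ([set y.1] `*` setT : set (mR * mR)).
  by apply: measurableX; [exact: measurable_set1|exact: measurableT].
have mL2 : measurable (setT `*` [set y.2] : set (mR * mR)).
  by apply: measurableX; [exact: measurableT|exact: measurable_set1].
have mL : measurable L by exact: measurableU.
have L0 : mu2 L = 0%E.
  rewrite /lebesgue2; apply: null_set_setU => //.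
  - apply: (etrans (@product_measure1E _ _ _ _ _ mu mu _ _ _ _)) => //.
    by rewrite [X in (X * _)%E](lebesgue_measure_set1 y.1) mul0e.
  - apply: (etrans (@product_measure1E _ _ _ _ _ mu mu _ _ _ _)) => //.
    by rewrite [X in (_ * X)%E](lebesgue_measure_set1 y.2) mule0.
have mEf : measurable_fun [set: mR * mR] (EFin \o f) by exact/measurable_EFinP.
apply/(negligible_integrable mL measurableT mEf L0).
pose rho c (t : R) := isq c t * \1_(`[- M, M]%classic : set R) t.
have mrho c : measurable_fun [set: mR] (rho c : mR -> mR).
  apply: measurable_funM; first exact: isq_measurable.
  by apply: measurable_indic; exact: measurable_itv.
have rho0 c t : 0 <= rho c t by rewrite mulr_ge0 ?isq_ge0.
pose g (x : R * R) := `|C| * (rho y.1 x.1 * rho y.2 x.2).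
have g0 x : 0 <= g x by rewrite /g mulr_ge0// mulr_ge0// rho0.
have mg : mfun g.
  apply: measurable_funM; first exact: measurable_cst.
  by apply: measurable_funM; apply: (measurableT_comp (mrho _)); [exact: measurable_fst|exact: measurable_snd].
have rhoI c : (\int[mu]_t (rho c t)%:E < +oo)%E.
  have := isq_int_fin c M; rewrite integral_mkcond.
  congr (_ < _)%E; apply: eq_integral => t _; rewrite /patch /rho indicE.
  by case: ifPn; rewrite ?mulr1 ?mulr0.
have ig : intg g.
  apply/integrable12ltyP; first exact/measurable_EFinP.
  rewrite (eq_integral (fun a : mR => ((`|C| * rho y.1 a)%:E * \int[mu]_b (rho y.2 b)%:E)%E)); last first.
    move=> a _; rewrite -ge0_integralZl_EFin//; last 3 first.
    - by move=> b _; rewrite lee_fin.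
    - by apply/measurable_EFinP; exact: mrho.
    - by rewrite mulr_ge0.
    apply: eq_integral => b _; rewrite /= ger0_norm; last exact: g0.
    by rewrite -EFinM /g mulrA.
  have fi c : (\int[mu]_b (rho c b)%:E)%E \is a fin_num.
    by rewrite ge0_fin_numE// integral_ge0// => b _; rewrite lee_fin.
  rewrite -(fineK (fi y.2)); set r := fine _.
  have r0 : 0 <= r by rewrite fine_ge0// integral_ge0// => b _; rewrite lee_fin.
  rewrite (eq_integral (fun a : mR => ((`|C| * r)%:E * (rho y.1 a)%:E)%E)); last first.
    by move=> a _; rewrite -!EFinM mulrAC.
  rewrite ge0_integralZl_EFin//; last 3 first.
  - by move=> b _; rewrite lee_fin.
  - by apply/measurable_EFinP; exact: mrho.
  - by rewrite mulr_ge0.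
  by rewrite -(fineK (fi y.1)) -EFinM ltry.
apply: (le_integrable _ _ _ (integrableS _ _ _ ig)) => //.
- exact: measurableD.
- exact: measurable_funS mEf.
- move=> x [_ nL].
  have x1 : x.1 - y.1 != 0.
    by rewrite subr_eq0; apply/eqP => e; apply: nL; left; split.
  have x2 : x.2 - y.2 != 0.
    by rewrite subr_eq0; apply/eqP => e; apply: nL; right; split.
  rewrite /= lee_fin [leRHS]ger0_norm; last exact: g0.
  have [bx|nb] := pselect (box M x); last by rewrite f0// normr0.
  have -> : g x = `|C| * (isq 0 (x - y).1 * isq 0 (x - y).2).
    move: bx; rewrite boxE => -[b1 b2]; rewrite /g /rho !indicE !mem_set// !mulr1.
    by rewrite /isq !subr0.
  have xy : x != y by apply: contra x1 => /eqP ->; rewrite subrr.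
  apply: (le_trans (fC x xy)).
  apply: (@le_trans _ _ (`|C| * (euclid_norm (x - y))^-1)).
    by rewrite ler_wpM2r ?invr_ge0 ?sqrtr_ge0// ler_norm.
  by rewrite ler_wpM2l// nrm_isq.
- exact: measurableD.
Qed.

Lemma line_integral0 (G G' : R -> R) (L : R) : 0 < L ->
  (forall t : R, is_derive t 1 G (G' t)) -> continuous G' ->
  (forall t : R, L <= `|t| -> G t = 0) -> (forall t : R, L <= `|t| -> G' t = 0) ->
  (\int[mu]_t (G' t)%:E)%E = 0%E.
Proof.
move=> L0 dG cG' G0 G'0.
have -> : (\int[mu]_t (G' t)%:E)%E = (\int[mu]_(t in `[(- L)%R, L]) (G' t)%:E)%E.
  rewrite [RHS]integral_mkcond; apply: eq_integral => t _; rewrite /patch.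
  case: ifPn => //; rewrite notin_setE /= in_itv/= -ler_norml => /negP.
  by rewrite -ltNge => /ltW h; rewrite G'0.
have LL : - L < L by lra.
have cG t : {for t, continuous G}.
  by have [d _] := dG t; apply: differentiable_continuous; apply/derivable1_diffP.
rewrite (@continuous_FTC2 _ G' G)//.
- by rewrite !G0 ?subee// ?normrN ger0_norm// ltW.
- exact: continuous_subspaceT.
- split.
  + by move=> t _; have [] := dG t.
  + by apply: cvg_at_right_filter; apply: cG.
  + by apply: cvg_at_left_filter; apply: cG.
- by move=> t _; rewrite derive1E; have [] := dG t.
Qed.

Definition plane_int f : R := \int[mu2]_x f x.

Lemma box_slice (M a b : R) : 0 <= M -> M + 1 <= `|a| \/ M + 1 <= `|b| -> ~ box M (a, b).
Proof. by move=> M0 h [/= h1 h2]; case: h => h; lra. Qed.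

(** Fubini with x.1 innermost: on every line except x.2 = c the inner integral is that of the
    derivative of a function vanishing at both ends. The discarded line is where a point singularity
    sits, so no boundary term around it ever appears. *)
Lemma int_slice0 (F F' : R * R -> R) (c M : R) : 0 <= M ->
  (forall x, x.2 != c -> is_derive x (e_ 0) F (F' x)) ->
  (forall x, x.2 != c -> {for x, continuous F'}) ->
  (forall x, ~ box M x -> F x = 0) -> (forall x, ~ box M x -> F' x = 0) ->
  intg F' -> plane_int F' = 0.
Proof.
move=> M0 dF cF' F0 F'0 iF'.
rewrite /plane_int /Rintegral.
suff -> : (\int[mu2]_x (F' x)%:E = 0)%E by [].
rewrite -[LHS](integral21_prod_meas1 iF').
apply: (etrans (@ae_eq_integral _ _ _ mu _ (cst 0%E) _ measurableT
  (measurable_fubini_G iF') _ _)); [exact: measurable_cst| |exact: integral0].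
- exists [set c]; split; [exact: measurable_set1|exact: lebesgue_measure_set1|].
  move=> b /= nb; apply: contrapT => bc; apply: nb => _.
  rewrite /fubini_G /=.
  have bc' : b != c by apply/eqP.
  apply: (@line_integral0 (fun t => F (t, b)) (fun t => F' (t, b)) (M + 1)).
  + by rewrite ltr_wpDl.
  + by move=> t; apply/slice1; exact: dF.
  + move=> t; apply: (@continuous_comp _ _ _ (fun t => (t, b)) F'); last exact: cF'.
    exact: (cvg_pair (@cvg_id _ (nbhs t)) (@cvg_cst _ b _ _ _)).
  + by move=> t h; apply: F0; apply: box_slice => //; left.
  + by move=> t h; apply: F'0; apply: box_slice => //; left.
Qed.

Lemma int_slice1 (F F' : R * R -> R) (c M : R) : 0 <= M ->
  (forall x, x.1 != c -> is_derive x (e_ 1) F (F' x)) ->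
  (forall x, x.1 != c -> {for x, continuous F'}) ->
  (forall x, ~ box M x -> F x = 0) -> (forall x, ~ box M x -> F' x = 0) ->
  intg F' -> plane_int F' = 0.
Proof.
move=> M0 dF cF' F0 F'0 iF'.
rewrite /plane_int /Rintegral.
suff -> : (\int[mu2]_x (F' x)%:E = 0)%E by [].
rewrite -[LHS](integral12_prod_meas1 iF').
apply: (etrans (@ae_eq_integral _ _ _ mu _ (cst 0%E) _ measurableT
  (measurable_fubini_F iF') _ _)); [exact: measurable_cst| |exact: integral0].
- exists [set c]; split; [exact: measurable_set1|exact: lebesgue_measure_set1|].
  move=> b /= nb; apply: contrapT => bc; apply: nb => _.
  rewrite /fubini_F /=.
  have bc' : b != c by apply/eqP.
  apply: (@line_integral0 (fun t => F (b, t)) (fun t => F' (b, t)) (M + 1)).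
  + by rewrite ltr_wpDl.
  + by move=> t; apply/slice2; exact: dF.
  + move=> t; apply: (@continuous_comp _ _ _ (fun t => (b, t)) F'); last exact: cF'.
    exact: (cvg_pair (@cvg_cst _ b _ _ _) (@cvg_id _ (nbhs t))).
  + by move=> t h; apply: F0; apply: box_slice => //; right.
  + by move=> t h; apply: F'0; apply: box_slice => //; right.
Qed.

(** The line through x in the direction e_i misses the singular point y. *)
Definition hyper (i : 'I_2) (x y : R * R) : bool := if i == 0 then x.2 != y.2 else x.1 != y.1.

Lemma int_partial0 i (F F' : R * R -> R) (y : R * R) (M : R) : 0 <= M ->
  (forall x, hyper i x y -> is_derive x (e_ i) F (F' x)) ->
  (forall x, hyper i x y -> {for x, continuous F'}) ->
  (forall x, ~ box M x -> F x = 0) -> (forall x, ~ box M x -> F' x = 0) ->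
  intg F' -> plane_int F' = 0.
Proof.
move: i; apply: I2_ind; rewrite /hyper /=; [exact: int_slice0|exact: int_slice1].
Qed.

Lemma compact_box (M : R) : compact (box M).
Proof. by rewrite boxE; apply: compact_setX; exact: segment_compact. Qed.

Lemma box_bound f M : continuous f -> exists C, 0 <= C /\ forall x, box M x -> `|f x| <= C.
Proof.
move=> cf; have : compact (f @` box M).
  by apply: continuous_compact; [exact: continuous_subspaceT|exact: compact_box].
move=> /compact_bounded[C [_ HC]]; exists (`|C| + 1); split; first by rewrite addr_ge0.
by move=> x bx; apply: HC; [rewrite (le_lt_trans (ler_norm C))// ltrDl|exists x].
Qed.

Definition supported (M : R) phi := smooth phi /\ forall x, ~ box M x -> phi x = 0.

Lemma closed_box M : closed (box M).
Proof. by apply: compact_closed; [exact: @norm_hausdorff|exact: compact_box]. Qed.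

Lemma supported_partial M i phi : supported M phi -> supported M (partial i phi).
Proof.
move=> [sp p0]; split; first exact: smooth_on_partial.
have oB : open (~` box M) by apply: closed_openC; exact: closed_box.
move=> x nx; have := @partials_eq_on _ (~` box M) [:: i] phi (fun=> 0) oB _ x.
rewrite /= {2}/partial derive_cst; apply; last by rewrite inE.
by move=> y; rewrite inE => /p0.
Qed.

Lemma supported_bound M phi : supported M phi -> exists C, 0 <= C /\ forall x, `|phi x| <= C.
Proof.
move=> [sp p0]; have [|C [C0 HC]] := @box_bound phi M.
  by move=> x; exact: (smooth_on_cont sp).
exists C; split => // x; have [/HC//|/p0 ->] := pselect (box M x).
by rewrite normr0.
Qed.

Lemma test_fun_supported A phi : test_fun A phi -> exists M, 0 <= M /\ supported M phi.
Proof.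
move=> [sp /compact_bounded[C [_ HC]] _]; exists (`|C| + 1); split; first by rewrite addr_ge0.
split => // x nb; apply: contrapT => /eqP px; apply: nb.
have : supp phi x by apply: subset_closure.
have cC : C < `|C| + 1 by rewrite (le_lt_trans (ler_norm C))// ltrDl.
by move=> sx; have := HC _ cC x sx; rewrite /= prod_normE ge_max => /andP[].
Qed.

End PlaneIntegral.

(** * Convolution of homogeneous kernels with test functions *)

Section Convolution.
Context {R : realType}.
Implicit Types (f g h : R * R -> R) (x y : R * R).

Notation e_ := (@basis2 R).
Notation mu := (@lebesgue_measure R).
Notation mu2 := (@lebesgue2 R).
Notation mR := (measurableTypeR R).
Notation nrm := (@euclid_norm R).

(* Combinations of kernels homogeneous of degree d - 1 off the origin; the value at 0 is
   unconstrained. *)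
Inductive hom : nat -> (R * R -> R) -> Prop :=
| hom_ker a b s d of (a + b + 1 = s + d)%N : hom d (ker a b s)
| hom_add d f g of hom d f & hom d g : hom d (fun x => f x + g x)
| hom_scale d c f of hom d f : hom d (fun x => c * f x)
| hom_eq d f g of (forall x, x != 0 -> f x = g x) & hom d f : hom d g.

Lemma hom_smooth d h : hom d h -> smooth_on off0 h.
Proof.
elim=> {d h} [a b s d _|d f g _ IHf _ IHg|d c f _ IH|d f g fg _ IH].
- exact: smooth_ker.
- exact: (smooth_onD open_off0 IHf IHg).
- exact: (smooth_onZ c open_off0 IH).
- by apply: (smooth_on_eq open_off0 _ IH) => x; rewrite inE => /fg.
Qed.

Lemma hom0 d : hom d (fun=> 0).
Proof.
apply: (@hom_eq d (fun x => 0 * ker d 0 1 x)); first by move=> x _; rewrite mul0r.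
by apply: hom_scale; apply: hom_ker; rewrite addn0 addnC.
Qed.

Lemma hom_partial d h i : hom d.+1 h -> hom d (partial i h).
Proof.
move: {1 3}d.+1 (erefl d.+1) => D DE H; elim: H DE => {D h}.
- move=> a b s D e De; move: i; apply: I2_ind.
  + apply: (@hom_eq d (fun x => a%:R * ker a.-1 b s x + (- s%:R) * ker a.+1 b s.+2 x)).
      by move=> x x0; rewrite partial_ker0// mulNr.
    apply: hom_add; last by apply: hom_scale; apply: hom_ker; lia.
    (* For a = 0 the truncated exponent [a.-1] would break the degree count, but its coefficient is
       0. *)
    case: a e => [|a] e; last by apply: hom_scale; apply: hom_ker; lia.
    by apply: (hom_eq _ (hom0 d)) => x _; rewrite mul0r.
  + apply: (@hom_eq d (fun x => b%:R * ker a b.-1 s x + (- s%:R) * ker a b.+1 s.+2 x)).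
      by move=> x x0; rewrite partial_ker1// mulNr.
    apply: hom_add; last by apply: hom_scale; apply: hom_ker; lia.
    case: b e => [|b] e; last by apply: hom_scale; apply: hom_ker; lia.
    by apply: (hom_eq _ (hom0 d)) => x _; rewrite mul0r.
- move=> D f g Hf IHf Hg IHg De.
  apply: (hom_eq _ (hom_add (IHf De) (IHg De))) => x x0.
  by rewrite (partialD i (hom_smooth Hf) (hom_smooth Hg) x0).
- move=> D c f Hf IHf De.
  apply: (hom_eq _ (hom_scale c (IHf De))) => x x0.
  by rewrite (partialZ i c (hom_smooth Hf) x0).
- move=> D f g fg Hf IHf De; apply: (hom_eq _ (IHf De)) => x x0.
  apply: (@partials_eq_on _ off0 [:: i] f g); first exact: open_off0.
    by move=> y; rewrite inE => /fg.
  by rewrite inE.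
Qed.

Lemma hom_partials d h s : hom (size s + d) h -> hom d (partials s h).
Proof.
elim: s d => //= i s IH d H; apply: hom_partial; apply: IH.
by rewrite addnS.
Qed.

Lemma coo1_le x : `|x.1| <= nrm x.
Proof.
rewrite -sqrtr_sqr /euclid_norm ler_sqrt ?addr_ge0 ?sqr_ge0//.
by rewrite lerDl sqr_ge0.
Qed.

Lemma coo2_le x : `|x.2| <= nrm x.
Proof.
rewrite -sqrtr_sqr /euclid_norm ler_sqrt ?addr_ge0 ?sqr_ge0//.
by rewrite lerDr sqr_ge0.
Qed.

Lemma nrm_le x : nrm x <= `|x.1| + `|x.2|.
Proof.
rewrite -[leRHS]ger0_norm ?addr_ge0// -sqrtr_sqr /euclid_norm ler_sqrt ?sqr_ge0//.
rewrite sqrrD !real_normK ?num_real// addrAC lerDl mulrn_wge0// mulr_ge0//.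
Qed.

Lemma hom_bound d h : hom d h -> exists C, 0 <= C /\
  forall x, x != 0 -> `|h x| <= C * nrm x ^+ d / nrm x.
Proof.
elim=> {d h} [a b s d e|d f g _ [C [C0 IHf]] _ [D [D0 IHg]]|d c f _ [C [C0 IH]]|d f g fg _ [C [C0 IH]]].
- exists 1; split => // x x0; have n0 : 0 < nrm x by rewrite nrm_gt0.
  rewrite mul1r /ker !normrM normfV !normrX (ger0_norm (ltW n0)).
  have -> : nrm x ^+ d / nrm x = nrm x ^+ a * nrm x ^+ b / nrm x ^+ s.
    have n1 : nrm x != 0 by rewrite gt_eqF.
    apply/eqP; rewrite eqr_div ?expf_neq0//; apply/eqP.
    by rewrite -!exprD -exprSr; congr (_ ^+ _); lia.
  rewrite ler_wpM2r ?invr_ge0 ?exprn_ge0 ?(ltW n0)//.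
  by rewrite ler_pM ?exprn_ge0//; apply: lerXn2r; rewrite ?nnegrE ?(ltW n0) ?coo1_le ?coo2_le.
- exists (C + D); split => [|x x0]; first exact: addr_ge0.
  by rewrite !mulrDl (le_trans (ler_normD _ _))// lerD ?IHf ?IHg.
- exists (`|c| * C); split => [|x x0]; first exact: mulr_ge0.
  by rewrite normrM -!mulrA ler_wpM2l// mulrA IH.
- by exists C; split => // x x0; rewrite -fg// IH.
Qed.

(** The argument fed to the distribution in [convolution]. With the kernel taken at x - y and y as
    parameter, derivatives in y become derivatives of [phi] without a sign. *)
Definition conv h phi : R * R -> R := fun y => plane_int (fun x => h (x - y) * phi x).

Lemma cont_shift x y : {for x, continuous (fun x => x - y)}.
Proof. by apply: cvgB; [exact: cvg_id|exact: cvg_cst]. Qed.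

Lemma hom_cont_shift d h x y : hom d h -> x != y -> {for x, continuous (fun x => h (x - y))}.
Proof.
move=> H xy; apply: (@continuous_comp _ _ _ (fun x => x - y) h); first exact: cont_shift.
by apply: (smooth_on_cont (hom_smooth H)); rewrite /off0/= subr_eq0.
Qed.

(** One constant serves all y of a box. The majorant C / |x - y|, valid down to degree -1, gives
    integrability; the plain C, valid from degree 0 on, gives domination under the integral sign. *)
Lemma conv_dom d h phi (M rho : R) : 0 <= M -> hom d h -> supported M phi ->
  exists C, 0 <= C /\ forall x y, box rho y -> x != y ->
    `|h (x - y) * phi x| <= C / nrm (x - y) /\ ((0 < d)%N -> `|h (x - y) * phi x| <= C).
Proof.
move=> M0 /hom_bound[C [C0 HC]] sp; have [D [D0 HD]] := supported_bound sp.
pose L := 2 * M + 2 * `|rho|.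
have L0 : 0 <= L by rewrite addr_ge0 ?mulr_ge0.
have K0 : 0 <= C * (1 + L) ^+ d * D by rewrite !mulr_ge0// exprn_ge0// addr_ge0.
exists (C * (1 + L) ^+ d * D); split => //.
move=> x y [y1 y2] xy; have z0 : x - y != 0 by rewrite subr_eq0.
have n0 : 0 < nrm (x - y) by rewrite nrm_gt0.
have L1 : 1 <= 1 + L by rewrite lerDl.
have [bx|nb] := pselect (box M x); last first.
  have -> : phi x = 0 by apply: sp.2.
  by rewrite mulr0 normr0; split => [|_//]; rewrite divr_ge0// ltW.
have nL : nrm (x - y) <= L.
  apply: (le_trans (nrm_le _)); case: bx => b1 b2; rewrite /L.
  have := ler_normB x.1 y.1; have := ler_normB x.2 y.2; have := ler_norm rho.
  by rewrite /=; lra.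
have nL1 : nrm (x - y) <= 1 + L by lra.
have hx := HC _ z0.
have N k : nrm (x - y) ^+ k <= (1 + L) ^+ k by apply: lerXn2r; rewrite ?nnegrE ?(ltW n0) ?(le_trans ler01 L1).
split.
- rewrite normrM mulrAC ler_pM// (le_trans hx)// ler_wpM2r ?invr_ge0 ?(ltW n0)//.
  by rewrite ler_wpM2l.
- move=> d0; rewrite normrM ler_pM// (le_trans hx)// -mulrA ler_wpM2l//.
  case: d d0 {HC hx K0} => // d _; rewrite exprS mulrC mulrA mulVf ?gt_eqF// mul1r.
  by rewrite (le_trans (N d))// exprS ler_peMl// exprn_ge0// addr_ge0.
Qed.

Lemma conv_mfun d h phi (M : R) y : hom d h -> supported M phi ->
  mfun (fun x => h (x - y) * phi x).
Proof.
move=> H sp; apply: (@mfun_off _ y) => x xy; apply: continuousM.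
  exact: hom_cont_shift H xy.
exact: (smooth_on_cont sp.1).
Qed.

Lemma conv_intg d h phi (M : R) y : 0 <= M -> hom d h -> supported M phi ->
  intg (fun x => h (x - y) * phi x).
Proof.
move=> M0 H sp; have [C [C0 HC]] := conv_dom (`|y.1| + `|y.2|) M0 H sp.
apply: (@intg_singular _ _ y M C); first exact: conv_mfun H sp.
- move=> x xy; have [] // := HC x y _ xy.
  by split; rewrite ?lerDl ?lerDr.
- by move=> x nx; rewrite (sp.2 _ nx) mulr0.
Qed.

Lemma is_derive_shift1 i h x y : x != y -> smooth_on off0 h ->
  is_derive x (e_ i) (fun x => h (x - y)) (partial i h (x - y)).
Proof.
move=> xy sh; have z0 : off0 (x - y) by rewrite /off0/= subr_eq0.
have [d1 d2] := smooth_on_derive i sh z0.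
have E : (fun t : R => t^-1 *: (((fun x => h (x - y)) \o shift x) (t *: e_ i) - h (x - y))) =
    (fun t : R => t^-1 *: ((h \o shift (x - y)) (t *: e_ i) - h (x - y))).
  by apply/funext => t /=; rewrite addrA.
by split; [rewrite /derivable E|rewrite /derive E].
Qed.

Lemma is_derive_shift2 i h x y : x != y -> smooth_on off0 h ->
  is_derive y (e_ i) (fun y => h (x - y)) (- partial i h (x - y)).
Proof.
move=> xy sh; have z0 : off0 (x - y) by rewrite /off0/= subr_eq0.
have d1 : is_derive y (e_ i) (fun y : R * R => x.1 - y.1) (- (i == 0)%:R).
  have := is_deriveB (is_derive_cst x.1 y (e_ i)) (is_derive_fst i y).
  by rewrite sub0r.
have d2 : is_derive y (e_ i) (fun y : R * R => x.2 - y.2) (- (i == 1)%:R).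
  have := is_deriveB (is_derive_cst x.2 y (e_ i)) (is_derive_snd i y).
  by rewrite sub0r.
have := chain_rule open_off0 (z0 : off0 (x.1 - y.1, x.2 - y.2))
  (fun z => @smooth_on_derive R off0 0 h z sh) (fun z => @smooth_on_derive R off0 1 h z sh)
  (smooth_on_cont (smooth_on_partial 0 sh) z0) (smooth_on_cont (smooth_on_partial 1 sh) z0) d1 d2.
move=> D; apply: (is_derive_eq D); move: i {d1 d2 D}; apply: I2_ind => /=.
- by rewrite oppr0 mulr0 addr0 mulrN1.
- by rewrite oppr0 mulr0 add0r mulrN1.
Qed.

Lemma plane_intD f g : intg f -> intg g ->
  plane_int (fun x => f x + g x) = plane_int f + plane_int g.
Proof. by move=> If Ig; rewrite /plane_int RintegralD. Qed.

Lemma plane_intZ c f : intg f -> plane_int (fun x => c * f x) = c * plane_int f.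
Proof. by move=> If; rewrite /plane_int RintegralZl. Qed.

Lemma intgD f g : intg f -> intg g -> intg (fun x => f x + g x).
Proof. by move=> If Ig; have := integrableD measurableT If Ig. Qed.

Lemma intgZ c f : intg f -> intg (fun x => c * f x).
Proof. by move=> If; have := integrableZl measurableT c If. Qed.

Lemma hyper_neq i x y : hyper i x y -> x != y.
Proof. by apply: contraL => /eqP ->; rewrite /hyper; case: ifP; rewrite eqxx. Qed.

(** Moving everything to one side leaves the integral of the derivative of h(x - y) phi(x). As h has
    degree at least 0, its derivative is still integrable and [int_partial0] applies across the
    singularity. *)
Lemma conv_ibp i d h phi (M : R) y : 0 <= M -> hom d.+1 h -> supported M phi ->
  conv (partial i h) phi y = - conv h (partial i phi) y.
Proof.
move=> M0 H sp; have sp' := supported_partial i sp; have H' := hom_partial i H.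
have I1 := conv_intg y M0 H' sp; have I2 := conv_intg y M0 H sp'.
apply/eqP; rewrite -subr_eq0 opprK; apply/eqP.
rewrite /conv -plane_intD//.
apply: (@int_partial0 _ i (fun x => h (x - y) * phi x) _ y M) => //.
- move=> x /hyper_neq xy.
  have D := is_deriveM (is_derive_shift1 i xy (hom_smooth H)) (smooth_on_derive i sp.1 (I : setT x)).
  by apply: (is_derive_eq D); rewrite /GRing.scale/= addrC mulrC.
- move=> x /hyper_neq xy; apply: continuousD; apply: continuousM.
  + exact: hom_cont_shift H' xy.
  + exact: (smooth_on_cont sp.1).
  + exact: hom_cont_shift H xy.
  + exact: (smooth_on_cont sp'.1).
- by move=> x nx; rewrite sp.2// mulr0.
- by move=> x nx; rewrite sp.2// sp'.2// !mulr0 addr0.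
- exact: intgD.
Qed.

Lemma line_derive f v y (t : R) d :
  is_derive (t *: v + y) v f d <-> is_derive t 1 (fun s : R => f (s *: v + y)) d.
Proof.
have E : (fun h : R => h^-1 *: ((f \o shift (t *: v + y)) (h *: v) - f (t *: v + y))) =
   (fun h : R => h^-1 *: (((fun s : R => f (s *: v + y)) \o shift t) (h *: 1) - f (t *: v + y))).
  by apply/funext => h /=; rewrite addrA -scalerDl /GRing.scale/= mulr1.
split=> -[d1 d2]; split.
- by rewrite /derivable -E.
- by rewrite /derive -E.
- by rewrite /derivable E.
- by rewrite /derive E.
Qed.

Definition hset i y : set (mR * mR) := [set x | hyper i x y].

Lemma hset_null i y : measurable (hset i y) /\ mu2 (~` hset i y) = 0%E.
Proof.
move: i; apply: I2_ind.
- have E : ~` hset 0 y = setT `*` [set y.2].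
    apply/seteqP; split => x; rewrite /hset /hyper /=.
      by move=> /negP; rewrite negbK => /eqP.
    by move=> [_ ->]; rewrite eqxx.
  have mE : measurable (~` hset 0 y).
    by rewrite E; apply: measurableX; [exact: measurableT|exact: measurable_set1].
  split; first by rewrite -(setCK (hset 0 y)); exact: measurableC.
  rewrite E; apply: (etrans (@product_measure1E _ _ _ _ _ mu mu _ _ _ _)) => //.
  by rewrite [X in (_ * X)%E](lebesgue_measure_set1 y.2) mule0.
- have E : ~` hset 1 y = [set y.1] `*` setT.
    apply/seteqP; split => x; rewrite /hset /hyper /=.
      by move=> /negP; rewrite negbK => /eqP.
    by move=> [-> _]; rewrite eqxx.
  have mE : measurable (~` hset 1 y).
    by rewrite E; apply: measurableX; [exact: measurable_set1|exact: measurableT].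
  split; first by rewrite -(setCK (hset 1 y)); exact: measurableC.
  rewrite E; apply: (etrans (@product_measure1E _ _ _ _ _ mu mu _ _ _ _)) => //.
  by rewrite [X in (X * _)%E](lebesgue_measure_set1 y.1) mul0e.
Qed.

Lemma plane_int_hset i y f : intg f -> plane_int f = \int[mu2]_(x in hset i y) f x.
Proof.
move=> If; have [mH H0] := hset_null i y.
rewrite /plane_int /Rintegral; congr fine.
rewrite (negligible_integral (measurableC mH) measurableT If H0).
by rewrite setDE setCK setTI.
Qed.

(** For h of degree at least 1 the differentiated kernel is bounded, which dominates the integrand
    uniformly in the shift. [conv_ibp] then puts the derivative on phi, so the argument can be
    iterated with the same h. *)
Lemma conv_derive i d h phi (M : R) y : 0 <= M -> hom d.+2 h -> supported M phi ->
  is_derive y (e_ i) (conv h phi) (conv h (partial i phi) y).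
Proof.
move=> M0 H sp; have H' := hom_partial i H; have sh := hom_smooth H.
have [mH H0] := hset_null i y.
pose f (t : R) (x : mR * mR) : R := h (x - (t *: e_ i + y)) * phi x.
pose rho := `|y.1| + `|y.2| + 1.
have [C [C0 HC]] := conv_dom rho M0 H' sp.
pose G (x : mR * mR) : R := C * \1_(box M : set (mR * mR)) x.
have itf (t : R) : intg (f t) by exact: conv_intg M0 H sp.
(* The moving singularity y + t e_i stays on the line removed in [hset i y], so one null set serves
   all t. *)
have neq (t : R) (x : R * R) : hset i y x -> x != t *: e_ i + y.
  rewrite /hset /hyper /= /basis2; move: i {H' f HC itf G mH H0}; apply: I2_ind => /=; apply: contraNN => /eqP ->.
  - by rewrite /GRing.add/= /GRing.scale/= mulr0 add0r.
  - by rewrite /GRing.add/= /GRing.scale/= mulr0 add0r.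
have Df (t : R) (x : R * R) : hset i y x -> is_derive t 1 (f^~ x) (- (partial i h (x - (t *: e_ i + y)) * phi x)).
  move=> /(neq t) xt; have D := is_derive_shift2 i xt sh.
  have D2 := is_deriveM D (is_derive_cst (phi x) (t *: e_ i + y) (e_ i)).
  apply/(@line_derive (fun z => h (x - z) * phi x)).
  apply: (is_derive_eq D2); rewrite scaler0 add0r /GRing.scale/=.
  by rewrite mulrN mulrC.
have mG : mfun G by apply: measurable_funM; [exact: measurable_cst|apply: measurable_indic; exact: measurable_box].
have iG : intg G.
  apply: (@intg_bounded _ _ M C) => //.
  - by move=> x; rewrite /G normrM (ger0_norm C0) indicE; case: (_ \in _); rewrite /= ?normr1 ?normr0 ?mulr1 ?mulr0.
  - by move=> x nb; rewrite /G indicE memNset// mulr0.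
have bt (t : R) : t \in `]-1, 1[ -> box rho (t *: e_ i + y).
  rewrite in_itv/= => /andP[t1 t2]; rewrite /box /rho /basis2.
  have nt : `|t| <= 1 by rewrite ler_norml; apply/andP; split; exact: ltW.
  have := normr_ge0 y.1; have := normr_ge0 y.2 => a0 b0.
  case: ifP => _; split; rewrite /= /GRing.scale/= ?mulr1 ?mulr0 ?add0r.
  - by have := ler_normD t y.1; lra.
  - by lra.
  - by lra.
  - by have := ler_normD t y.2; lra.
have Gub (t : R) x : `](-1 : R), 1[%classic t -> hset i y x -> `|partial1of2 f t x| <= G x.
  move=> t1 hx; have [_] := Df t x hx; rewrite partial1of2E => ->; rewrite normrN /G indicE.
  have [bx|nb] := pselect (box M x); last first.
    by rewrite memNset// mulr0 sp.2// mulr0 normr0.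
  rewrite mem_set// mulr1; have [_] := HC x _ (bt t t1) (neq t x hx); exact.
have sI g : intg g -> mu2.-integrable (hset i y) (EFin \o g).
  by move=> Ig; apply: integrableS Ig.
have I0 : `](-1 : R), 1[%classic 0 by rewrite /= in_itv/= ltrN10 ltr01.
have G0 x : 0 <= G x by rewrite mulr_ge0.
have d1 := derivable_under_integral mH I0 (fun t _ => sI _ (itf t))
  (fun t x _ hx => @ex_derive _ _ _ _ _ _ _ (Df t x hx)) G0 (sI _ iG) Gub.
have d2 := differentiation_under_integral mH I0 (fun t _ => sI _ (itf t))
  (fun t x _ hx => @ex_derive _ _ _ _ _ _ _ (Df t x hx)) G0 (sI _ iG) Gub.
have E : (fun t : R => conv h phi (t *: e_ i + y)) = (fun t => \int[mu2]_(x in hset i y) f t x).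
  by apply/funext => t; exact: plane_int_hset (itf t).
have D0 : is_derive (0 : R) 1 (fun t : R => conv h phi (t *: e_ i + y))
    (conv h (partial i phi) (0 *: e_ i + y)).
  rewrite E; split => //; rewrite -derive1E d2 scale0r add0r.
  have Ih := conv_intg y M0 H' sp.
  rewrite -[RHS]opprK -(conv_ibp i y M0 H sp) /conv (plane_int_hset i y Ih).
  transitivity (\int[mu2]_(x in hset i y) (- 1 * (partial i h (x - y) * phi x))).
    apply: eq_Rintegral => x; rewrite inE => hx; have [_] := Df 0 x hx.
    by rewrite partial1of2E => ->; rewrite scale0r add0r mulN1r.
  by rewrite RintegralZl ?mulN1r//; exact: sI.
by have := (line_derive (conv h phi) (e_ i) y 0 _).2 D0; rewrite scale0r add0r.
Qed.

Lemma box_mono (M M' : R) x : M <= M' -> box M x -> box M' x.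
Proof. by move=> h [a b]; split; exact: le_trans h. Qed.

Lemma bet_abs (a b z M : R) : bet a b z -> `|a| <= M -> `|b| <= M -> `|z| <= M.
Proof. by rewrite !ler_norml => /orP[] /andP[? ?] /andP[? ?] /andP[? ?]; apply/andP; split; lra. Qed.

Lemma box_lipschitz f (f' : 'I_2 -> R * R -> R) (M C : R) :
  (forall i x, box M x -> is_derive x (e_ i) f (f' i x)) ->
  (forall i x, box M x -> `|f' i x| <= C) ->
  forall x y, box M x -> box M y -> `|f x - f y| <= C * (`|x.1 - y.1| + `|x.2 - y.2|).
Proof.
move=> df fC [x1 x2] [y1 y2] [/= hx1 hx2] [/= hy1 hy2].
have [z hz|z hz e1] := @mean_value R (fun t => f (t, x2)) (fun t => f' 0 (t, x2)) y1 x1.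
  by apply/slice1; apply: df; split => //=; exact: bet_abs hz _ _.
have [w hw|w hw e2] := @mean_value R (fun t => f (y1, t)) (fun t => f' 1 (y1, t)) y2 x2.
  by apply/slice2; apply: df; split => //=; exact: bet_abs hw _ _.
have -> : f (x1, x2) - f (y1, y2) = (f (x1, x2) - f (y1, x2)) + (f (y1, x2) - f (y1, y2)).
  by rewrite addrA subrK.
rewrite e1 e2 [leRHS]mulrDr (le_trans (ler_normD _ _))// !normrM.
by apply: lerD; apply: ler_wpM2r => //; apply: fC; split => //=; [exact: bet_abs hz _ _|exact: bet_abs hw _ _].
Qed.

(** Locally bounded partial derivatives make f locally Lipschitz. This yields the continuity of
    parameter integrals from bounds on their derivatives, which are integrals of the same type. *)
Lemma cont_of_derive f (f' : 'I_2 -> R * R -> R) :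
  (forall i x, is_derive x (e_ i) f (f' i x)) ->
  (forall M : R, exists C : R, forall i x, box M x -> `|f' i x| <= C) ->
  continuous f.
Proof.
move=> df fC x; apply/cont2P => e e0.
pose M := `|x.1| + `|x.2| + 1; have [C HC] := fC M.
have C0 : 0 <= `|C| by [].
exists (Num.min 1 (e / (2 * (`|C| + 1)))).
  by rewrite lt_min ltr01 divr_gt0// mulr_gt0// ltr_wpDl.
move=> z1 z2; rewrite !lt_min => /andP[a1 a2] /andP[b1 b2].
have bx : box M x by rewrite /M; split; have := normr_ge0 x.1; have := normr_ge0 x.2; lra.
have bz : box M (z1, z2).
  have := normr_ge0 x.1; have := normr_ge0 x.2 => ? ?; rewrite /M; split => /=.
  - by have := ler_normB x.1 (x.1 - z1); rewrite opprB addrC subrK; lra.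
  - by have := ler_normB x.2 (x.2 - z2); rewrite opprB addrC subrK; lra.
apply: (le_lt_trans (box_lipschitz (fun i x _ => df i x) HC bx bz)) => /=.
have d0 : 0 < e / (2 * (`|C| + 1)) by rewrite divr_gt0// mulr_gt0// ltr_wpDl.
apply: (@le_lt_trans _ _ (`|C| * (2 * (e / (2 * (`|C| + 1)))))).
  apply: (@le_trans _ _ (`|C| * (`|x.1 - z1| + `|x.2 - z2|))).
    by apply: ler_wpM2r; [exact: addr_ge0|exact: ler_norm].
  apply: ler_wpM2l => //; lra.
have -> : `|C| * (2 * (e / (2 * (`|C| + 1)))) = e * (`|C| / (`|C| + 1)).
  have : `|C| + 1 != 0 by rewrite gt_eqF// ltr_wpDl.
  by move: (`|C|) => c c0; field.
by rewrite gtr_pMr// ltr_pdivrMr ?ltr_wpDl// mul1r ltrDl.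
Qed.

Lemma plane_int_le f (M C : R) : intg f -> (forall x, `|f x| <= C) ->
  (forall x, ~ box M x -> f x = 0) -> `|plane_int f| <= C * fine (mu2 (box M)).
Proof.
move=> If fC f0.
have C0 : 0 <= C by apply: le_trans (fC 0).
pose G (x : mR * mR) : R := \1_(box M : set (mR * mR)) x.
have mG : mfun G by apply: measurable_indic; exact: measurable_box.
have iG : intg G.
  apply: (@intg_bounded _ _ M 1) => //.
  - by move=> x; rewrite /G indicE; case: (_ \in _); rewrite /= ?normr1 ?normr0.
  - by move=> x nb; rewrite /G indicE memNset.
apply: (le_trans (le_normr_Rintegral measurableT If)).
have -> : C * fine (mu2 (box M)) = plane_int (fun x => C * G x).
  rewrite (plane_intZ C iG) /plane_int /Rintegral /G integral_indic//; last exact: measurable_box.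
  by rewrite setIT.
apply: le_Rintegral => //.
- by have := integrable_abse If.
- exact: intgZ.
- move=> x _; rewrite /G indicE; have [bx|nb] := pselect (box M x).
    by rewrite mem_set// mulr1.
  by rewrite memNset// mulr0 f0// normr0.
Qed.

Lemma conv_bound d h phi (M rho : R) : 0 <= M -> hom d.+1 h -> supported M phi ->
  exists C : R, forall y, box rho y -> `|conv h phi y| <= C.
Proof.
move=> M0 H sp; have [C [C0 HC]] := conv_dom rho M0 H sp.
have [D [D0 HD]] := supported_bound sp.
exists ((C + `|h 0| * D) * fine (mu2 (box M))) => y yb.
apply: plane_int_le; first exact: conv_intg M0 H sp.
- move=> x; have [->|xy] := eqVneq x y.
    by rewrite subrr normrM (@le_trans _ _ (`|h 0| * D))// ?ler_wpM2l// lerDr.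
  by have [_ /(_ isT)] := HC x y yb xy; move=> /le_trans; apply; rewrite lerDl mulr_ge0.
- by move=> x nb; rewrite sp.2// mulr0.
Qed.

Lemma conv_smooth d h phi (M : R) : 0 <= M -> hom d.+2 h -> supported M phi ->
  smooth (conv h phi).
Proof.
move=> M0 H sp.
have cc psi : supported M psi -> continuous (conv h psi).
  move=> sp'; apply: (@cont_of_derive _ (fun i => conv h (partial i psi))).
    by move=> i y; exact: conv_derive M0 H sp'.
  move=> rho; have [C0 HC0] := conv_bound rho M0 H (supported_partial 0 sp').
  have [C1 HC1] := conv_bound rho M0 H (supported_partial 1 sp').
  exists (Num.max C0 C1); apply: I2_ind => y yb; rewrite le_max.
    by rewrite (HC0 y yb).
  by rewrite (HC1 y yb) orbT.
apply/smooth_onP => [|n]; first exact: openT.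
elim: n phi sp => [|n IH] phi sp.
  by apply: Cn0I => x _; exact: cc sp x.
apply: (CnSI (f' := fun i => conv h (partial i phi))).
- by move=> x _; exact: cc sp x.
- by move=> i x _; exact: conv_derive M0 H sp.
- by move=> i; exact: IH (supported_partial i sp).
Qed.

Lemma conv_partials d h phi (M : R) s : 0 <= M -> hom d.+2 h -> supported M phi ->
  partials s (conv h phi) = conv h (partials s phi).
Proof.
move=> M0 H; elim/last_ind: s phi => // s i IH phi sp.
rewrite !partials_rcons -IH; last exact: supported_partial.
congr (partials s _); apply/funext => y.
by have [_] := conv_derive i y M0 H sp.
Qed.

Lemma supported_partials (M : R) s phi : supported M phi -> supported M (partials s phi).
Proof. by move=> sp; elim: s => // i s; exact: supported_partial. Qed.

Lemma conv_kernel_partials d h phi (M : R) s : 0 <= M -> hom (size s + d) h ->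
  supported M phi ->
  conv (partials s h) phi = fun y => (-1) ^+ size s * conv h (partials (rev s) phi) y.
Proof.
move=> M0; elim: s d phi => [|i s IH] d phi H sp.
  by apply/funext => y; rewrite mul1r.
apply/funext => y /=.
have H1 : hom d.+1 (partials s h) by apply: hom_partials; rewrite addnS.
rewrite (conv_ibp i y M0 H1 sp) (IH d.+1 _ _ (supported_partial i sp)); last by rewrite addnS.
by rewrite exprS mulN1r mulNr rev_cons partials_rcons.
Qed.

End Convolution.

(** * Derivatives of |x|^(2r-1) and the span of the homogeneous kernels *)

Section Kernels.
Context {R : realType}.
Implicit Types (A : set (R * R)) (f g h : R * R -> R) (x y : R * R).

Notation nrm := (@euclid_norm R).

Lemma smooth_on_partials A s f : smooth_on A f -> smooth_on A (partials s f).
Proof. by move=> sf; elim: s => [//|i s]; exact: smooth_on_partial. Qed.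

Lemma partial_eq_on A i f g x : open A -> A x -> (forall y, A y -> f y = g y) ->
  partial i f x = partial i g x.
Proof.
move=> oA Ax fg; apply: (@partials_eq_on _ A [:: i] f g oA); last by rewrite inE.
by move=> y; rewrite inE; exact: fg.
Qed.

Lemma pderivS2 A a b f x : open A -> smooth_on A f -> A x ->
  pderiv a b.+1 f x = partial 1 (pderiv a b f) x.
Proof.
move=> oA sf; elim: a x => [|a IH] x Ax; first by [].
have -> : pderiv a.+1 b.+1 f x = partial 0 (pderiv a b.+1 f) x by [].
rewrite (partial_eq_on _ oA Ax IH).
exact: partialC oA Ax (smooth_on_partials _ sf).
Qed.

Lemma partial_eq_off0 i f g x : (forall y, y != 0 -> f y = g y) -> x != 0 ->
  partial i f x = partial i g x.
Proof. by move=> fg x0; apply: (partial_eq_on _ open_off0). Qed.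

Lemma pderiv_eq_off0 a b f g x : (forall y, y != 0 -> f y = g y) -> x != 0 ->
  pderiv a b f x = pderiv a b g x.
Proof.
move=> fg x0; apply: (@partials_eq_on _ off0 _ f g open_off0); last by rewrite inE.
by move=> y; rewrite inE; exact: fg.
Qed.

Lemma partial_fst i x : partial i (fst : R * R -> R) x = (i == 0)%:R.
Proof. by have [_] := is_derive_fst i x. Qed.

Lemma partial_snd i x : partial i (snd : R * R -> R) x = (i == 1)%:R.
Proof. by have [_] := is_derive_snd i x. Qed.

Lemma partial_mulfst i f x : smooth_on off0 f -> x != 0 ->
  partial i (fun x => x.1 * f x) x = x.1 * partial i f x + (i == 0)%:R * f x.
Proof.
by move=> sf x0; rewrite (partialM i (smooth_on_fst open_off0) sf x0) partial_fst.
Qed.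

Lemma partial_mulsnd i f x : smooth_on off0 f -> x != 0 ->
  partial i (fun x => x.2 * f x) x = x.2 * partial i f x + (i == 1)%:R * f x.
Proof.
by move=> sf x0; rewrite (partialM i (smooth_on_snd open_off0) sf x0) partial_snd.
Qed.

Lemma smooth_mulfst f : smooth_on off0 f -> smooth_on off0 (fun x => x.1 * f x).
Proof. by move=> sf; exact: (smooth_onM open_off0 (smooth_on_fst open_off0) sf). Qed.

Lemma smooth_mulsnd f : smooth_on off0 f -> smooth_on off0 (fun x => x.2 * f x).
Proof. by move=> sf; exact: (smooth_onM open_off0 (smooth_on_snd open_off0) sf). Qed.

Lemma pderiv_mulfst a b f x : smooth_on off0 f -> x != 0 ->
  pderiv a b (fun x => x.1 * f x) x = x.1 * pderiv a b f x + a%:R * pderiv a.-1 b f x.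
Proof.
move=> sf; have o0 := @open_off0 R.
have base b' y : y != 0 -> pderiv 0 b' (fun x => x.1 * f x) y = y.1 * pderiv 0 b' f y.
  elim: b' y => [//|b' IH] y y0.
  have -> : pderiv 0 b'.+1 (fun x => x.1 * f x) y = partial 1 (pderiv 0 b' (fun x => x.1 * f x)) y by [].
  by rewrite (partial_eq_off0 _ IH)// (partial_mulfst 1 (smooth_on_partials _ sf) y0) mul0r addr0.
elim: a x => [|a IH] x x0; first by rewrite base// mul0r addr0.
have -> : pderiv a.+1 b (fun x => x.1 * f x) x = partial 0 (pderiv a b (fun x => x.1 * f x)) x by [].
have sa : smooth_on off0 (pderiv a b f) by exact: smooth_on_partials.
have sa1 : smooth_on off0 (pderiv a.-1 b f) by exact: smooth_on_partials.
rewrite (partial_eq_off0 _ IH)// (partialD 0 (smooth_mulfst sa) (smooth_onZ _ o0 sa1) x0).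
rewrite partial_mulfst// (partialZ 0 _ sa1 x0) mul1r -addrA; congr (_ + _).
case: a {IH sa sa1} => [|a] /=; first by rewrite mul0r addr0 mul1r.
have -> : partial 0 (pderiv a b f) x = pderiv a.+1 b f x by [].
by rewrite -[in RHS]natr1 mulrDl mul1r addrC.
Qed.

Lemma pderiv_mulsnd a b f x : smooth_on off0 f -> x != 0 ->
  pderiv a b (fun x => x.2 * f x) x = x.2 * pderiv a b f x + b%:R * pderiv a b.-1 f x.
Proof.
move=> sf; have o0 := @open_off0 R.
have sg := smooth_mulsnd sf.
elim: b x => [|b IH] x x0.
  rewrite mul0r addr0; elim: a x x0 => [//|a IH] x x0.
  have -> : pderiv a.+1 0 (fun x => x.2 * f x) x = partial 0 (pderiv a 0 (fun x => x.2 * f x)) x by [].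
  by rewrite (partial_eq_off0 _ IH)// (partial_mulsnd 0 (smooth_on_partials _ sf) x0) mul0r addr0.
rewrite (pderivS2 _ _ o0 sg x0).
have sa : smooth_on off0 (pderiv a b f) by exact: smooth_on_partials.
have sa1 : smooth_on off0 (pderiv a b.-1 f) by exact: smooth_on_partials.
rewrite (partial_eq_off0 _ IH)// (partialD 1 (smooth_mulsnd sa) (smooth_onZ _ o0 sa1) x0).
rewrite partial_mulsnd// (partialZ 1 _ sa1 x0) mul1r -addrA (pderivS2 _ _ o0 sf x0); congr (_ + _).
case: b {IH sa sa1} => [|b] /=; first by rewrite mul0r addr0 mul1r.
rewrite -(pderivS2 _ _ o0 sf x0).
by rewrite -[in RHS]natr1 mulrDl mul1r addrC.
Qed.

(* |x|^(2r-1); its derivatives of order 2r are the kernels of the normal operator with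
   r = k + l, see [pderiv_pot]. *)
Definition pot (r : nat) x : R := (x.1 ^+ 2 + x.2 ^+ 2) ^+ r / nrm x.

Lemma hom_mulQ d h : hom d h -> hom d.+2 (fun x => (x.1 ^+ 2 + x.2 ^+ 2) * h x).
Proof.
elim=> {d h} [a b s d e|d f g _ IHf _ IHg|d c f _ IH|d f g fg _ IH].
- apply: (@hom_eq _ _ (fun x => ker a.+2 b s x + ker a b.+2 s x)).
    by move=> x _; rewrite /ker !exprS; ring.
  by apply: hom_add; apply: hom_ker; lia.
- by apply: (hom_eq _ (hom_add IHf IHg)) => x _; rewrite mulrDr.
- by apply: (hom_eq _ (hom_scale c IH)) => x _; rewrite mulrCA.
- by apply: (hom_eq _ IH) => x x0; rewrite fg.
Qed.

Lemma hom_pot r : hom (2 * r) (pot r).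
Proof.
elim: r => [|r IH].
  apply: (@hom_eq _ _ (ker 0 0 1)); last exact: hom_ker.
  by move=> x _; rewrite /ker /pot !expr0 mulr1.
rewrite mulnS; apply: (hom_eq _ (hom_mulQ IH)) => x _.
by rewrite /pot [in RHS](exprS _ r) mulrA.
Qed.

(** The square of the double factorial (2r - 1)!!. *)
Fixpoint pot_cst (r : nat) : R := if r is r'.+1 then (2 * r' + 1)%:R ^+ 2 * pot_cst r' else 1.

Lemma pot_cst_neq0 r : pot_cst r != 0.
Proof.
elim: r => [|r IH] /=; first exact: oner_neq0.
by rewrite mulf_neq0// expf_neq0// pnatr_eq0 addn1.
Qed.

(** The Leibniz rule for a quadratic factor, obtained one coordinate factor at a time; predecessors
    truncated at 0 carry a zero coefficient. *)
Lemma pderiv_mulQ a b g x : smooth_on off0 g -> x != 0 ->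
  pderiv a b (fun x => (x.1 ^+ 2 + x.2 ^+ 2) * g x) x =
  (x.1 ^+ 2 + x.2 ^+ 2) * pderiv a b g x
  + 2 * a%:R * x.1 * pderiv a.-1 b g x + 2 * b%:R * x.2 * pderiv a b.-1 g x
  + a%:R * a.-1%:R * pderiv a.-2 b g x + b%:R * b.-1%:R * pderiv a b.-2 g x.
Proof.
move=> sg x0.
rewrite (@pderiv_eq_off0 _ _ _ (fun x => x.1 * (x.1 * g x) + x.2 * (x.2 * g x)))//;
  last by move=> y _; ring.
have DD s f h : smooth_on off0 f -> smooth_on off0 h -> forall y, y != 0 ->
    partials s (fun x => f x + h x) y = partials s f y + partials s h y.
  move=> sf sh; elim: s => [//|i s IH] y y0 /=.
  by rewrite (partial_eq_off0 _ IH)// (partialD i (smooth_on_partials _ sf) (smooth_on_partials _ sh) y0).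
have s1 := smooth_mulfst sg; have s2 := smooth_mulsnd sg.
rewrite {1}/pderiv (DD _ _ _ (smooth_mulfst s1) (smooth_mulsnd s2))//.
rewrite -!/(pderiv a b _) (pderiv_mulfst _ _ s1 x0) !(pderiv_mulfst _ _ sg x0).
rewrite (pderiv_mulsnd _ _ s2 x0) !(pderiv_mulsnd _ _ sg x0); ring.
Qed.

Lemma partial_kerZ0 c a b s x : x != 0 -> partial 0 (fun x => c * ker a b s x) x =
  c * (a%:R * ker a.-1 b s x - s%:R * ker a.+1 b s.+2 x).
Proof. by move=> x0; rewrite (partialZ 0 c (smooth_ker a b s) x0) partial_ker0. Qed.

Lemma partial_kerZ1 c a b s x : x != 0 -> partial 1 (fun x => c * ker a b s x) x =
  c * (b%:R * ker a b.-1 s x - s%:R * ker a b.+1 s.+2 x).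
Proof. by move=> x0; rewrite (partialZ 1 c (smooth_ker a b s) x0) partial_ker1. Qed.

Lemma partial_ker2 i c a b s (u v : R) a1 b1 a2 b2 s2 x : x != 0 ->
  (forall y, y != 0 -> partial i (fun x => c * ker a b s x) y =
     c * (u * ker a1 b1 s y - v * ker a2 b2 s2 y)) ->
  forall j, partial j (partial i (fun x => c * ker a b s x)) x =
     c * (u * partial j (ker a1 b1 s) x - v * partial j (ker a2 b2 s2) x).
Proof.
move=> x0 H j; rewrite (partial_eq_off0 _ H)//.
have o0 := @open_off0 R.
have s1 := smooth_onZ u o0 (smooth_ker a1 b1 s).
have s2' := smooth_onZ v o0 (smooth_ker a2 b2 s2).
rewrite (partialZ j c (smooth_onB o0 s1 s2') x0) (partialD j s1 (smooth_onN o0 s2') x0).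
rewrite (partialZ j u (smooth_ker a1 b1 s) x0).
have -> : partial j (fun x => - (v * ker a2 b2 s2 x)) x = - v * partial j (ker a2 b2 s2) x.
  have -> : (fun x => - (v * ker a2 b2 s2 x)) = (fun x => - v * ker a2 b2 s2 x).
    by apply/funext => y; rewrite mulNr.
  exact: (partialZ j (- v) (smooth_ker a2 b2 s2) x0).
by rewrite mulNr.
Qed.

Lemma nrm_pow2 s x : nrm x ^+ s.+2 = nrm x ^+ s * (x.1 ^+ 2 + x.2 ^+ 2).
Proof. by rewrite -nrm_sq -exprD addn2. Qed.

Lemma partial_ker00 c a b s x : x != 0 ->
  partial 0 (partial 0 (fun x => c * ker a b s x)) x =
  c * (a%:R * (a.-1%:R * ker a.-2 b s x - s%:R * ker a.-1.+1 b s.+2 x)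
       - s%:R * (a.+1%:R * ker a b s.+2 x - s.+2%:R * ker a.+2 b s.+4 x)).
Proof.
move=> x0; rewrite (partial_ker2 x0 (fun y hy => @partial_kerZ0 c a b s y hy)).
by rewrite !partial_ker0.
Qed.

Lemma partial_ker11 c a b s x : x != 0 ->
  partial 1 (partial 1 (fun x => c * ker a b s x)) x =
  c * (b%:R * (b.-1%:R * ker a b.-2 s x - s%:R * ker a b.-1.+1 s.+2 x)
       - s%:R * (b.+1%:R * ker a b s.+2 x - s.+2%:R * ker a b.+2 s.+4 x)).
Proof.
move=> x0; rewrite (partial_ker2 x0 (fun y hy => @partial_kerZ1 c a b s y hy)).
by rewrite !partial_ker1.
Qed.

Lemma partial_ker01 c a b s x : x != 0 ->
  partial 0 (partial 1 (fun x => c * ker a b s x)) x =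
  c * (b%:R * (a%:R * ker a.-1 b.-1 s x - s%:R * ker a.+1 b.-1 s.+2 x)
       - s%:R * (a%:R * ker a.-1 b.+1 s.+2 x - s.+2%:R * ker a.+1 b.+1 s.+4 x)).
Proof.
move=> x0; rewrite (partial_ker2 x0 (fun y hy => @partial_kerZ1 c a b s y hy)).
by rewrite !partial_ker0.
Qed.

(** Induction through |x|^(2r+1) = |x|^2 |x|^(2r-1): every term of [pderiv_mulQ] is a derivative of
    [pot r] of order at least 2r, hence the inductive formula differentiated at most twice, and a
    rational identity remains. *)
Theorem pderiv_pot r a b x : (a + b = 2 * r)%N -> x != 0 ->
  pderiv a b (pot r) x = pot_cst r * (-1) ^+ a * ker b a (2 * r + 1) x.
Proof.
elim: r a b x => [|r IH] a b x ab x0.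
  have [-> ->] : a = 0%N /\ b = 0%N by lia.
  by rewrite /pderiv /pot /ker /= !expr0 !mulr1 !mul1r.
have o0 := @open_off0 R.
have sg : smooth_on off0 (pot r) := hom_smooth (hom_pot r).
pose C := pot_cst r.
have G c d y : (c + d = 2 * r)%N -> y != 0 ->
    pderiv c d (pot r) y = C * (-1) ^+ c * ker d c (2 * r + 1) y by move=> *; exact: IH.
have E1 i c d : (c + d = 2 * r)%N -> forall y, y != 0 -> partial i (pderiv c d (pot r)) y =
    partial i (fun x => C * (-1) ^+ c * ker d c (2 * r + 1) x) y.
  by move=> cd y y0; apply: partial_eq_off0 => // z z0; exact: G.
have E2 i j c d : (c + d = 2 * r)%N -> forall y, y != 0 ->
    partial j (partial i (pderiv c d (pot r))) y =
    partial j (partial i (fun x => C * (-1) ^+ c * ker d c (2 * r + 1) x)) y.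
  by move=> cd y y0; apply: partial_eq_off0 => // z z0; exact: E1.
have n0 : nrm x != 0 by rewrite gt_eqF// nrm_gt0.
have q0 : x.1 ^+ 2 + x.2 ^+ 2 != 0 by rewrite -sqd0E gt_eqF// sqd0_gt0.
have S2 : (2 * r.+1 + 1 = (2 * r + 1).+2)%N by lia.
have CS : pot_cst r.+1 = (2 * r + 1)%:R ^+ 2 * C by [].
rewrite (@pderiv_eq_off0 a b _ (fun x => (x.1 ^+ 2 + x.2 ^+ 2) * pot r x))//; last first.
  by move=> y _; rewrite /pot (exprS _ r) mulrA.
rewrite pderiv_mulQ// CS S2.
have fin : forall m : nat, nrm x ^+ m != 0 by move=> m; rewrite expf_neq0.
(* Two derivatives have to be split off to come down to the known order 2r: both in x1 if a >= 2,
   both in x2 if a = 0, one of each if a = 1. *)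
have [a2|a1] := leqP 2 a.
  case: a a2 ab => [//|[//|a]] _ ab.
  have -> : pderiv a.+2 b (pot r) x = partial 0 (partial 0 (pderiv a b (pot r))) x by exact: erefl.
  have -> : pderiv a.+2.-1 b (pot r) x = partial 0 (pderiv a b (pot r)) x by exact: erefl.
  have ab0 : (a + b = 2 * r)%N by lia.
  rewrite (E2 _ _ _ _ ab0 _ x0) (E1 _ _ _ ab0 _ x0) (G a.+2.-2 b x ab0 x0).
  rewrite partial_ker00// partial_kerZ0//.
  have sE : (2 * r + 1 = (a + b).+1)%N by lia.
  rewrite sE in ab0 *; case: b ab ab0 sE => [|[|b]] ab ab0 sE /=.
  - rewrite !mulr0 !mul0r; rewrite /ker !nrm_pow2; move: n0 q0 (fin (a + 0).+1).
    move: x.1 x.2 (nrm x ^+ (a + 0).+1) => X Y W _ q0 w0.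
    rewrite !exprS; move: ((-1) ^+ a) => sg'; move: q0; rewrite !expr2 => q0.
    field; rewrite ?q0 ?w0//.
  - have -> : pderiv a.+2 0 (pot r) x = partial 0 (pderiv a.+1 0 (pot r)) x by exact: erefl.
    have ab1 : (a.+1 + 0 = 2 * r)%N by lia.
    rewrite (E1 _ _ _ ab1 _ x0) partial_kerZ0// sE.
    rewrite /ker !nrm_pow2; move: n0 q0 (fin (a + 1).+1).
    move: x.1 x.2 (nrm x ^+ (a + 1).+1) => X Y W _ q0 w0.
    rewrite !exprS; move: ((-1) ^+ a) => sg'; move: q0; rewrite !expr2 => q0.
    field; rewrite ?q0 ?w0//.
  - have -> : pderiv a.+2 b.+1 (pot r) x = partial 0 (pderiv a.+1 b.+1 (pot r)) x by exact: erefl.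
    have ab1 : (a.+1 + b.+1 = 2 * r)%N by lia.
    have ab2 : (a.+2 + b = 2 * r)%N by lia.
    rewrite (E1 _ _ _ ab1 _ x0) partial_kerZ0// (G _ _ _ ab2 x0) sE.
    rewrite /ker !nrm_pow2; move: n0 q0 (fin (a + b.+2).+1).
    move: x.1 x.2 (nrm x ^+ (a + b.+2).+1) => X Y W _ q0 w0.
    rewrite !exprS; move: ((-1) ^+ a) => sg'; move: q0; rewrite !expr2 => q0.
    field; rewrite ?q0 ?w0//.
have [b2|b1] := leqP 2 b; last first.
  have [-> -> r0] : [/\ a = 1%N, b = 1%N & r = 0%N] by split; lia.
  have -> : pderiv 1 1 (pot r) x = partial 0 (partial 1 (pderiv 0 0 (pot r))) x by exact: erefl.
  have -> : pderiv 1.-1 1 (pot r) x = partial 1 (pderiv 0 0 (pot r)) x by exact: erefl.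
  have -> : pderiv 1 1.-1 (pot r) x = partial 0 (pderiv 0 0 (pot r)) x by exact: erefl.
  have ab0 : (0 + 0 = 2 * r)%N by lia.
  rewrite (E2 _ _ _ _ ab0 _ x0) !(E1 _ _ _ ab0 _ x0).
  rewrite partial_ker01// partial_kerZ0// partial_kerZ1// r0 /=.
  rewrite /ker !nrm_pow2 muln0 add0n expr1; move: n0 q0 => n0 q0.
  move: x.1 x.2 (nrm x) n0 q0 => X Y W w0.
  rewrite !exprS !expr0 => q0; move: q0; rewrite !mulr1 => q0.
  field; rewrite ?q0 ?w0//.
case: b b2 ab => [//|[//|b]] _ ab.
have sg1 := hom_smooth (hom_pot r).
have P2 c d : pderiv c d.+2 (pot r) x = partial 1 (partial 1 (pderiv c d (pot r))) x.
  rewrite (pderivS2 _ _ o0 sg x0); apply: partial_eq_off0 => // y hy.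
  exact: pderivS2 o0 sg hy.
case: a a1 ab => [_|[_|//]] ab.
  have ab0 : (0 + b = 2 * r)%N by lia.
  have -> : pderiv 0 b.+2.-1 (pot r) x = partial 1 (pderiv 0 b (pot r)) x by exact: erefl.
  rewrite P2 (E2 _ _ _ _ ab0 _ x0) (E1 _ _ _ ab0 _ x0) (G _ _ _ ab0 x0).
  rewrite partial_ker11// partial_kerZ1//.
  have sE : (2 * r + 1 = b.+1)%N by lia.
  rewrite sE /ker !nrm_pow2 /=; move: n0 q0 (fin b.+1).
  move: x.1 x.2 (nrm x ^+ b.+1) => X Y W _ q0 w0.
  rewrite !exprS; move: q0; rewrite !expr2 => q0; field; rewrite ?q0 ?w0//.
have ab0 : (0 + b.+1 = 2 * r)%N by lia.
have ab1 : (1 + b = 2 * r)%N by lia.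
have -> : pderiv 1 b.+2 (pot r) x = partial 0 (partial 1 (pderiv 0 b.+1 (pot r))) x by exact: erefl.
have -> : pderiv 1.-1 b.+2 (pot r) x = partial 1 (pderiv 0 b.+1 (pot r)) x by exact: erefl.
have -> : pderiv 1 b.+2.-1 (pot r) x = partial 0 (pderiv 0 b.+1 (pot r)) x by exact: erefl.
rewrite (E2 _ _ _ _ ab0 _ x0) !(E1 _ _ _ ab0 _ x0) (G _ _ _ ab1 x0).
rewrite partial_ker01// partial_kerZ0// partial_kerZ1//.
have sE : (2 * r + 1 = b.+2)%N by lia.
rewrite sE /ker !nrm_pow2 /=; move: n0 q0 (fin b).
move: x.1 x.2 (nrm x ^+ b) => X Y W _ q0 w0.
rewrite !exprS; move: q0; rewrite !expr2 => q0; field; rewrite ?q0 ?w0//.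
Qed.

(* The kernels of total degree n over N^(2n+1) are obtained from 1/N by differentiation:
   the two expressions for the derivatives of neighbouring monomials form a 2 x 2 linear
   system of determinant -(2n+1)n. *)
Theorem ker_span (P : (R * R -> R) -> Prop) :
  (forall f g, (forall x, x != 0 -> f x = g x) -> P f -> P g) ->
  (forall f g, smooth_on off0 f -> smooth_on off0 g -> P f -> P g -> P (fun x => f x + g x)) ->
  (forall c f, smooth_on off0 f -> P f -> P (fun x => c * f x)) ->
  (forall i f, smooth_on off0 f -> P f -> P (partial i f)) ->
  P (ker 0 0 1) -> forall n a b, (a + b = n)%N -> P (ker a b (2 * n + 1)).
Proof.
move=> Peq Padd Pscale Pder P0; elim=> [|n IH] a b ab.
  by have [-> ->] : a = 0%N /\ b = 0%N by lia.
pose s := (2 * n + 1)%N; have sE : (2 * n.+1 + 1 = s.+2)%N by rewrite /s; lia.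
have sk a' b' s' := @smooth_ker R a' b' s'.
have sc c a' b' s' := smooth_onZ c open_off0 (sk a' b' s').
have Pc c a' b' s' : P (ker a' b' s') -> P (fun x => c * ker a' b' s' x) by exact: Pscale.
have Pinv c a' b' s' : c != 0 -> P (fun x => c * ker a' b' s' x) -> P (ker a' b' s').
  move=> c0 H; apply: (Peq (fun x => c^-1 * (c * ker a' b' s' x))).
    by move=> x _; rewrite mulrA mulVf// mul1r.
  by apply: Pscale => //; exact: sc.
have S0 : s%:R != 0 :> R by rewrite pnatr_eq0 /s addn1.
have D0 c d : (c + d = n)%N -> P (fun x => c%:R * ker c.-1 d s x + (- s%:R) * ker c.+1 d s.+2 x).
  move=> cd; apply: (Peq (partial 0 (ker c d s))); last by apply: Pder => //; exact: IH.
  by move=> x x0; rewrite partial_ker0// mulNr.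
have D1 c d : (c + d = n)%N -> P (fun x => d%:R * ker c d.-1 s x + (- s%:R) * ker c d.+1 s.+2 x).
  move=> cd; apply: (Peq (partial 1 (ker c d s))); last by apply: Pder => //; exact: IH.
  by move=> x x0; rewrite partial_ker1// mulNr.
have pair c d : (c + d.+1 = n)%N -> P (ker c.+2 d s.+2) /\ P (ker c d.+2 s.+2).
  move=> cd; have H0 := D0 c.+1 d (etrans (addSnnS c d) cd); have H1 := D1 c d.+1 cd.
  have n0 : n%:R != 0 :> R by rewrite pnatr_eq0; lia.
  have sD c1 c2 : smooth_on off0 (fun x => c1 * ker c.+2 d s.+2 x + c2 * ker c d.+2 s.+2 x).
    exact: (smooth_onD open_off0 (sc _ _ _ _) (sc _ _ _ _)).
  have {}H0 : P (fun x => (c.+1%:R - s%:R) * ker c.+2 d s.+2 x + c.+1%:R * ker c d.+2 s.+2 x).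
    by apply: Peq H0 => x x0 /=; rewrite [ker c d s x]ker_raise//; ring.
  have {}H1 : P (fun x => d.+1%:R * ker c.+2 d s.+2 x + (d.+1%:R - s%:R) * ker c d.+2 s.+2 x).
    by apply: Peq H1 => x x0 /=; rewrite [ker c d s x]ker_raise//; ring.
  have nE : s%:R = 2 * n%:R + 1 :> R by rewrite /s natrD natrM.
  have cE : n%:R = c.+1%:R + d%:R :> R by rewrite -natrD; congr (_%:R); lia.
  have sn0 : s%:R * n%:R != 0 :> R by rewrite mulf_neq0.
  split; apply: (Pinv (- (s%:R * n%:R))); rewrite ?oppr_eq0//.
  - apply: (Peq _ _ _ (Padd _ _ (smooth_onZ _ open_off0 (sD _ _)) (smooth_onZ _ open_off0 (sD _ _))
      (Pscale (s%:R - d.+1%:R) _ (sD _ _) H0) (Pscale c.+1%:R _ (sD _ _) H1))) => x x0 /=.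
    rewrite nE cE; ring.
  - apply: (Peq _ _ _ (Padd _ _ (smooth_onZ _ open_off0 (sD _ _)) (smooth_onZ _ open_off0 (sD _ _))
      (Pscale d.+1%:R _ (sD _ _) H0) (Pscale (s%:R - c.+1%:R) _ (sD _ _) H1))) => x x0 /=.
    rewrite nE cE; ring.
(* For a = 1 the derivative of [ker 0 n s] in x1 has a single term, the kernel wanted. For a = 0 the
   pair with c = 0 applies, except at n = 0, where one derivative of 1/|x| in x2 does. *)
rewrite sE; case: a ab => [|[|a]] ab.
- case: n {IH} @s sE S0 D0 D1 pair sk sc Pc Pinv ab => [|n] s sE S0 D0 D1 pair sk sc Pc Pinv ab.
    have -> : b = 1%N by lia.
    apply: (Pinv (- s%:R)); first by rewrite oppr_eq0.
    by apply: Peq (D1 0%N 0%N erefl) => x _; rewrite mul0r add0r.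
  have -> : b = n.+2 by lia.
  exact: (pair 0%N n erefl).2.
- have -> : b = n by lia.
  apply: (Pinv (- s%:R)); first by rewrite oppr_eq0.
  by apply: Peq (D0 0%N n erefl) => x _; rewrite mul0r add0r.
- by apply: (pair a b _).1; lia.
Qed.

End Kernels.

(** * Primitives in one variable that depend smoothly on both *)

Section Primitive.
Context {R : realType}.
Implicit Types (B : set (R * R)) (f g phi psi : R * R -> R) (x y : R * R).

Notation e_ := (@basis2 R).
Notation mu := (@lebesgue_measure R).
Notation mR := (measurableTypeR R).

Definition seg (c s : R) x : R * R := (c + s * (x.1 - c), x.2).

(** A weighted mean over the horizontal segment from (c, x.2) to x. The weights s^k make the family
    stable under differentiation: each derivative in x.1 brings out one more factor s. *)
Definition avg (c : R) (k : nat) phi x : R :=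
  \int[mu]_(s in `[(0 : R), 1]) (s ^+ k * phi (seg c s x)).

Lemma seg_box (c M s : R) x : 0 <= s <= 1 -> `|c| <= M -> box M x -> box M (seg c s x).
Proof.
move=> /andP[s0 s1] cM [b1 b2]; split => //=.
have -> : c + s * (x.1 - c) = (1 - s) * c + s * x.1 by ring.
apply: (le_trans (ler_normD _ _)); rewrite !normrM (ger0_norm s0) ger0_norm ?subr_ge0//.
have -> : M = (1 - s) * M + s * M by ring.
by apply: lerD; apply: ler_wpM2l; rewrite ?subr_ge0.
Qed.

Lemma avg_cont k c phi x : continuous phi ->
  continuous (fun s : R => s ^+ k * phi (seg c s x)).
Proof.
move=> cp s.
have c0 : {for s, continuous (fun s : R => phi (seg c s x))}; last first.
  exact: (@continuousM R R (fun s => s ^+ k) (fun s => phi (seg c s x)) s (@exprn_continuous R k s) c0).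
apply: (@continuous_comp _ _ _ (fun s => seg c s x) phi); last exact: cp.
have c1 : {for s, continuous (fun s : R => c + s * (x.1 - c))}.
  apply: continuousD; first exact: cst_continuous.
  by apply: continuousM; [exact: cvg_id|exact: cst_continuous].
exact: (cvg_pair c1 (@cvg_cst _ x.2 _ _ _)).
Qed.

Lemma avg_int k c phi x : continuous phi ->
  mu.-integrable `[(0 : R), 1] (EFin \o (fun s : R => s ^+ k * phi (seg c s x))).
Proof.
move=> cp; apply: continuous_compact_integrable; first exact: segment_compact.
by apply: continuous_subspaceT; exact: avg_cont.
Qed.

Lemma int01_le (g : R -> R) (C : R) : mu.-integrable `[(0 : R), 1] (EFin \o g) ->
  (forall s, 0 <= s <= 1 -> `|g s| <= C) -> `|\int[mu]_(s in `[(0 : R), 1]) g s| <= C.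
Proof.
move=> Ig gC; apply: (le_trans (le_normr_Rintegral _ Ig)); first exact: measurable_itv.
have -> : C = \int[mu]_(s in `[(0 : R), 1]) (cst C s).
  rewrite Rintegral_cst; last exact: measurable_itv.
  by rewrite [X in fine X]lebesgue_measure_itv/= lte_fin ltr01 oppr0 adde0 mulr1.
apply: le_Rintegral; first exact: measurable_itv.
- by have := integrable_abse Ig.
- apply: continuous_compact_integrable; first exact: segment_compact.
  by apply: continuous_subspaceT; exact: cst_continuous.
- by move=> s; rewrite /= in_itv/=; exact: gC.
Qed.

Lemma avg_bound k c phi (M B : R) x : smooth phi -> `|c| <= M -> box M x ->
  (forall y, box M y -> `|phi y| <= B) -> `|avg c k phi x| <= B.
Proof.
move=> sp cM bx pB; apply: int01_le; first by apply: avg_int => y; exact: (smooth_on_cont sp).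
move=> s s01; rewrite normrM -[leRHS]mul1r.
have := seg_box s01 cM bx; case/andP: s01 => s0 s1 hb.
apply: ler_pM => //; last exact: pB.
by rewrite normrX (ger0_norm s0) exprn_ile1.
Qed.

Lemma seg_derive i c s phi x : smooth phi ->
  is_derive x (e_ i) (fun y => phi (seg c s y))
    (s ^+ (i == 0) * partial i phi (seg c s x)).
Proof.
move=> sp.
have d1 : is_derive x (e_ i) (fun y : R * R => c + s * (y.1 - c)) (s * (i == 0)%:R).
  have D := is_deriveD (is_derive_cst c x (e_ i))
    (is_deriveZ s (is_deriveB (is_derive_fst i x) (is_derive_cst c x (e_ i)))).
  by apply: (is_derive_eq D); rewrite add0r subr0.
have D := @chain_rule R setT (partial 0 phi) (partial 1 phi) phi _ _ x (e_ i) _ _ openT I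
  (fun z _ => @smooth_on_derive R setT 0 phi z sp I) (fun z _ => @smooth_on_derive R setT 1 phi z sp I)
  (smooth_on_cont (smooth_on_partial 0 sp) I) (smooth_on_cont (smooth_on_partial 1 sp) I) d1
  (is_derive_snd i x).
apply: (is_derive_eq D); move: i {d1 D}; apply: I2_ind => /=.
- by rewrite mulr1 mulr0 addr0 mulrC.
- by rewrite mulr0 mulr0 add0r mulr1 mul1r.
Qed.

Lemma avg_derive i k c phi x : smooth phi ->
  is_derive x (e_ i) (avg c k phi) (avg c (k + (i == 0)) (partial i phi) x).
Proof.
move=> sp; have spi : smooth (partial i phi) := smooth_on_partial i sp.
have cp psi : smooth psi -> continuous psi by move=> ss y; exact: (smooth_on_cont ss).
pose f (t s : R) : R := s ^+ k * phi (seg c s (t *: e_ i + x)).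
pose M := `|x.1| + `|x.2| + 1 + `|c|.
have [C [C0 HC]] := box_bound M (cp _ spi).
have mI : measurable (`[(0 : R), 1] : set mR) by exact: measurable_itv.
have Df (t s : R) : is_derive t 1 (f^~ s) (s ^+ (k + (i == 0)) * partial i phi (seg c s (t *: e_ i + x))).
  apply/(@line_derive _ (fun z => s ^+ k * phi (seg c s z))).
  have D := is_deriveZ (s ^+ k) (seg_derive i c s (t *: e_ i + x) sp).
  by apply: (is_derive_eq D); rewrite exprD -mulrA.
have cM : `|c| <= M by rewrite /M lerDr !addr_ge0.
have bt (t : R) : `](-1 : R), 1[%classic t -> box M (t *: e_ i + x).
  rewrite /= in_itv/= => /andP[t1 t2]; rewrite /box /M /basis2.
  have nt : `|t| <= 1 by rewrite ler_norml; apply/andP; split; exact: ltW.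
  have := normr_ge0 x.1; have := normr_ge0 x.2; have := normr_ge0 c => c0 a0 b0.
  case: ifP => _; split; rewrite /= /GRing.scale/= ?mulr1 ?mulr0 ?add0r.
  - by have := ler_normD t x.1; lra.
  - by lra.
  - by lra.
  - by have := ler_normD t x.2; lra.
have Gub (t s : R) : `](-1 : R), 1[%classic t -> `[(0 : R), 1]%classic s -> `|partial1of2 f t s| <= (cst C : mR -> R) s.
  move=> t1 s01; have [_] := Df t s; rewrite partial1of2E => ->.
  move: s01; rewrite /= in_itv/= => s01.
  rewrite normrM -[leRHS]mul1r; have hb := seg_box s01 cM (bt t t1).
  case/andP: s01 => s0 s1; apply: ler_pM => //; last exact: HC.
  by rewrite normrX (ger0_norm s0) exprn_ile1.
have intf (t : R) : mu.-integrable `[(0 : R), 1] (EFin \o f t) by apply: avg_int; exact: cp.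
have I0 : `](-1 : R), 1[%classic 0 by rewrite /= in_itv/= ltrN10 ltr01.
have iG : mu.-integrable `[(0 : R), 1] (EFin \o (cst C : mR -> R)).
  apply: continuous_compact_integrable; first exact: segment_compact.
  by apply: continuous_subspaceT; exact: cst_continuous.
have d1 := derivable_under_integral mI I0 (fun t _ => intf t)
  (fun t s _ _ => @ex_derive _ _ _ _ _ _ _ (Df t s)) (fun=> C0) iG Gub.
have d2 := differentiation_under_integral mI I0 (fun t _ => intf t)
  (fun t s _ _ => @ex_derive _ _ _ _ _ _ _ (Df t s)) (fun=> C0) iG Gub.
have D0 : is_derive (0 : R) 1 (fun t : R => avg c k phi (t *: e_ i + x))
    (avg c (k + (i == 0)) (partial i phi) (0 *: e_ i + x)).
  split => //; rewrite -derive1E [LHS]d2.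
  by apply: eq_Rintegral => s _; have [_] := Df 0 s; rewrite partial1of2E => ->.
by have := (line_derive (avg c k phi) (e_ i) x 0 _).2 D0; rewrite scale0r add0r.
Qed.

Lemma avg_smooth k c phi : smooth phi -> smooth (avg c k phi).
Proof.
move=> sp; apply/smooth_onP => [|n]; first exact: openT.
have cc m psi : smooth psi -> continuous (avg c m psi).
  move=> ss; apply: (@cont_of_derive _ _ (fun i => avg c (m + (i == 0)) (partial i psi))).
    by move=> i y; exact: avg_derive.
  move=> M; have cp i : continuous (partial i psi).
    by move=> y; exact: (smooth_on_cont (smooth_on_partial i ss)).
  have [C0 [_ HC0]] := box_bound (M + `|c|) (cp 0).
  have [C1 [_ HC1]] := box_bound (M + `|c|) (cp 1).
  exists (Num.max C0 C1) => i y yb.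
  have M0 : 0 <= M by case: yb => [yb _]; exact: le_trans yb.
  have cM : `|c| <= M + `|c| by rewrite lerDr.
  have yb' : box (M + `|c|) y by apply: box_mono yb; rewrite lerDl.
  move: i; apply: I2_ind; rewrite le_max; apply/orP; [left|right].
    exact: (avg_bound _ (smooth_on_partial 0 ss) cM yb').
  exact: (avg_bound _ (smooth_on_partial 1 ss) cM yb').
elim: n k phi sp => [|n IH] k phi sp; first by apply: Cn0I => x _; exact: cc.
apply: (CnSI (f' := fun i => avg c (k + (i == 0)) (partial i phi))).
- by move=> x _; exact: cc.
- by move=> i x _; exact: avg_derive.
- by move=> i; apply: IH; exact: smooth_on_partial.
Qed.

Lemma avg_partial i k c phi : smooth phi ->
  partial i (avg c k phi) = avg c (k + (i == 0)) (partial i phi).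
Proof. by move=> sp; apply/funext => x; have [_] := avg_derive i k c x sp. Qed.

(* The primitive in x.1 vanishing at x.1 = c, in a form that can be differentiated under the
   integral sign in both variables. *)
Definition prim0 (c : R) phi x : R := (x.1 - c) * avg c 0 phi x.

Lemma smooth_coord c : smooth (fun x : R * R => x.1 - c).
Proof. exact: (smooth_onB openT (smooth_on_fst openT) (smooth_on_cst c openT)). Qed.

Lemma prim0_smooth c phi : smooth phi -> smooth (prim0 c phi).
Proof. by move=> sp; exact: (smooth_onM openT (smooth_coord c) (avg_smooth 0 c sp)). Qed.

Lemma partial_coord i c x : partial i (fun x : R * R => x.1 - c) x = (i == 0)%:R.
Proof.
have D := is_deriveB (is_derive_fst i x) (is_derive_cst c x (e_ i)).
by have [_] := D; rewrite subr0.
Qed.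

Lemma prim0_partial1 c phi : smooth phi -> partial 1 (prim0 c phi) = prim0 c (partial 1 phi).
Proof.
move=> sp; apply/funext => x.
rewrite /prim0 (partialM 1 (smooth_coord c) (avg_smooth 0 c sp) (I : setT x)).
by rewrite partial_coord mul0r addr0 avg_partial.
Qed.

(* d/ds (s phi(seg s x)) = phi(seg s x) + s (x1 - c) d1 phi(seg s x). *)
Lemma avg_FTC c phi x : smooth phi ->
  avg c 0 phi x + (x.1 - c) * avg c 1 (partial 0 phi) x = phi x.
Proof.
move=> sp; have sp0 : smooth (partial 0 phi) := smooth_on_partial 0 sp.
have cp psi : smooth psi -> continuous psi by move=> ss y; exact: (smooth_on_cont ss).
rewrite /avg -RintegralZl//; last exact: avg_int (cp _ sp0).
rewrite -RintegralD//; last first.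
- have := integrableZl _ (x.1 - c) (avg_int 1 c x (cp _ sp0)); apply; exact: measurable_itv.
- exact: avg_int (cp _ sp).
pose G (s : R) := s * phi (seg c s x).
have dG (s : R) : is_derive s 1 G (s ^+ 0 * phi (seg c s x) + (x.1 - c) * (s ^+ 1 * partial 0 phi (seg c s x))).
  have dseg : is_derive s 1 (fun s : R => phi (seg c s x)) ((x.1 - c) * partial 0 phi (seg c s x)).
    have d0 : is_derive (c + s * (x.1 - c)) 1 (fun t => phi (t, x.2)) (partial 0 phi (seg c s x)).
      by apply/slice1; exact: (smooth_on_derive 0 sp).
    have d1 : is_derive s 1 (fun s : R => c + s * (x.1 - c)) (x.1 - c).
      have D := is_deriveD (is_derive_cst c s 1) (is_deriveM (is_derive_id s 1) (is_derive_cst (x.1 - c) s 1)).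
      by apply: (is_derive_eq D); rewrite add0r scaler0 add0r /GRing.scale/= mulr1.
    have := @is_derive1_comp R (fun t => phi (t, x.2)) (fun s : R => c + s * (x.1 - c)) s _ _ d0 d1.
    by rewrite mulrC.
  have D := is_deriveM (is_derive_id s 1) dseg.
  by apply: (is_derive_eq D); rewrite /GRing.scale/= mulr1 expr0 expr1 mul1r addrC; congr (_ + _); rewrite mulrCA.
have cG (s : R) : {for s, continuous G}.
  by have [d _] := dG s; apply: differentiable_continuous; apply/derivable1_diffP.
have cI : continuous (fun s : R =>
    s ^+ 0 * phi (seg c s x) + (x.1 - c) * (s ^+ 1 * partial 0 phi (seg c s x))).
  move=> s; have c0 := @avg_cont 0 c _ x (cp _ sp) s; have c1 := @avg_cont 1 c _ x (cp _ sp0) s.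
  exact: (@continuousD R R R _ _ s c0 (@continuousM R R _ _ s (@cst_continuous R R (x.1 - c) s) c1)).
rewrite /Rintegral (@continuous_FTC2 _ _ G 0 1)//.
- by rewrite /G /= mul1r mul0r subr0 /seg mul1r addrC subrK; case: (x).
- by apply: continuous_subspaceT; exact: cI.
- split.
  + by move=> s _; have [] := dG s.
  + by apply: cvg_at_right_filter; apply: cG.
  + by apply: cvg_at_left_filter; apply: cG.
- by move=> s _; rewrite derive1E; have [] := dG s.
Qed.

Lemma prim0_partial0 c phi : smooth phi -> partial 0 (prim0 c phi) = phi.
Proof.
move=> sp; apply/funext => x.
rewrite /prim0 (partialM 0 (smooth_coord c) (avg_smooth 0 c sp) (I : setT x)).
by rewrite partial_coord mul1r avg_partial//= addrC avg_FTC.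
Qed.

Lemma prim0_bound c phi (M B : R) x : smooth phi -> `|c| <= M -> box M x ->
  (forall y, box M y -> `|phi y| <= B) -> `|prim0 c phi x| <= 2 * M * B.
Proof.
move=> sp cM bx pB; rewrite normrM; apply: ler_pM => //; last exact: avg_bound bx pB.
by case: bx => b1 _; rewrite (le_trans (ler_normB _ _))//; lra.
Qed.

Lemma prim0_eq0 c phi x : x.1 = c -> prim0 c phi x = 0.
Proof. by move=> xc; rewrite /prim0 xc subrr mul0r. Qed.

(** Uniqueness of the primitive, by the mean value theorem on horizontal lines; it replaces
    computations with integrals in [prim0_lin] and [prim0_K]. *)
Lemma eq_of_partial0 (c : R) f g : smooth f -> smooth g ->
  (forall x, partial 0 f x = partial 0 g x) -> (forall x, x.1 = c -> f x = g x) -> f = g.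
Proof.
move=> sf sg fg fg0; apply/funext => -[a b].
have [z hz e] := @mean_value R (fun t => f (t, b) - g (t, b))
  (fun t => partial 0 f (t, b) - partial 0 g (t, b)) c a
  (fun z _ => is_deriveB ((slice1 _ _ _ _).1 (@smooth_on_derive _ setT 0 f (z, b) sf I))
     ((slice1 _ _ _ _).1 (@smooth_on_derive _ setT 0 g (z, b) sg I))).
move: e; rewrite fg subrr mul0r (fg0 (c, b))// subrr subr0 => /eqP.
by rewrite subr_eq0 => /eqP.
Qed.

Lemma prim0_lin c a phi psi : smooth phi -> smooth psi ->
  prim0 c (fun x => a * phi x + psi x) = (fun x => a * prim0 c phi x + prim0 c psi x).
Proof.
move=> sp ss; have sap := smooth_onZ a openT sp; have sapp := smooth_onD openT sap ss.
have s1 := prim0_smooth c sp; have s2 := prim0_smooth c ss.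
have as1 := smooth_onZ a openT s1; have s12 := smooth_onD openT as1 s2.
apply: (@eq_of_partial0 c _ _ (prim0_smooth c sapp) s12).
- move=> x; rewrite (prim0_partial0 c sapp) (partialD 0 as1 s2 I) (partialZ 0 a s1 I).
  by rewrite (prim0_partial0 c sp) (prim0_partial0 c ss).
- by move=> x xc; rewrite !prim0_eq0// mulr0 addr0.
Qed.

Lemma prim0_K c phi : smooth phi ->
  prim0 c (partial 0 phi) = (fun x => phi x - phi (c, x.2)).
Proof.
move=> sp; have sc : smooth (fun x => phi (c, x.2)).
  exact: (smooth_on_comp openT openT sp (smooth_on_cst c openT) (smooth_on_snd openT)).
apply: (@eq_of_partial0 c).
- exact: (prim0_smooth c (smooth_on_partial 0 sp)).
- exact: (smooth_onB openT sp sc).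
- move=> x; rewrite (prim0_partial0 c (smooth_on_partial 0 sp)).
  rewrite (partialD 0 sp (smooth_onN openT sc) I).
  have -> : partial 0 (fun x => - phi (c, x.2)) x = 0; last by rewrite addr0.
  have [_] // : is_derive x (e_ 0) (fun x => - phi (c, x.2)) 0.
  by case: x => a b; apply/slice1; exact: (is_derive_cst (- phi (c, b))).
- by case=> a b /= ->; rewrite prim0_eq0// subrr.
Qed.

End Primitive.

(** * Compactly supported distributions and continuous operators on smooth functions *)

Section CompactlySupported.
Context {R : realType}.
Implicit Types (f g h phi psi : R * R -> R) (x y p : R * R) (T : @functional R).

Notation e_ := (@basis2 R).

Definition linear_on_smooth T : Prop := forall (c : R) phi psi, smooth phi -> smooth psi ->
  T (fun x => c * phi x + psi x) = c * T phi + T psi.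

Definition bounded_on (D : set (R * R)) (n : nat) (B : R) phi : Prop :=
  forall s, (size s <= n)%N -> forall x, D x -> `|partials s phi x| <= B.

(** The seminorm estimate with a single bound B for all derivatives, indexed by words: in this form
    it composes with operators. By [csP] it singles out the same functionals as
    [cs_distribution]. *)
Definition box_bounded T : Prop := exists (M : R) (n : nat) (C : R), [/\ 0 <= M, 0 <= C &
  forall phi B, smooth phi -> bounded_on (box M) n B phi -> `|T phi| <= C * B].

Definition cs T : Prop := linear_on_smooth T /\ box_bounded T.

Lemma box0 (M : R) : 0 <= M -> box M (0 : R * R).
Proof. by move=> M0; split; rewrite /= normr0. Qed.

Lemma bounded_ge0 (M B : R) n phi : 0 <= M -> bounded_on (box M) n B phi -> 0 <= B.
Proof. by move=> M0 /(_ [::] isT 0 (box0 M0)); exact: le_trans. Qed.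

Lemma pderiv_bounded D n (B : R) phi a b x : bounded_on D n B phi -> (a + b <= n)%N -> D x ->
  `|pderiv a b phi x| <= B.
Proof. by move=> h ab Dx; apply: h => //; rewrite size_cat !size_nseq. Qed.

Lemma compact_in_box (K : set (R * R)) : compact K -> exists M : R, 0 <= M /\ K `<=` box M.
Proof.
move=> cK; have [M [_ HM]] := compact_bounded cK.
exists (`|M| + 1); split; first by rewrite addr_ge0.
move=> x Kx; have : `|x| <= `|M| + 1 by apply: HM => //; rewrite (le_lt_trans (ler_norm M))// ltrDl.
by rewrite /box /= prod_normE ge_max => /andP[].
Qed.

Lemma word2_size (s : seq 'I_2) : (count_mem 0%R s + count_mem 1%R s = size s)%N.
Proof.
elim: s => //= i s IH; rewrite -IH; move: i; apply: I2_ind => /=; lia.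
Qed.

Lemma sup_norm_ge0 (K : set (R * R)) f : 0 <= sup [set `|f x| | x in K].
Proof.
have [->|/set0P[x Kx]] := eqVneq K set0; first by rewrite image_set0 sup0.
have [hs|hs] := pselect (has_sup [set `|f x| | x in K]); last by rewrite sup_out.
by apply: (@le_trans _ _ `|f x|) => //; apply: ub_le_sup; [exact: hs.2|exists x].
Qed.

Lemma csP T : cs_distribution T <-> cs T.
Proof.
split.
- move=> [lT [K [n [C [cK HT]]]]]; split => //.
  have [M [M0 KM]] := compact_in_box cK.
  exists M, n, (`|C| * \sum_(a < n.+1) \sum_(b < n.+1 | (a + b <= n)%N) 1); split => //.
    by rewrite mulr_ge0// sumr_ge0// => a _; rewrite sumr_ge0.
  move=> phi B sp hB; have B0 := bounded_ge0 M0 hB.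
  have h a b : (a + b <= n)%N -> sup [set `|pderiv a b phi x| | x in K] <= B.
    move=> ab; have [->|/set0P[x Kx]] := eqVneq K set0; first by rewrite image_set0 sup0.
    apply: ge_sup; first by exists `|pderiv a b phi x|; exists x.
    by move=> _ [y Ky <-]; apply: pderiv_bounded hB ab _; exact: KM.
  apply: (le_trans (HT _ sp)); rewrite -mulrA.
  have S0 a b : 0 <= sup [set `|pderiv a b phi x| | x in K].
    by exact: sup_norm_ge0.
  apply: (@le_trans _ _ (`|C| * \sum_(a < n.+1) \sum_(b < n.+1 | (a + b <= n)%N)
                        sup [set `|pderiv a b phi x| | x in K])).
    by apply: ler_wpM2r; [rewrite sumr_ge0// => a _; rewrite sumr_ge0|exact: ler_norm].
  apply: ler_wpM2l => //; rewrite mulr_suml; apply: ler_sum => a _.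
  by rewrite mulr_suml; apply: ler_sum => b ab; rewrite mul1r; exact: h.
- move=> [lT [M [n [C [M0 C0 HT]]]]]; split => //.
  exists (box M), n, C; split; first exact: compact_box.
  move=> phi sp; apply: HT => // s sn x bx.
  rewrite partials_pderiv//; have := word2_size s.
  move: (count_mem 1 s) (count_mem 0 s) => b a ab.
  have an : (a < n.+1)%N by lia.
  have bn : (b < n.+1)%N by lia.
  have S0 a' b' : 0 <= sup [set `|pderiv a' b' phi x| | x in box M] by exact: sup_norm_ge0.
  rewrite (bigD1 (Ordinal an))//= (bigD1 (Ordinal bn))/=; last by rewrite ab.
  rewrite -addrA (@le_trans _ _ (sup [set `|pderiv a b phi x| | x in box M]))//.
    have [B [_ HB]] : exists B, 0 <= B /\ forall x, box M x -> `|pderiv a b phi x| <= B.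
      apply: box_bound => y; exact: (smooth_on_cont (smooth_partials _ sp)).
    by apply: ub_le_sup; [exists B => _ [y yb <-]; exact: HB|exists x].
  by rewrite lerDl addr_ge0// sumr_ge0// => c _; rewrite sumr_ge0.
Qed.

Lemma partialsD s f g : smooth f -> smooth g ->
  partials s (fun x => f x + g x) = fun x => partials s f x + partials s g x.
Proof.
move=> sf sg; elim: s => //= i s ->; apply/funext => x.
exact: (partialD i (smooth_partials s sf) (smooth_partials s sg) I).
Qed.

Lemma partialsZ s (c : R) f : smooth f ->
  partials s (fun x => c * f x) = fun x => c * partials s f x.
Proof.
move=> sf; elim: s => //= i s ->; apply/funext => x.
exact: (partialZ i c (smooth_partials s sf) I).
Qed.

Lemma smoothD f g : smooth f -> smooth g -> smooth (fun x => f x + g x).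
Proof. exact: (smooth_onD openT). Qed.

Lemma smoothZ (c : R) f : smooth f -> smooth (fun x => c * f x).
Proof. exact: (smooth_onZ c openT). Qed.

Lemma smoothM f g : smooth f -> smooth g -> smooth (fun x => f x * g x).
Proof. exact: (smooth_onM openT). Qed.

Lemma boundedD D n (B B' : R) phi psi : smooth phi -> smooth psi ->
  bounded_on D n B phi -> bounded_on D n B' psi ->
  bounded_on D n (B + B') (fun x => phi x + psi x).
Proof.
move=> sp ss h h' s sn x Dx; rewrite (partialsD s sp ss).
by apply: (le_trans (ler_normD _ _)); apply: lerD; [exact: h|exact: h'].
Qed.

Lemma bounded_partial D n (B : R) i phi : bounded_on D n.+1 B phi -> bounded_on D n B (partial i phi).
Proof. by move=> h s sn x Dx; rewrite -partials_rcons; apply: h; rewrite // size_rcons. Qed.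

Lemma boundedS D n (B : R) phi : (forall x, D x -> `|phi x| <= B) ->
  (forall i, bounded_on D n B (partial i phi)) -> bounded_on D n.+1 B phi.
Proof.
move=> h0 h s; case/lastP: s => [_ x /h0//|s i sn x Dx].
by rewrite partials_rcons; apply: h => //; move: sn; rewrite size_rcons.
Qed.

Lemma boundedW D D' n n' (B B' : R) phi : D' `<=` D -> (n' <= n)%N -> B <= B' ->
  bounded_on D n B phi -> bounded_on D' n' B' phi.
Proof.
by move=> DD nn BB h s sn x Dx; apply: (le_trans _ BB); apply: h; [exact: leq_trans nn|exact: DD].
Qed.

(** The continuous linear maps of the Frechet space of smooth functions; by [cs_op] their transposes
    preserve compactly supported distributions. *)
Definition smooth_op (A : (R * R -> R) -> (R * R -> R)) : Prop :=
  [/\ forall phi, smooth phi -> smooth (A phi),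
      forall (c : R) phi psi, smooth phi -> smooth psi ->
        A (fun x => c * phi x + psi x) = (fun x => c * A phi x + A psi x) &
      forall (M : R) n, 0 <= M -> exists (M' : R) n' (C : R), [/\ 0 <= M', 0 <= C &
        forall phi B, smooth phi -> bounded_on (box M') n' B phi ->
          bounded_on (box M) n (C * B) (A phi)]].

Lemma cs_op T A : cs T -> smooth_op A -> cs (fun phi => T (A phi)).
Proof.
move=> [lT [M [n [C [M0 C0 HT]]]]] [sA lA bA]; split.
  by move=> c phi psi sp ss; rewrite (lA c _ _ sp ss) (lT c _ _ (sA _ sp) (sA _ ss)).
have [M' [n' [C' [M'0 C'0 H]]]] := bA M n M0.
exists M', n', (C * C'); split=> //; first exact: mulr_ge0.
by move=> phi B sp hB; rewrite -mulrA; apply: HT; [exact: sA|exact: H].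
Qed.

Lemma op_partial i : smooth_op (partial i).
Proof.
split.
- by move=> phi sp; exact: smooth_on_partial.
- move=> c phi psi sp ss; apply/funext => x.
  by rewrite (partialD i (smoothZ c sp) ss I) (partialZ i c sp I).
- move=> M n M0; exists M, n.+1, 1; split => // phi B sp hB.
  by rewrite mul1r; exact: bounded_partial.
Qed.

Lemma smooth_op_comp A A' : smooth_op A -> smooth_op A' -> smooth_op (fun phi => A (A' phi)).
Proof.
move=> [sA lA bA] [sA' lA' bA']; split.
- by move=> phi /sA'/sA.
- by move=> c phi psi sp ss; rewrite (lA' c _ _ sp ss) (lA c _ _ (sA' _ sp) (sA' _ ss)).
- move=> M n M0; have [M1 [n1 [C1 [M10 C10 H1]]]] := bA M n M0.
  have [M2 [n2 [C2 [M20 C20 H2]]]] := bA' M1 n1 M10.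
  exists M2, n2, (C1 * C2); split => //; first exact: mulr_ge0.
  by move=> phi B sp hB; rewrite -mulrA; apply: H1; [exact: sA'|exact: H2].
Qed.

(** The constant does not depend on n: a derivative in x.1 cancels the primitive, one in x.2
    commutes with it. *)
Lemma prim0_bounded (c M B : R) n phi : smooth phi -> `|c| <= M ->
  bounded_on (box M) n B phi -> bounded_on (box M) n ((1 + 2 * M) * B) (prim0 c phi).
Proof.
move=> sp cM; have M0 : 0 <= M := le_trans (normr_ge0 c) cM.
elim: n phi sp => [|n IH] phi sp hB; have B0 := bounded_ge0 M0 hB;
  have h0 x : box M x -> `|prim0 c phi x| <= (1 + 2 * M) * B by
    [move=> bx; rewrite mulrDl mul1r (le_trans (prim0_bound sp cM bx (hB [::] isT)))// lerDr].
  by move=> s; rewrite leqn0 size_eq0 => /eqP -> x; exact: h0.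
apply: boundedS => // i; move: i; apply: I2_ind.
  rewrite (prim0_partial0 c sp); apply: boundedW hB => //.
  by rewrite ler_peMl// lerDl mulr_ge0.
rewrite (prim0_partial1 c sp); apply: IH; first exact: smooth_on_partial.
exact: bounded_partial.
Qed.

Lemma op_prim0 c : smooth_op (prim0 c).
Proof.
split; first by move=> phi; exact: prim0_smooth.
  by move=> a phi psi; exact: prim0_lin.
move=> M n M0; exists (M + `|c|), n, (1 + 2 * (M + `|c|)); split.
- by rewrite addr_ge0.
- by rewrite addr_ge0// mulr_ge0// addr_ge0.
move=> phi B sp hB; apply: (@boundedW (box (M + `|c|)) _ n n _ _ _ _ _ (lexx _)) => //.
  by move=> x; apply: box_mono; rewrite lerDl.
by apply: prim0_bounded => //; rewrite lerDr.
Qed.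

Definition swap phi x : R := phi (x.2, x.1).

Lemma swapK phi : swap (swap phi) = phi.
Proof. by apply/funext => -[]. Qed.

Lemma smooth_swap phi : smooth phi -> smooth (swap phi).
Proof.
move=> sp.
exact: (@smooth_on_comp R setT setT phi snd fst openT openT sp (smooth_on_snd openT)
  (smooth_on_fst openT) (fun _ _ => I)).
Qed.

Lemma partial_swap i phi : smooth phi -> partial i (swap phi) = swap (partial (1 - i) phi).
Proof.
move=> sp; apply/funext => -[a b]; move: i; apply: I2_ind.
  have [_] // : is_derive (a, b) (e_ 0) (swap phi) (swap (partial (1 - 0) phi) (a, b)).
  by apply/slice1; apply/(@slice2 _ phi b a); exact: (smooth_on_derive _ sp).
have [_] // : is_derive (a, b) (e_ 1) (swap phi) (swap (partial (1 - 1) phi) (a, b)).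
by apply/slice2; apply/(@slice1 _ phi b a); exact: (smooth_on_derive _ sp).
Qed.

Lemma swap_bounded (M B : R) n phi : smooth phi ->
  bounded_on (box M) n B phi -> bounded_on (box M) n B (swap phi).
Proof.
have h0 psi : (forall x, box M x -> `|psi x| <= B) -> forall x, box M x -> `|swap psi x| <= B.
  by move=> h x [b1 b2]; apply: h.
elim: n phi => [|n IH] phi sp hB.
  by move=> s; rewrite leqn0 size_eq0 => /eqP ->; apply: h0; exact: (hB [::]).
apply: boundedS => [|i]; first by apply: h0; exact: (hB [::]).
rewrite partial_swap//; apply: IH; first exact: smooth_on_partial.
exact: bounded_partial.
Qed.

Lemma op_swap : smooth_op swap.
Proof.
split; [exact: smooth_swap|by []|].
move=> M n M0; exists M, n, 1; split => // phi B sp hB.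
by rewrite mul1r; exact: swap_bounded.
Qed.

Definition prim1 c phi : R * R -> R := swap (prim0 c (swap phi)).

Lemma op_prim1 c : smooth_op (prim1 c).
Proof. exact: (smooth_op_comp op_swap (smooth_op_comp (op_prim0 c) op_swap)). Qed.

Lemma prim1_smooth c phi : smooth phi -> smooth (prim1 c phi).
Proof. by move=> sp; apply/smooth_swap/prim0_smooth/smooth_swap. Qed.

Lemma prim1_partial1 c phi : smooth phi -> partial 1 (prim1 c phi) = phi.
Proof.
move=> sp; rewrite /prim1 partial_swap; last by apply/prim0_smooth/smooth_swap.
by rewrite subrr (prim0_partial0 c (smooth_swap sp)) swapK.
Qed.

Lemma prim1_partial0 c phi : smooth phi -> partial 0 (prim1 c phi) = prim1 c (partial 0 phi).
Proof.
move=> sp; rewrite /prim1 partial_swap; last by apply/prim0_smooth/smooth_swap.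
rewrite subr0 prim0_partial1; last exact: smooth_swap.
by rewrite partial_swap// subrr.
Qed.

Lemma prim1_K c phi : smooth phi ->
  prim1 c (partial 1 phi) = (fun x => phi x - phi (x.1, c)).
Proof.
move=> sp; have e : swap (partial 1 phi) = partial 0 (swap phi) by rewrite partial_swap// subr0.
rewrite /prim1 e prim0_K; last exact: smooth_swap.
by apply/funext => -[].
Qed.

Lemma prim1_bounded (c M B : R) n phi : smooth phi -> `|c| <= M ->
  bounded_on (box M) n B phi -> bounded_on (box M) n ((1 + 2 * M) * B) (prim1 c phi).
Proof.
move=> sp cM hB; apply: swap_bounded; first by apply/prim0_smooth/smooth_swap.
exact: (prim0_bounded (smooth_swap sp) cM (swap_bounded sp hB)).
Qed.

Lemma cs_lin (c : R) T T' : cs T -> cs T' -> cs (fun phi => c * T phi + T' phi).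
Proof.
move=> [lT [M [n [C [M0 C0 HT]]]]] [lT' [M' [n' [C' [M'0 C'0 HT']]]]]; split.
  by move=> a phi psi sp ss; rewrite lT// lT'//; ring.
exists (M + M'), (n + n')%N, (`|c| * C + C'); split; first exact: addr_ge0.
  by rewrite addr_ge0// mulr_ge0.
move=> phi B sp hB; rewrite mulrDl (le_trans (ler_normD _ _))// normrM -mulrA.
apply: lerD; first (apply: ler_wpM2l => //; apply: HT => //).
  by apply: boundedW hB; [move=> x; apply: box_mono; rewrite lerDl|exact: leq_addr|].
apply: HT' => //.
by apply: boundedW hB; [move=> x; apply: box_mono; rewrite lerDr|exact: leq_addl|].
Qed.

Lemma cs0 : cs (fun=> 0).
Proof.
split; first by move=> c phi psi _ _; rewrite mulr0 addr0.
by exists 0, 0%N, 0; split => // phi B _ _; rewrite normr0 mul0r.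
Qed.

Lemma csD T T' : cs T -> cs T' -> cs (fun phi => T phi + T' phi).
Proof. by move=> c1 c2; have := cs_lin 1 c1 c2; under eq_fun do rewrite mul1r. Qed.

Lemma csZ (c : R) T : cs T -> cs (fun phi => c * T phi).
Proof. by move=> c1; have := cs_lin c c1 cs0; under eq_fun do rewrite addr0. Qed.

Lemma csN T : cs T -> cs (fun phi => - T phi).
Proof. by move=> c1; have := csZ (-1) c1; under eq_fun do rewrite mulN1r. Qed.

Lemma cs_sum (I : Type) (r : seq I) (P : pred I) (T : I -> @functional R) :
  (forall i, P i -> cs (T i)) -> cs (fun phi => \sum_(i <- r | P i) T i phi).
Proof.
move=> cT; elim: r => [|i r IH]; first by under eq_fun do rewrite big_nil; exact: cs0.
under eq_fun do rewrite big_cons.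
by have := cT i; case: (P i) => ci; [exact: (csD (ci isT) IH)|exact: IH].
Qed.

Lemma cs_dpartial i T : cs T -> cs (dpartial i T).
Proof. by move=> cT; apply: csN; exact: (cs_op cT (op_partial i)). Qed.

Lemma csT0 T : cs T -> T (fun=> 0) = 0.
Proof.
move=> [lT _]; have s0 : smooth (fun=> 0 : R) := smooth_on_cst 0 openT.
transitivity (T (fun=> -1 * 0 + 0)); last by rewrite (lT (-1) _ _ s0 s0) mulN1r addNr.
by congr T; apply/funext => x; rewrite mulr0 addr0.
Qed.

Lemma csTD T phi psi : cs T -> smooth phi -> smooth psi ->
  T (fun x => phi x + psi x) = T phi + T psi.
Proof.
move=> [lT _] sp ss; rewrite -[T phi]mul1r -lT//; congr T.
by apply/funext => x; rewrite mul1r.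
Qed.

Lemma csTZ T (c : R) phi : cs T -> smooth phi -> T (fun x => c * phi x) = c * T phi.
Proof.
move=> cT sp; have [lT _] := cT; have := lT c phi _ sp (smooth_on_cst 0 openT).
by rewrite (csT0 cT) addr0 => <-; congr T; apply/funext => x; rewrite addr0.
Qed.

Lemma csTB T phi psi : cs T -> smooth phi -> smooth psi ->
  T (fun x => phi x - psi x) = T phi - T psi.
Proof.
move=> cT sp ss; rewrite -mulN1r -(csTZ (-1) cT ss) -(csTD cT sp (smoothZ (-1) ss)).
by congr T; apply/funext => x; rewrite mulN1r.
Qed.

Lemma cs_local T : cs T -> exists M : R, 0 <= M /\
  forall phi (O : set (R * R)), smooth phi -> open O -> box M `<=` O ->
    (forall x, O x -> phi x = 0) -> T phi = 0.
Proof.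
move=> [_ [M [n [C [M0 C0 HT]]]]]; exists M; split => // phi O sp oO MO p0.
apply/normr0_eq0/le_anti/andP; split => //.
rewrite -(mulr0 C); apply: HT => // s _ x bx.
have -> : partials s phi x = partials s (fun=> 0) x.
  by apply: (partials_eq_on _ oO); [move=> y /set_mem; exact: p0|apply/mem_set/MO].
elim: s {phi sp p0} x bx => /= [|i s IH] x bx; first by rewrite normr0.
have -> : partials s (fun=> (0 : R)) = fun=> 0.
  elim: s {IH} => //= j s ->; apply/funext => y.
  by have [_] := is_derive_cst (0 : R) y (e_ j).
by have [_] := is_derive_cst (0 : R) x (e_ i); rewrite /partial => ->; rewrite normr0.
Qed.

End CompactlySupported.

(** * Pullback by a smooth map defined on an open set, localized by a weight *)

Section LocalComposition.
Context {R : realType}.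
Implicit Types (g h phi psi rho : R * R -> R) (x y p : R * R).
Variables (A O : set (R * R)) (z1 z2 : R * R -> R).
Hypotheses (oO : open O) (AO : A `<=` O) (cA : open (~` A)).
Hypotheses (sz1 : smooth_on O z1) (sz2 : smooth_on O z2).

(** A is closed and contained in the open set O on which (z1, z2) is smooth; multiplication by a
    weight vanishing off A turns a function smooth on O into a globally smooth one. *)
Definition carried rho := smooth rho /\ forall x, ~ A x -> rho x = 0.

Lemma carried_mul rho g : carried rho -> smooth_on O g -> carried (fun x => rho x * g x).
Proof.
move=> [sr r0] sg; split; last by move=> x /r0 ->; rewrite mul0r.
have -> : smooth (fun x => rho x * g x) = smooth_on (O `|` ~` A) (fun x => rho x * g x).
  congr smooth_on; apply/seteqP; split => // x _.
  by have [/AO|] := pselect (A x); [left|right].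
apply: smooth_onU.
  exact: (smooth_onM oO (smooth_onS (@subsetT _ O) sr) sg).
apply: (@smooth_on_eq _ _ (fun=> 0)) => //; last exact: smooth_on_cst.
by move=> x /set_mem /r0 ->; rewrite mul0r.
Qed.

Lemma carried_partial i rho : carried rho -> carried (partial i rho).
Proof.
move=> [sr r0]; split; first exact: smooth_on_partial.
move=> x Ax; have -> : partial i rho x = partial i (fun=> 0) x by exact: (partial_eq_on _ cA).
by have [_] := is_derive_cst (0 : R) x (basis2 i).
Qed.

Definition pcomp rho phi x : R := rho x * phi (z1 x, z2 x).

Lemma pcomp_carried rho phi : carried rho -> smooth phi -> carried (pcomp rho phi).
Proof.
move=> cr sp; apply: (carried_mul cr).
exact: (smooth_on_comp oO openT sp sz1 sz2 (fun _ _ => I)).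
Qed.

Lemma pcomp_partial i rho phi : carried rho -> smooth phi ->
  partial i (pcomp rho phi) = fun x => pcomp (partial i rho) phi x
    + (pcomp (fun x => rho x * partial i z1 x) (partial 0 phi) x
       + pcomp (fun x => rho x * partial i z2 x) (partial 1 phi) x).
Proof.
move=> cr sp; apply/funext => x; have [Ax|Ax] := pselect (A x).
  have sc := smooth_on_comp oO openT sp sz1 sz2 (fun _ _ => I).
  have sr : smooth_on O rho by apply: smooth_onS cr.1.
  rewrite /pcomp (partialM i sr sc (AO Ax)) (partial_comp i openT sp sz1 sz2 (AO Ax) I); ring.
have [_ p0] := carried_partial i (pcomp_carried cr sp); rewrite p0//.
by rewrite /pcomp (carried_partial i cr).2// cr.2// !mul0r !addr0.
Qed.

(** By [pcomp_partial] a derivative is again a sum of weighted pullbacks with carried weights, hence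
    the induction over all [rho]. The set D is left free: [op_pcomp] takes a box, [dirac_limit] a
    region away from the singular point. *)
Lemma pcomp_bounded n rho (M : R) : carried rho -> exists C : R, 0 <= C /\
  forall phi (B : R) (D : set (R * R)), smooth phi -> 0 <= B ->
    (forall x, A x -> box M x -> D (z1 x, z2 x)) ->
    bounded_on D n B phi -> bounded_on (box M) n (C * B) (pcomp rho phi).
Proof.
elim: n rho => [|n IH] rho cr; have [C0 [C00 HC0]] : exists C, 0 <= C /\ forall x, box M x -> `|rho x| <= C by
    [apply: box_bound => y; exact: (smooth_on_cont cr.1)|];
  have h0 phi (B : R) (D : set (R * R)) : 0 <= B -> (forall x, A x -> box M x -> D (z1 x, z2 x)) ->
    (forall x, D x -> `|phi x| <= B) -> forall x, box M x -> `|pcomp rho phi x| <= C0 * B by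
    [move=> B0 AD pB x bx; rewrite /pcomp normrM; have [Ax|Ax] := pselect (A x);
      [apply: ler_pM => //; [exact: HC0|exact: pB (AD _ Ax bx)]|rewrite cr.2// normr0 mul0r mulr_ge0]].
  exists C0; split => // phi B D sp B0 AD hB s; rewrite leqn0 size_eq0 => /eqP -> x bx.
  by apply: (h0 phi B D B0 AD) bx; exact: (hB [::]).
have cr1 i : carried (fun x => rho x * partial i z1 x) := carried_mul cr (smooth_on_partial i sz1).
have cr2 i : carried (fun x => rho x * partial i z2 x) := carried_mul cr (smooth_on_partial i sz2).
have H i : exists C : R, 0 <= C /\ forall phi (B : R) (D : set (R * R)), smooth phi -> 0 <= B ->
    (forall x, A x -> box M x -> D (z1 x, z2 x)) ->
    bounded_on D n.+1 B phi -> bounded_on (box M) n (C * B) (partial i (pcomp rho phi)).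
  have [C1 [C10 H1]] := IH _ (carried_partial i cr).
  have [C2 [C20 H2]] := IH _ (cr1 i).
  have [C3 [C30 H3]] := IH _ (cr2 i).
  exists (C1 + (C2 + C3)); split; first by rewrite !addr_ge0.
  move=> phi B D sp B0 AD hB; rewrite (pcomp_partial i cr sp).
  have s0 := smooth_on_partial 0 sp; have s1 := smooth_on_partial 1 sp.
  have t1 := (pcomp_carried (carried_partial i cr) sp).1.
  have t2 := (pcomp_carried (cr1 i) s0).1.
  have t3 := (pcomp_carried (cr2 i) s1).1.
  rewrite !mulrDl.
  have b1 := H1 _ _ _ sp B0 AD (boundedW (@subset_refl _ D) (leqnSn n) (lexx B) hB).
  have b2 := H2 _ _ _ s0 B0 AD (bounded_partial 0 hB).
  have b3 := H3 _ _ _ s1 B0 AD (bounded_partial 1 hB).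
  exact: (boundedD t1 (smoothD t2 t3) b1 (boundedD t2 t3 b2 b3)).
have [C1 [C10 H1]] := H 0; have [C2 [C20 H2]] := H 1.
exists (C0 + C1 + C2); split; first by rewrite !addr_ge0.
move=> phi B D sp B0 AD hB; apply: boundedS.
  move=> x bx; apply: (@le_trans _ _ (C0 * B)); last by apply: ler_wpM2r => //; rewrite -addrA lerDl addr_ge0.
  by apply: (h0 phi B D B0 AD) bx; exact: (hB [::]).
apply: I2_ind.
  apply: boundedW (H1 _ _ _ sp B0 AD hB) => //.
  by apply: ler_wpM2r => //; rewrite addrAC lerDr addr_ge0.
apply: boundedW (H2 _ _ _ sp B0 AD hB) => //.
by apply: ler_wpM2r => //; rewrite lerDr addr_ge0.
Qed.

Lemma op_pcomp rho : carried rho ->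
  (forall M : R, exists M' : R, 0 <= M' /\ forall x, A x -> box M x -> box M' (z1 x, z2 x)) ->
  smooth_op (pcomp rho).
Proof.
move=> cr H; split.
- by move=> phi sp; exact: (pcomp_carried cr sp).1.
- by move=> c phi psi sp ss; apply/funext => x; rewrite /pcomp; ring.
move=> M n M0; have [M' [M'0 HM]] := H M.
have [C [C0 HC]] := pcomp_bounded n M cr.
exists M', n, C; split => // phi B sp hB.
exact: (HC phi B (box M') sp (bounded_ge0 M'0 hB) HM hB).
Qed.

End LocalComposition.

(** * Bernstein polynomials and density of polynomials *)

Section Bernstein.
Context {R : realType}.
Implicit Types (f g h phi psi : R * R -> R) (x y p : R * R) (T : @functional R).

Notation e_ := (@basis2 R).

Lemma open_sqd_gt p (t : R) : open [set x | t < sqd p x].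
Proof.
have -> : [set x | t < sqd p x] = sqd p @^-1` [set s : R | t < s] by [].
by apply: open_comp => [x _|]; [exact: continuous_sqd|exact: open_gt].
Qed.

Lemma open_sqd_lt p (t : R) : open [set x | sqd p x < t].
Proof.
have -> : [set x | sqd p x < t] = sqd p @^-1` [set s : R | s < t] by [].
by apply: open_comp => [x _|]; [exact: continuous_sqd|exact: open_lt].
Qed.

(* Expectation of [F] at a binomial(n, t) variable. *)
Fixpoint bern (n : nat) (t : R) (F : nat -> R) : R :=
  if n is n'.+1 then (1 - t) * bern n' t F + t * bern n' t (F \o S) else F 0%N.

Lemma bern_lin n (t c : R) F G :
  bern n t (fun i => c * F i + G i) = c * bern n t F + bern n t G.
Proof.
elim: n F G => //= n IH F G; rewrite (IH F G).
by have := IH (F \o S) (G \o S); rewrite /comp => ->; ring.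
Qed.

Lemma bern_le n (t : R) F G : 0 <= t <= 1 -> (forall i, (i <= n)%N -> F i <= G i) ->
  bern n t F <= bern n t G.
Proof.
move=> t01; have /andP[t0 t1] := t01.
elim: n F G => [|n IH] F G FG /=; first exact: FG.
apply: lerD; apply: ler_wpM2l; rewrite ?subr_ge0//; apply: IH => i ni; apply: FG => //.
exact: leqW.
Qed.

Lemma bern_cst n (t c : R) : bern n t (fun=> c) = c.
Proof. by elim: n => //= n IH; have -> : (fun=> c) \o S = (fun=> c) by []; rewrite IH; ring. Qed.

(** Conditioning on one trial shifts c by one, so the recursion preserves the second moment about an
    arbitrary c; at c = n t the variance remains. *)
Lemma bern_sq n (t c : R) :
  bern n t (fun i => (i%:R - c) ^+ 2) = (n%:R * t - c) ^+ 2 + n%:R * (t * (1 - t)).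
Proof.
elim: n c => [|n IH] c /=; first by rewrite !mul0r addr0.
have -> : (fun i => (i%:R - c) ^+ 2) \o S = (fun i => (i%:R - (c - 1)) ^+ 2).
  by apply/funext => i /=; rewrite -natr1; ring.
by rewrite !IH -natr1; ring.
Qed.

Lemma bern_norm n (t : R) F G : 0 <= t <= 1 -> (forall i, (i <= n)%N -> `|F i| <= G i) ->
  `|bern n t F| <= bern n t G.
Proof.
move=> t01 FG; rewrite ler_norml.
have -> : - bern n t G = bern n t (fun i => -1 * G i + 0) by rewrite bern_lin bern_cst; ring.
by apply/andP; split; apply: bern_le => // i /FG; rewrite ler_norml => /andP[] *; rewrite ?mulN1r ?addr0.
Qed.

Lemma bern_sqn n (t : R) : (0 < n)%N -> 0 <= t <= 1 ->
  bern n t (fun i => (i%:R / n%:R - t) ^+ 2) <= n%:R^-1.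
Proof.
move=> n0 /andP[t0 t1]; have n0' : n%:R != 0 :> R by rewrite pnatr_eq0 -lt0n.
have -> : (fun i : nat => (i%:R / n%:R - t) ^+ 2) = (fun i => n%:R^-2 * (i%:R - n%:R * t) ^+ 2 + 0).
  by apply/funext => i; field.
rewrite bern_lin bern_cst bern_sq subrr expr0n/= add0r addr0.
have -> : n%:R^-2 * (n%:R * (t * (1 - t))) = n%:R^-1 * (t * (1 - t)) :> R by field.
by rewrite ler_piMr ?invr_ge0//; nra.
Qed.

(** Instead of separating the event of a large deviation, the inequality |u| <= del + u^2 / del
    bounds the mean deviation by the variance, in each variable. *)
Lemma bern2_err (L del : R) n (F : R -> R -> R) (s t : R) : (0 < n)%N -> 0 < del -> 0 <= L ->
  0 <= s <= 1 -> 0 <= t <= 1 ->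
  (forall i j, (i <= n)%N -> (j <= n)%N ->
     `|F (i%:R / n%:R) (j%:R / n%:R) - F s t| <= L * (`|i%:R / n%:R - s| + `|j%:R / n%:R - t|)) ->
  `|bern n s (fun i => bern n t (fun j => F (i%:R / n%:R) (j%:R / n%:R))) - F s t| <=
    L * (2 * del + 2 * (n%:R^-1 / del)).
Proof.
move=> n0 d0 L0 hs ht HF.
have amgm (u : R) : `|u| <= del + u ^+ 2 / del.
  have -> : u ^+ 2 = `|u| ^+ 2 by rewrite real_normK ?num_real.
  rewrite -(ler_pM2r d0) mulrDl divfK ?gt_eqF//.
  by have := sqr_ge0 (`|u| - del); have := normr_ge0 u; nra.
pose Q (u : R) (i : nat) := (i%:R / n%:R - u) ^+ 2.
pose H i j := L * (2 * del + (Q s i / del + Q t j / del)).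
have -> : bern n s (fun i => bern n t (fun j => F (i%:R / n%:R) (j%:R / n%:R))) - F s t =
    bern n s (fun i => bern n t (fun j => F (i%:R / n%:R) (j%:R / n%:R) - F s t)).
  have e i : bern n t (fun j => F (i%:R / n%:R) (j%:R / n%:R) - F s t) =
      -1 * F s t + bern n t (fun j => F (i%:R / n%:R) (j%:R / n%:R)).
    rewrite -{2}(bern_cst n t (F s t)) -bern_lin; congr bern; apply/funext => j.
    by rewrite mulN1r addrC.
  under [X in _ = bern n s X]eq_fun do rewrite e.
  by rewrite bern_lin bern_cst mulN1r addrC.
apply: (@le_trans _ _ (bern n s (fun i => bern n t (H i)))).
  apply: bern_norm => // i ni; apply: bern_norm => // j nj.
  apply: (le_trans (HF _ _ ni nj)); apply: ler_wpM2l => //.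
  have := amgm (i%:R / n%:R - s); have := amgm (j%:R / n%:R - t); rewrite /Q; lra.
have HE i : bern n t (H i) = L * (2 * del + bern n t (Q t) / del) + L / del * Q s i.
  have -> : H i = (fun j => L / del * Q t j + (L * (2 * del) + L / del * Q s i)).
    by apply/funext => j; rewrite /H; ring.
  by rewrite bern_lin bern_cst; ring.
under [X in bern n s X]eq_fun do rewrite HE addrC.
rewrite bern_lin bern_cst.
have h1 := bern_sqn n0 hs; have h2 := bern_sqn n0 ht.
have -> : L / del * bern n s (Q s) + L * (2 * del + bern n t (Q t) / del) =
  L * (2 * del + (bern n s (Q s) / del + bern n t (Q t) / del)) by ring.
apply: ler_wpM2l => //; rewrite lerD2l mulr2n mulrDl mul1r.
by apply: lerD; apply: ler_wpM2r => //; rewrite invr_ge0 ltW.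
Qed.

Inductive polyfun : (R * R -> R) -> Prop :=
| polyfun_mono a b : polyfun (fun x => x.1 ^+ a * x.2 ^+ b)
| polyfun_lin (c : R) f g of polyfun f & polyfun g : polyfun (fun x => c * f x + g x).

Lemma polyfun0 : polyfun (fun=> 0).
Proof.
have := polyfun_lin (-1) (polyfun_mono 0 0) (polyfun_mono 0 0).
by congr polyfun; apply/funext => x; rewrite mulN1r addNr.
Qed.

Lemma polyfunZ (c : R) f : polyfun f -> polyfun (fun x => c * f x).
Proof.
by move=> pf; have := polyfun_lin c pf polyfun0; congr polyfun; apply/funext => x; rewrite addr0.
Qed.

Lemma polyfunD f g : polyfun f -> polyfun g -> polyfun (fun x => f x + g x).
Proof.
by move=> pf pg; have := polyfun_lin 1 pf pg; congr polyfun; apply/funext => x; rewrite mul1r.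
Qed.

Lemma polyfun_cst (c : R) : polyfun (fun=> c).
Proof.
by have := polyfunZ c (polyfun_mono 0 0); congr polyfun; apply/funext => x; rewrite !expr0 !mulr1.
Qed.

Lemma polyfun_mul1 f : polyfun f -> polyfun (fun x => x.1 * f x).
Proof.
elim=> [a b|c g h _ p1 _ p2].
  by have := polyfun_mono a.+1 b; congr polyfun; apply/funext => x; rewrite exprS mulrA.
by have := polyfun_lin c p1 p2; congr polyfun; apply/funext => x; ring.
Qed.

Lemma polyfun_swap f : polyfun f -> polyfun (swap f).
Proof.
elim=> [a b|c g h _ p1 _ p2]; last exact: polyfun_lin.
by have := polyfun_mono b a; congr polyfun; apply/funext => x; rewrite /swap mulrC.
Qed.

Lemma polyfun_smooth f : polyfun f -> smooth f.
Proof.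
elim=> [a b|c g h _ p1 _ p2]; last exact: (smoothD (smoothZ c p1) p2).
exact: (smoothM (smooth_onX a openT (smooth_on_fst openT)) (smooth_onX b openT (smooth_on_snd openT))).
Qed.

Lemma polyfun_prim0 (c : R) f : polyfun f -> polyfun (prim0 c f).
Proof.
elim=> [a b|d g h pg p1 ph p2]; last first.
  by rewrite (prim0_lin c d (polyfun_smooth pg) (polyfun_smooth ph)); exact: polyfun_lin.
pose G x := a.+1%:R^-1 * (x.1 ^+ a.+1 * x.2 ^+ b).
have pG : polyfun G := polyfunZ _ (polyfun_mono _ _).
have -> : (fun x : R * R => x.1 ^+ a * x.2 ^+ b) = partial 0 G.
  apply/funext => -[x1 x2].
  suff : is_derive (x1, x2) (e_ 0) G (x1 ^+ a * x2 ^+ b) by case=> _; rewrite /partial => ->.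
  apply/slice1 => /=.
  have D := is_deriveZ (a.+1%:R^-1) (is_deriveM (@is_deriveX _ _ _ a.+1 x1 1 _ (is_derive_id x1 1)) (is_derive_cst (x2 ^+ b) x1 1)).
  rewrite exprfctE in D; apply: (is_derive_eq D); rewrite /GRing.scale/= mulr0 add0r mulr1.
  have a0 : a.+1%:R != 0 :> R by rewrite pnatr_eq0.
  by rewrite -mulr_natl; field.
rewrite (prim0_K c (polyfun_smooth pG)).
have := polyfunD pG (polyfunZ (- (a.+1%:R^-1 * c ^+ a.+1)) (polyfun_mono 0 b)).
by congr polyfun; apply/funext => x; rewrite /G /= expr0; ring.
Qed.

Lemma polyfun_prim1 (c : R) f : polyfun f -> polyfun (prim1 c f).
Proof. by move=> pf; apply/polyfun_swap/polyfun_prim0/polyfun_swap. Qed.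

(** The coefficients may depend on x, so that [polyfun_bern2] can substitute the inner Bernstein sum
    in x.2 for them. *)
Lemma polyfun_bern n (al be : R) (F : nat -> R * R -> R) : (forall i, polyfun (F i)) ->
  polyfun (fun x => bern n (al * x.1 + be) (F^~ x)).
Proof.
elim: n F => [|n IH] F pF /=; first exact: pF.
have p1 := IH _ pF; have p2 := IH _ (fun i => pF i.+1).
have q1 := polyfun_mul1 p1; have q2 := polyfun_mul1 p2.
have := polyfun_lin (1 - be) p1 (polyfun_lin (- al) q1 (polyfun_lin al q2 (polyfunZ be p2))).
congr polyfun; apply/funext => x; set u := bern _ _ _; set v := bern _ _ _. ring.
Qed.

Lemma polyfun_bern2 n (al be : R) (F : nat -> nat -> R) :
  polyfun (fun x => bern n (al * x.1 + be) (fun i => bern n (al * x.2 + be) (F i))).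
Proof.
apply: (@polyfun_bern n al be (fun i x => bern n (al * x.2 + be) (F i))) => i.
exact: (polyfun_swap (@polyfun_bern n al be (fun j _ => F i j) (fun j => polyfun_cst _))).
Qed.

Lemma polyfun_approx f (M eps : R) : smooth f -> 0 < M -> 0 < eps ->
  exists2 p, polyfun p & forall x, box M x -> `|f x - p x| <= eps.
Proof.
move=> sf M0 e0.
have [L [L0 HL]] : exists L : R, 0 <= L /\ forall i x, box M x -> `|partial i f x| <= L.
  have cp i : continuous (partial i f) by move=> y; exact: (smooth_on_cont (smooth_on_partial i sf)).
  have [C0 [h0 HC0]] := box_bound M (cp 0); have [C1 [h1 HC1]] := box_bound M (cp 1).
  exists (C0 + C1); split; first exact: addr_ge0.
  apply: I2_ind => x bx; first by rewrite (le_trans (HC0 x bx))// lerDl.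
  by rewrite (le_trans (HC1 x bx))// lerDr.
have lipf := box_lipschitz (fun i x _ => @smooth_on_derive _ setT i f x sf I) HL.
(* The affine map of [0, 1] onto [-M, M]; its inverse is u |-> al u + be, with [al] and [be] set
   below. *)
pose c (s : R) : R := M * (2 * s - 1).
have cb (s : R) : 0 <= s <= 1 -> `|c s| <= M.
  move=> /andP[s0 s1]; rewrite ler_norml /c; apply/andP; split; nra.
pose F s t := f (c s, c t).
have lipF s t s' t' : 0 <= s <= 1 -> 0 <= t <= 1 -> 0 <= s' <= 1 -> 0 <= t' <= 1 ->
    `|F s t - F s' t'| <= (2 * M * L) * (`|s - s'| + `|t - t'|).
  move=> hs ht hs' ht'; rewrite /F.
  have := lipf (c s, c t) (c s', c t') (conj (cb _ hs) (cb _ ht)) (conj (cb _ hs') (cb _ ht')).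
  move=> /le_trans; apply; rewrite /=.
  have cc u v : `|c u - c v| = 2 * M * `|u - v|.
    have -> : c u - c v = 2 * M * (u - v) by rewrite /c; ring.
    by rewrite normrM gtr0_norm// mulr_gt0.
  by rewrite !cc -mulrDr mulrA (mulrC L).
pose K := 2 * M * L; have K0 : 0 <= K by rewrite !mulr_ge0// ltW.
(* With n^-1 <= del^2 both terms of [bern2_err] are at most 2 del, so the error is at most 4 K del
   <= eps; K + 1 avoids a division by 0. *)
pose del := eps / (4 * (K + 1)); have K1 : 0 < K + 1 by rewrite ltr_wpDl.
have d0 : 0 < del by rewrite divr_gt0// mulr_gt0.
have [n n0 hn] : exists2 n, (0 < n)%N & (n%:R^-1 : R) <= del ^+ 2.
  pose m := (Num.truncn (del ^- 2)).+1.
  exists m => //; have : del ^- 2 <= m%:R by apply/ltW/truncnS_gt.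
  by rewrite -[X in _ -> _ <= X]invrK => hm; rewrite lef_pV2 ?posrE ?ltr0n// invr_gt0 exprn_gt0.
have M2 : 2 * M != 0 by rewrite mulf_neq0// gt_eqF.
pose al := (2 * M)^-1; pose be : R := 2^-1.
exists (fun x => bern n (al * x.1 + be) (fun i => bern n (al * x.2 + be)
  (fun j => F (i%:R / n%:R) (j%:R / n%:R)))); first exact: (polyfun_bern2 n al be (fun i j => F (i%:R / n%:R) (j%:R / n%:R))).
move=> x [b1 b2].
have u01 (u : R) : `|u| <= M -> 0 <= al * u + be <= 1 /\ c (al * u + be) = u.
  rewrite ler_norml => /andP[h1 h2]; split; last by rewrite /c /al /be; field; rewrite gt_eqF.
  have e : al * u + be = (u + M) / (2 * M) by rewrite /al /be; field; rewrite gt_eqF.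
  rewrite e ler_pdivlMr ?mulr_gt0// ler_pdivrMr ?mulr_gt0//.
  by apply/andP; split; lra.
have [hs es] := u01 _ b1; have [ht et] := u01 _ b2.
have ef : f x = F (al * x.1 + be) (al * x.2 + be) by rewrite /F es et; case: (x).
rewrite distrC ef; set s := al * x.1 + be; set t := al * x.2 + be.
have in01 i : (i <= n)%N -> 0 <= (i%:R / n%:R : R) <= 1.
  by move=> ni; rewrite divr_ge0//= ler_pdivrMr ?ltr0n// mul1r ler_nat.
apply: (le_trans (@bern2_err K del n F s t n0 d0 K0 hs ht _)).
  by move=> i j ni nj; apply: lipF => //; exact: in01.
have h3 : n%:R^-1 / del <= del by rewrite ler_pdivrMr// -expr2.
apply: (@le_trans _ _ (K * (4 * del))); first by apply: ler_wpM2l => //; lra.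
have -> : K * (4 * del) = K / (K + 1) * eps by rewrite /del; field; rewrite gt_eqF.
by rewrite ler_piMl ?(ltW e0)// ler_pdivrMr// mul1r lerDl.
Qed.

Lemma cs_polyfun T f : cs T -> (forall a b, T (fun x => x.1 ^+ a * x.2 ^+ b) = 0) ->
  polyfun f -> T f = 0.
Proof.
move=> cT T0; elim=> [a b|c g h pg p1 ph p2]; first exact: T0.
by rewrite (cT.1 c _ _ (polyfun_smooth pg) (polyfun_smooth ph)) p1 p2 mulr0 addr0.
Qed.

Definition prims (c : R) n phi := iter n (prim1 c) (iter n (prim0 c) phi).

Lemma iter_prim0_smooth (c : R) n phi : smooth phi -> smooth (iter n (prim0 c) phi).
Proof. by move=> sp; elim: n => [|n IH]; [exact: sp|exact: (prim0_smooth c IH)]. Qed.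

Lemma iter_prim1_smooth (c : R) n phi : smooth phi -> smooth (iter n (prim1 c) phi).
Proof. by move=> sp; elim: n => [|n IH]; [exact: sp|exact: (prim1_smooth c IH)]. Qed.

Lemma op_id : @smooth_op R id.
Proof. by split => // M n M0; exists M, n, 1; split => // phi B _; rewrite mul1r. Qed.

Lemma op_iter A n : @smooth_op R A -> smooth_op (iter n A).
Proof. by move=> oA; elim: n => [|n IH]; [exact: op_id|exact: (smooth_op_comp oA IH)]. Qed.

Lemma op_prims (c : R) n : smooth_op (prims c n).
Proof. exact: (smooth_op_comp (op_iter n (op_prim1 c)) (op_iter n (op_prim0 c))). Qed.

Lemma polyfun_prims (c : R) n f : polyfun f -> polyfun (prims c n f).
Proof.
move=> pf; rewrite /prims.
have : polyfun (iter n (prim0 c) f) by elim: n => //= n; exact: polyfun_prim0.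
by move: (iter n _ f) => g pg; elim: n => //= n; exact: polyfun_prim1.
Qed.

Lemma iter_partial_prim0 (c : R) m n phi : smooth phi -> (m <= n)%N ->
  iter m (partial 0) (iter n (prim0 c) phi) = iter (n - m) (prim0 c) phi.
Proof.
move=> sp; elim: m n => [|m IH] n mn; first by rewrite subn0.
case: n mn => // n mn; rewrite iterSr /= (prim0_partial0 c (iter_prim0_smooth c n sp)) subSS.
exact: IH.
Qed.

Lemma iter_partial_prim1 (c : R) m n phi : smooth phi -> (m <= n)%N ->
  iter m (partial 1) (iter n (prim1 c) phi) = iter (n - m) (prim1 c) phi.
Proof.
move=> sp; elim: m n => [|m IH] n mn; first by rewrite subn0.
case: n mn => // n mn; rewrite iterSr /= (prim1_partial1 c (iter_prim1_smooth c n sp)) subSS.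
exact: IH.
Qed.

Lemma partial0_iter_prim1 (c : R) m n phi : smooth phi ->
  iter m (partial 0) (iter n (prim1 c) phi) = iter n (prim1 c) (iter m (partial 0) phi).
Proof.
elim: m phi => //= m IH phi sp; rewrite -iterS iterSr.
have -> : partial 0 (iter n (prim1 c) phi) = iter n (prim1 c) (partial 0 phi).
  elim: n {IH} => //= n IHn; rewrite (prim1_partial0 c (iter_prim1_smooth c n sp)); congr prim1.
  exact: IHn.
by rewrite (IH _ (smooth_on_partial 0 sp)) -iterSr.
Qed.

Lemma pderivE a b phi : pderiv a b phi = iter a (partial 0) (iter b (partial 1) phi).
Proof.
rewrite /pderiv partials_cat.
have H m i psi : partials (nseq m i) psi = iter m (partial i) psi by elim: m => //= m ->.
by rewrite !H.
Qed.

(** Against n primitives in each variable, a word of at most n derivatives only cancels some of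
    them, and each primitive left costs a factor 1 + 2 M. The C^n norm is thus controlled by the sup
    norm of phi, which uniform approximation can make small. *)
Lemma prims_bounded (c M B : R) n phi : smooth phi -> `|c| <= M ->
  (forall x, box M x -> `|phi x| <= B) ->
  bounded_on (box M) n ((1 + 2 * M) ^+ (n + n) * B) (prims c n phi).
Proof.
move=> sp cM hB s sn x bx; have M0 : 0 <= M := le_trans (normr_ge0 c) cM.
have B0 : 0 <= B by rewrite (le_trans _ (hB x bx)).
have K1 : 1 <= 1 + 2 * M by rewrite lerDl mulr_ge0.
rewrite (partials_pderiv s (iter_prim1_smooth c n (iter_prim0_smooth c n sp))) pderivE.
have := word2_size s; move: (count_mem 0 s) (count_mem 1 s) => a b ab.
have an : (a <= n)%N by lia.
have bn : (b <= n)%N by lia.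
rewrite /prims (iter_partial_prim1 c (iter_prim0_smooth c n sp) bn).
rewrite (partial0_iter_prim1 c a (n - b) (iter_prim0_smooth c n sp)) (iter_partial_prim0 c sp an).
have step A psi m (B' : R) : (forall psi (B' : R), smooth psi -> bounded_on (box M) 0 B' psi ->
      smooth (A psi) /\ bounded_on (box M) 0 ((1 + 2 * M) * B') (A psi)) ->
    smooth psi -> bounded_on (box M) 0 B' psi ->
    bounded_on (box M) 0 ((1 + 2 * M) ^+ m * B') (iter m A psi).
  move=> HA sps hB'.
  suff : smooth (iter m A psi) /\ bounded_on (box M) 0 ((1 + 2 * M) ^+ m * B') (iter m A psi) by case.
  elim: m => [|m [IH1 IH2]] /=; first by rewrite mul1r.
  by rewrite exprS -mulrA; exact: HA.
have hB0 : bounded_on (box M) 0 B phi by move=> t; rewrite leqn0 size_eq0 => /eqP ->; exact: hB.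
have h0 psi (B' : R) : smooth psi -> bounded_on (box M) 0 B' psi ->
    smooth (prim0 c psi) /\ bounded_on (box M) 0 ((1 + 2 * M) * B') (prim0 c psi).
  by move=> ss hb; split; [exact: prim0_smooth|exact: prim0_bounded].
have h1 psi (B' : R) : smooth psi -> bounded_on (box M) 0 B' psi ->
    smooth (prim1 c psi) /\ bounded_on (box M) 0 ((1 + 2 * M) * B') (prim1 c psi).
  by move=> ss hb; split; [exact: prim1_smooth|exact: prim1_bounded].
have := step _ _ (n - b)%N _ h1 (iter_prim0_smooth c (n - a) sp) (step _ _ (n - a)%N _ h0 sp hB0).
move=> /(_ [::] isT x bx) /le_trans; apply; rewrite mulrA -exprD.
by apply: ler_wpM2r => //; apply: ler_weXn2l => //; lia.
Qed.

(** The base lines x.1 = c and x.2 = c miss the disc carrying phi, so no boundary value appears when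
    a primitive undoes a derivative. *)
Lemma prims_pderiv (c t : R) n phi : smooth phi -> t < c ^+ 2 ->
  (forall x, t < sqd 0 x -> phi x = 0) -> prims c n (pderiv n n phi) = phi.
Proof.
move=> sp tc p0; rewrite pderivE /prims.
pose van psi := smooth psi /\ forall x, t < sqd 0 x -> psi x = 0.
have oW : open [set x : R * R | t < sqd 0 x].
  exact: open_sqd_gt.
have vp i psi : van psi -> van (partial i psi).
  move=> [ss s0]; split; first exact: smooth_on_partial.
  move=> x tx; have -> : partial i psi x = partial i (fun=> 0) x by exact: (partial_eq_on _ oW).
  by have [_] := is_derive_cst (0 : R) x (e_ i).
have tc1 x : x.1 = c -> t < sqd 0 x.
  by rewrite sqd0E => ->; rewrite ltr_wpDr// sqr_ge0.
have tc2 x : x.2 = c -> t < sqd 0 x.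
  by rewrite sqd0E => ->; rewrite ltr_wpDl// sqr_ge0.
have k0 psi : van psi -> prim0 c (partial 0 psi) = psi.
  move=> [ss s0]; rewrite (prim0_K c ss); apply/funext => x.
  by rewrite (s0 (c, x.2)) ?subr0//; exact: tc1.
have k1 psi : van psi -> prim1 c (partial 1 psi) = psi.
  move=> [ss s0]; rewrite (prim1_K c ss); apply/funext => x.
  by rewrite (s0 (x.1, c)) ?subr0//; exact: tc2.
have H i A m psi : (forall psi, van psi -> A (partial i psi) = psi) -> van psi ->
    iter m A (iter m (partial i) psi) = psi.
  move=> HA; elim: m psi => //= m IH psi vs.
  by rewrite -[partial i (iter m _ psi)]/(iter m.+1 (partial i) psi) iterSr (IH _ (vp i _ vs)) HA.
have vi m i psi : van psi -> van (iter m (partial i) psi).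
  by move=> vs; elim: m => [|m IH]; [exact: vs|exact: (vp i _ IH)].
by rewrite (H _ _ _ _ k0 (vi n 1 _ (conj sp p0))) (H _ _ _ _ k1 (conj sp p0)).
Qed.

(* A cut-off phi is the n-fold primitive, in both variables, of its derivative of order (n, n);
   replacing the latter by a uniformly close polynomial changes phi by little in C^n. *)
Theorem cs_density T : cs T -> (forall a b, T (fun x => x.1 ^+ a * x.2 ^+ b) = 0) ->
  forall phi, smooth phi -> T phi = 0.
Proof.
move=> cT T0 phi sp; have [M [M0 HM]] := cs_local cT.
have [_ [M1 [n [C [M10 C0 HC]]]]] := cT.
(* On [box M] one has |x|^2 <= 2 M^2 < t - 1, so the cut-off is 0 near the box and does not change
   the value of T. *)
pose t := 2 * M ^+ 2 + 2; have ts : t - 1 < t by rewrite ltrBlDr ltrDl.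
pose psi x := (1 - cutoff 0 (t - 1) t x) * phi x.
have sk := smooth_cutoff (0 : R * R) ts.
have ss : smooth psi := smoothM (smooth_onB openT (smooth_on_cst 1 openT) sk) sp.
have -> : T phi = T psi.
  apply/eqP; rewrite -subr_eq0 -(csTB cT sp ss); apply/eqP.
  apply: (HM _ [set x | sqd 0 x < t - 1]).
  - exact: (smooth_onB openT sp ss).
  - exact: open_sqd_lt.
  - move=> x [b1 b2]; rewrite /= sqd0E -(real_normK (num_real x.1)) -(real_normK (num_real x.2)) /t.
    have := normr_ge0 x.1; have := normr_ge0 x.2; nra.
  - by move=> x /= xt; rewrite /psi cutoff0 ?subr0 ?mul1r ?subrr// ltW.
have psi0 x : t < sqd 0 x -> psi x = 0.
  by move=> tx; rewrite /psi cutoff1 ?subrr ?mul0r// ltW.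
(* Serves two purposes: [box c] contains the box of the estimate for T, and c^2 > t, as
   [prims_pderiv] requires. *)
pose c := M1 + t; have t2 : 2 <= t by rewrite /t lerDr mulr_ge0// sqr_ge0.
have c0 : 0 < c by rewrite /c; lra.
have tc : t < c ^+ 2 by rewrite /c; nra.
have e := prims_pderiv n ss tc psi0; set D := pderiv n n psi in e.
have sD : smooth D := smooth_partials _ ss.
have [sJ lJ _] := op_prims c n.
apply/normr0_eq0/le_anti/andP; split => //; apply/ler_addgt0Pl => eps e0; rewrite addr0.
pose K := C * (1 + 2 * c) ^+ (n + n).
have K0 : 0 <= K by rewrite mulr_ge0// exprn_ge0// addr_ge0// mulr_ge0// ltW.
have K1 : 0 < K + 1 by rewrite ltr_wpDl.
have [p pp hp] := polyfun_approx sD c0 (divr_gt0 e0 K1).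
have spp := polyfun_smooth pp.
(* The primitives of p are polynomials, killed by T; only the uniformly small remainder q
   contributes to T psi. *)
pose q x := -1 * p x + D x; have sq : smooth q := smoothD (smoothZ (-1) spp) sD.
have Tq : T (prims c n q) = T psi.
  rewrite lJ// (cT.1 (-1) _ _ (sJ _ spp) (sJ _ sD)) e.
  by rewrite (cs_polyfun cT T0 (polyfun_prims c n pp)) mulr0 add0r.
have cc : `|c| <= c by rewrite gtr0_norm.
have hq x : box c x -> `|q x| <= eps / (K + 1).
  by move=> bx; rewrite /q mulN1r addrC; exact: hp.
have bq := prims_bounded (n := n) sq cc hq.
rewrite -Tq; apply: (le_trans (HC _ _ (sJ _ sq) (boundedW (n' := n) _ (leqnn n) (lexx _) bq))).
  by move=> x; apply: box_mono; rewrite /c; lra.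
rewrite mulrA -/K mulrCA ler_piMr ?(ltW e0)// ler_pdivrMr// mul1r lerDl //.
Qed.

End Bernstein.

(** * Inversion centred at a point off the support *)

Section Inversion.
Context {R : realType}.
Implicit Types (h phi psi theta : R * R -> R) (x y p : R * R) (T : @functional R).

Notation nrm := (@euclid_norm R).

Lemma sqd_gt0 p x : (0 < sqd p x) = (x != p).
Proof.
case: p x => p1 p2 [x1 x2]; rewrite /sqd /= lt0r paddr_eq0 ?sqr_ge0// addr_ge0 ?sqr_ge0// andbT.
by rewrite !sqrf_eq0 !subr_eq0.
Qed.

Lemma sqd0_sub p x : sqd 0 (p - x) = sqd p x.
Proof. rewrite sqd0E /sqd /=; ring. Qed.

Lemma nrm_sub_sq p x : nrm (p - x) ^+ 2 = sqd p x.
Proof. by rewrite nrm_sq -sqd0E sqd0_sub. Qed.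

Lemma smooth_on_refl p h : smooth_on off0 h -> smooth_on [set y | y != p] (fun y => h (p - y)).
Proof.
move=> sh; have oO := @open_neq2 R p.
have c1 := smooth_onB oO (smooth_on_cst p.1 oO) (smooth_on_fst oO).
have c2 := smooth_onB oO (smooth_on_cst p.2 oO) (smooth_on_snd oO).
have H x : x != p -> @off0 R (p.1 - x.1, p.2 - x.2).
  by rewrite /off0 /= -sqd0_gt0 -sqd_gt0 -[_ < sqd 0 _]/(0 < sqd 0 (p - x)) sqd0_sub.
exact: (smooth_on_comp oO open_off0 sh c1 c2 H).
Qed.

Variables (p0 : R * R) (s t : R).
Hypotheses (s0 : 0 < s) (st : s < t).

Definition outer : set (R * R) := [set y | s <= sqd p0 y].

Lemma open_outerC : open (~` outer).
Proof.
have -> : ~` outer = [set y | sqd p0 y < s].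
  by apply/seteqP; split => y; rewrite /outer /= ltNge => /negP.
exact: open_sqd_lt.
Qed.

Lemma outer_neq : outer `<=` [set y | y != p0].
Proof. by move=> y /= h; rewrite -sqd_gt0 (lt_le_trans s0). Qed.

Lemma cutoff_carried : carried outer (cutoff p0 s t).
Proof.
split; first exact: smooth_cutoff.
by move=> x /negP; rewrite /outer /= -ltNge => h; rewrite cutoff0// ltW.
Qed.

(* The kernel h (p0 - y), smoothly cut off near y = p0. *)
Definition ext h y : R := cutoff p0 s t y * h (p0 - y).

Lemma ext_carried h : smooth_on off0 h -> carried outer (ext h).
Proof.
move=> sh.
exact: (carried_mul (@open_neq2 R p0) outer_neq open_outerC cutoff_carried (smooth_on_refl sh)).
Qed.

Lemma smooth_ext h : smooth_on off0 h -> smooth (ext h).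
Proof. by move=> /ext_carried[]. Qed.

Lemma ext_p0 h : ext h p0 = 0.
Proof. by rewrite /ext cutoff0 ?mul0r// /sqd !subrr expr0n addr0 ltW. Qed.

Definition inv1 y : R := (p0.1 - y.1) / sqd p0 y.
Definition inv2 y : R := (p0.2 - y.2) / sqd p0 y.

Lemma smooth_inv : smooth_on [set y | y != p0] inv1 /\ smooth_on [set y | y != p0] inv2.
Proof.
have oO := @open_neq2 R p0.
have c1 := smooth_onB oO (smooth_on_cst p0.1 oO) (smooth_on_fst oO).
have c2 := smooth_onB oO (smooth_on_cst p0.2 oO) (smooth_on_snd oO).
have c3 : smooth_on [set y | y != p0] (fun y => (sqd p0 y)^-1).
  by apply: (smooth_onV oO (smooth_on_sqd p0 oO)) => x /=; rewrite -sqd_gt0 => /gt_eqF ->.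
by split; [exact: (smooth_onM oO c1 c3)|exact: (smooth_onM oO c2 c3)].
Qed.

Lemma inv_sq y : y != p0 -> inv1 y ^+ 2 + inv2 y ^+ 2 = (sqd p0 y)^-1.
Proof.
move=> yp; have Q0 : sqd p0 y != 0 by rewrite gt_eqF// sqd_gt0.
have -> : inv1 y ^+ 2 + inv2 y ^+ 2 = sqd p0 y / sqd p0 y ^+ 2.
  rewrite /inv1 /inv2 !exprMn -mulrDl exprVn; congr (_ / _); rewrite /sqd; ring.
by move: Q0; move: (sqd p0 y) => Q Q0; field.
Qed.

Lemma inv_bound y : outer y -> box (1 + s^-1) (inv1 y, inv2 y).
Proof.
move=> oy; have := inv_sq (outer_neq oy).
have : (sqd p0 y)^-1 <= s^-1 by rewrite lef_pV2 ?posrE// ?(lt_le_trans s0).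
move=> h1 h2; have h : inv1 y ^+ 2 + inv2 y ^+ 2 <= s^-1 by rewrite h2.
have s1 : 0 < s^-1 by rewrite invr_gt0.
have h3 := sqr_ge0 (inv1 y); have h4 := sqr_ge0 (inv2 y).
have e (u : R) : u ^+ 2 <= s^-1 -> `|u| <= 1 + s^-1.
  rewrite -(real_normK (num_real u)); have := normr_ge0 u; nra.
by split; apply: e; rewrite /=; lra.
Qed.

(* The inversion y |-> (p0 - y) / |p0 - y|^2 turns the kernels [ker a b (2 * n + 1)] into
   |p0 - y|^-1 times monomials, so that the density of polynomials applies. *)
Theorem inversion_kills T : cs T ->
  (forall phi, smooth phi -> (forall y, t <= sqd p0 y -> phi y = 0) -> T phi = 0) ->
  (forall n a b, (a + b = n)%N -> T (ext (ker a b (2 * n + 1))) = 0) ->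
  forall phi, smooth phi -> T phi = 0.
Proof.
move=> cT Tloc Tker phi sp; have t0 := lt_trans s0 st.
have oO := @open_neq2 R p0; have [si1 si2] := smooth_inv.
(* The weight is |p0 - y|^-1, cut off near p0: multiplied by the monomial of exponents (a, b) in the
   inverted variable it is exactly [ext (ker a b (2 * (a + b) + 1))]. *)
pose rho := ext (ker 0 0 1).
have cr : carried outer rho := ext_carried (@smooth_ker R 0 0 1).
have opc : smooth_op (pcomp inv1 inv2 rho).
  apply: (op_pcomp oO outer_neq open_outerC si1 si2 cr) => M; exists (1 + s^-1); split.
    by rewrite addr_ge0// invr_ge0 ltW.
  by move=> x ox _; exact: inv_bound.
have T0 := cs_density (cs_op cT opc).
have rhoE y : rho y = cutoff p0 s t y / nrm (p0 - y).
  by rewrite /rho /ext /ker !expr0 mul1r expr1 mul1r.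
have {}T0 : forall theta, smooth theta -> T (pcomp inv1 inv2 rho theta) = 0.
  apply: T0 => a b; rewrite -[RHS](Tker (a + b)%N a b erefl); congr T; apply/funext => y.
  rewrite /pcomp rhoE /=; have [->|yp] := eqVneq y p0.
    by rewrite ext_p0 cutoff0 ?mul0r// /sqd !subrr expr0n addr0 ltW.
  rewrite /ext /ker /inv1 /inv2 -nrm_sub_sq /=.
  have N0 : nrm (p0 - y) != 0 by rewrite gt_eqF// nrm_gt0 subr_eq0 eq_sym.
  rewrite !exprMn !exprVn -!exprM exprD expr1 mulnDr exprD.
  have := expf_neq0 (2 * a) N0; have := expf_neq0 (2 * b) N0; move: N0.
  move: (cutoff _ _ _ _) (nrm _) (nrm _ ^+ (2 * b)) (nrm _ ^+ (2 * a)) => c w v u.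
  by move=> w0 v0 u0; field; rewrite w0 v0 u0.
have [M [M0 HM]] := cs_local cT.
(* Chosen so that sqd p0 < q on [box M]; passing from phi to psi, which vanishes at large distance,
   does not change the value of T. *)
pose q := 2 * (M + `|p0.1| + `|p0.2|) ^+ 2 + 1; have q1 : q < q + 1 by rewrite ltrDl.
have q0 : 0 < q + 1 by rewrite /q ltr_wpDl// addr_ge0// mulr_ge0// sqr_ge0.
pose psi x := (1 - cutoff p0 q (q + 1) x) * phi x.
have ss : smooth psi := smoothM (smooth_onB openT (smooth_on_cst 1 openT) (smooth_cutoff p0 q1)) sp.
have psi0 x : q + 1 <= sqd p0 x -> psi x = 0.
  by move=> h; rewrite /psi cutoff1// subrr mul0r.
have -> : T phi = T psi.
  apply/eqP; rewrite -subr_eq0 -(csTB cT sp ss); apply/eqP.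
  apply: (HM _ [set x | sqd p0 x < q]); first exact: (smooth_onB openT sp ss).
  - exact: open_sqd_lt.
  - move=> x [b1 b2] /=; rewrite /sqd /q.
    have e1 : `|x.1 - p0.1| <= M + `|p0.1| by rewrite (le_trans (ler_normB _ _))// lerD2r.
    have e2 : `|x.2 - p0.2| <= M + `|p0.2| by rewrite (le_trans (ler_normB _ _))// lerD2r.
    rewrite -(real_normK (num_real (x.1 - p0.1))) -(real_normK (num_real (x.2 - p0.2))).
    have := normr_ge0 (x.1 - p0.1); have := normr_ge0 (x.2 - p0.2).
    have := normr_ge0 p0.1; have := normr_ge0 p0.2; nra.
  - by move=> x /= xt; rewrite /psi cutoff0 ?subr0 ?mul1r ?subrr// ltW.
pose k1 (z : R * R) := p0.1 - z.1 / sqd 0 z; pose k2 (z : R * R) := p0.2 - z.2 / sqd 0 z.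
(* (k1, k2) undoes the inversion, and the division by |z| = |p0 - y|^-1 compensates the weight, so
   the pullback of theta is psi times the cut-off. The origin z = 0 corresponds to infinity, near
   which psi vanishes; hence theta is smooth there as well, with theta 0 = 0 by the convention on
   the inverse of 0. *)
pose theta z := psi (k1 z, k2 z) / nrm z.
have sth : smooth theta.
  have o0 := @open_off0 R.
  have sq : smooth_on (@off0 R) (fun z => (sqd 0 z)^-1).
    by apply: (smooth_onV o0 (smooth_on_sqd 0 o0)) => z; rewrite /off0 /= -sqd0_gt0 => /gt_eqF ->.
  have sk1 : smooth_on (@off0 R) k1.
    exact: (smooth_onB o0 (smooth_on_cst p0.1 o0) (smooth_onM o0 (smooth_on_fst o0) sq)).
  have sk2 : smooth_on (@off0 R) k2.
    exact: (smooth_onB o0 (smooth_on_cst p0.2 o0) (smooth_onM o0 (smooth_on_snd o0) sq)).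
  have sn : smooth_on (@off0 R) (fun z => (nrm z)^-1).
    by apply: (smooth_onV o0 (@smooth_nrm R)) => z; rewrite /off0 /= -nrm_gt0 => /gt_eqF ->.
  have h1 : smooth_on (@off0 R) theta.
    exact: (smooth_onM o0 (smooth_on_comp o0 openT ss sk1 sk2 (fun _ _ => I)) sn).
  have oB := @open_sqd_lt R 0 (q + 1)^-1.
  have h2 : smooth_on [set z : R * R | sqd 0 z < (q + 1)^-1] theta.
    apply: (@smooth_on_eq _ _ (fun=> 0)) => //; last exact: smooth_on_cst.
    move=> z /set_mem /= hz; rewrite /theta; have [->|z0] := eqVneq z 0.
      by rewrite /euclid_norm /= !expr0n addr0 sqrtr0 invr0 mulr0.
    have Q0 : 0 < sqd 0 z by rewrite sqd0_gt0.
    rewrite psi0 ?mul0r//.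
    have -> : sqd p0 (k1 z, k2 z) = (sqd 0 z)^-1.
      have -> : sqd p0 (k1 z, k2 z) = sqd 0 z / sqd 0 z ^+ 2.
        have e (a b : R) : a - b - a = - b by ring.
        by rewrite {1}/sqd /k1 /k2 /= !e !sqrrN !exprMn -mulrDl -sqd0E exprVn.
      by move: (sqd 0 z) Q0 => Q Q0; field; rewrite gt_eqF.
    by rewrite -[leLHS]invrK lef_pV2 ?posrE ?invr_gt0// ltW.
  have -> : smooth theta = smooth_on (@off0 R `|` [set z : R * R | sqd 0 z < (q + 1)^-1]) theta.
    congr smooth_on; apply/seteqP; split => // z _.
    have [->|z0] := eqVneq z 0; [right|by left].
    by rewrite /= sqd0E /= expr0n addr0 invr_gt0.
  exact: smooth_onU.
have e : T (pcomp inv1 inv2 rho theta) = T (fun y => cutoff p0 s t y * psi y).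
  congr T; apply/funext => y; rewrite /pcomp rhoE; have [->|yp] := eqVneq y p0.
    by rewrite cutoff0 ?mul0r// /sqd !subrr expr0n addr0 ltW.
  have Q0 : 0 < sqd p0 y by rewrite sqd_gt0.
  have N0 : 0 < nrm (p0 - y) by rewrite nrm_gt0 subr_eq0 eq_sym.
  have sE : sqd 0 (inv1 y, inv2 y) = (sqd p0 y)^-1 by rewrite sqd0E inv_sq.
  have nE : nrm (inv1 y, inv2 y) = (nrm (p0 - y))^-1.
    rewrite nrmE sE -nrm_sub_sq sqrtrV; last by rewrite sqr_ge0.
    by rewrite sqrtr_sqr gtr0_norm.
  have -> : theta (inv1 y, inv2 y) = psi y * nrm (p0 - y).
    rewrite /theta nE invrK /k1 /k2 sE invrK /inv1 /inv2 /= !divfK ?gt_eqF//.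
    by rewrite !subKr; case: (y).
  by field; rewrite gt_eqF.
have sc : smooth (fun y => cutoff p0 s t y * psi y) := smoothM (smooth_cutoff p0 st) ss.
have := T0 _ sth; rewrite e => {}e.
transitivity (T (fun y => psi y - cutoff p0 s t y * psi y)).
  by rewrite (csTB cT ss sc) e subr0.
apply: Tloc.
  exact: (smooth_onB openT ss sc).
by move=> y ty; rewrite cutoff1// mul1r subrr.
Qed.

End Inversion.

(** * From the derivatives of |x|^(2r-1) to all the kernels required by the inversion *)

Section KernelFamily.
Context {R : realType}.
Implicit Types (f g : R * R -> R) (x y p : R * R) (T : @functional R).

Lemma partialsD_on A u f g x : open A -> smooth_on A f -> smooth_on A g -> A x ->
  partials u (fun x => f x + g x) x = partials u f x + partials u g x.
Proof.
move=> oA sf sg; elim: u x => //= i u IH x Ax.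
rewrite (partial_eq_on i oA Ax IH).
exact: (partialD i (smooth_on_partials u sf) (smooth_on_partials u sg) Ax).
Qed.

Lemma partialsZ_on A u (c : R) f x : open A -> smooth_on A f -> A x ->
  partials u (fun x => c * f x) x = c * partials u f x.
Proof.
move=> oA sf; elim: u x => //= i u IH x Ax.
rewrite (partial_eq_on i oA Ax IH).
exact: (partialZ i c (smooth_on_partials u sf) Ax).
Qed.

Lemma partials_eq_off0 u f g x : (forall x, x != 0 -> f x = g x) -> x != 0 ->
  partials u f x = partials u g x.
Proof.
move=> fg x0; apply: (partials_eq_on u (@open_off0 R)); last exact/mem_set.
by move=> y /set_mem; exact: fg.
Qed.

Variables (p0 : R * R) (s t : R).
Hypotheses (s0 : 0 < s) (st : s < t).

Lemma ext_eq f g : (forall x, x != 0 -> f x = g x) -> ext p0 s t f = ext p0 s t g.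
Proof.
move=> fg; apply/funext => y; have [->|yp] := eqVneq y p0; first by rewrite !ext_p0.
by rewrite /ext fg// subr_eq0 eq_sym.
Qed.

(** Up to nonzero constants, the derivatives of order 2r of [pot r] are the kernels of degree -1
    with denominator |x|^(2r+1). The identity |x|^2 / |x|^2 = 1, in the form [ker_raise], descends
    from these to |x|^-1, from which [ker_span] climbs to all kernels wanted. *)
Theorem kernel_family T r : cs T ->
  (forall u, (r <= size u)%N -> T (ext p0 s t (partials u (pot r))) = 0) ->
  forall n a b, (a + b = n)%N -> T (ext p0 s t (ker a b (2 * n + 1))) = 0.
Proof.
move=> cT Tpot.
(* Quantifying over all further derivatives builds the stability under [partial] into the
   predicate. *)
pose P f := forall u, T (ext p0 s t (partials u f)) = 0.
have sk a b q : smooth_on off0 (@ker R a b q) := @smooth_ker R a b q.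
have Peq f g : (forall x, x != 0 -> f x = g x) -> P f -> P g.
  move=> fg Pf u; rewrite -(Pf u); congr T; apply: ext_eq => x x0.
  by apply/esym; exact: partials_eq_off0.
have Padd f g : smooth_on off0 f -> smooth_on off0 g -> P f -> P g -> P (fun x => f x + g x).
  move=> sf sg Pf Pg u; pose F := partials u f; pose G := partials u g.
  have sF : smooth (ext p0 s t F) := smooth_ext p0 s0 st (smooth_on_partials u sf).
  have sG : smooth (ext p0 s t G) := smooth_ext p0 s0 st (smooth_on_partials u sg).
  transitivity (T (fun y => ext p0 s t F y + ext p0 s t G y)); last first.
    by rewrite (csTD cT sF sG) Pf Pg addr0.
  congr T; rewrite (@ext_eq _ (fun x => F x + G x)).
    by apply/funext => y; rewrite /ext mulrDr.
  by move=> x x0; exact: (partialsD_on u (@open_off0 R) sf sg x0).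
have Pscale c f : smooth_on off0 f -> P f -> P (fun x => c * f x).
  move=> sf Pf u; pose F := partials u f.
  have sF : smooth (ext p0 s t F) := smooth_ext p0 s0 st (smooth_on_partials u sf).
  transitivity (T (fun y => c * ext p0 s t F y)); last by rewrite (csTZ c cT sF) Pf mulr0.
  congr T; rewrite (@ext_eq _ (fun x => c * F x)).
    by apply/funext => y; rewrite /ext mulrCA.
  by move=> x x0; exact: (partialsZ_on u c (@open_off0 R) sf x0).
have Pder i f : smooth_on off0 f -> P f -> P (partial i f).
  by move=> _ Pf u; rewrite -partials_rcons.
have Ppot a b : (a + b = 2 * r)%N -> P (ker b a (2 * r + 1)).
  move=> ab; have sp : smooth_on off0 (@pot R r) := hom_smooth (hom_pot r).
  pose c := (pot_cst r * (-1) ^+ a : R).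
  have c0 : c != 0 by rewrite mulf_neq0 ?pot_cst_neq0// signr_eq0.
  apply: (Peq (fun x => c^-1 * pderiv a b (pot r) x)).
    by move=> x x0; rewrite (pderiv_pot ab x0) -/c mulKf.
  apply: Pscale; first exact: (smooth_on_partials _ sp).
  move=> u; rewrite /pderiv -partials_cat; apply: Tpot.
  by rewrite !size_cat !size_nseq; lia.
have Plow j : (j <= r)%N -> forall a b, (a + b = 2 * (r - j))%N -> P (ker a b (2 * (r - j) + 1)).
  elim: j => [_ a b|j IH jr a b ab]; first by rewrite subn0 addnC => /Ppot.
  apply: (Peq (fun x => ker a.+2 b (2 * (r - j) + 1) x + ker a b.+2 (2 * (r - j) + 1) x)).
    move=> x x0; rewrite [RHS](ker_raise _ _ _ x0).
    by have -> : (2 * (r - j) + 1 = (2 * (r - j.+1) + 1).+2)%N by lia.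
  apply: Padd => //; apply: IH; lia.
have P0 : P (ker 0 0 1).
  have := Plow r (leqnn r) 0%N 0%N; rewrite subnn; exact.
by move=> n a b ab; exact: (ker_span Peq Padd Pscale Pder P0 ab [::]).
Qed.

End KernelFamily.

(** * Bumps around a point and integration by parts between smooth functions *)

Section Concentration.
Context {R : realType}.
Implicit Types (f h q phi : R * R -> R) (x y p : R * R) (d : R).

Notation e_ := (@basis2 R).
Notation mu := (@lebesgue_measure R).
Notation mu2 := (@lebesgue2 R).
Notation mR := (measurableTypeR R).

Lemma smooth_cont f : smooth f -> continuous f.
Proof. by move=> sf x; exact: (smooth_on_cont sf I). Qed.

Lemma intg_supported q phi (M : R) : continuous q -> supported M phi ->
  intg (fun x => q x * phi x).
Proof.
move=> cq [sp p0]; have cp : continuous (fun x => q x * phi x).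
  by move=> x; apply: continuousM; [exact: cq|exact: smooth_cont].
have [C [C0 HC]] := box_bound M cp.
apply: (@intg_bounded _ _ M C); first exact: mfun_cont.
  by move=> x; have [/HC//|/p0 ->] := pselect (box M x); rewrite mulr0 normr0.
by move=> x /p0 ->; rewrite mulr0.
Qed.

Lemma smooth_ibp i h phi (M : R) : 0 <= M -> smooth h -> supported M phi ->
  plane_int (fun x => h x * partial i phi x) = - plane_int (fun x => partial i h x * phi x).
Proof.
move=> M0 sh sp; have sp' := supported_partial i sp; have sh' := smooth_on_partial i sh.
have I1 := intg_supported (smooth_cont sh) sp'; have I2 := intg_supported (smooth_cont sh') sp.
apply/eqP; rewrite -subr_eq0 opprK -(plane_intD I1 I2); apply/eqP.
apply: (@int_partial0 _ i (fun x => h x * phi x) _ 0 M M0).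
- move=> x _; have D := is_deriveM (smooth_on_derive i sh (I : setT x)) (smooth_on_derive i sp.1 (I : setT x)).
  by apply: (is_derive_eq D); rewrite /GRing.scale/= [phi x * _]mulrC.
- move=> x _; apply: continuousD; apply: continuousM.
  + exact: (smooth_cont sh).
  + exact: (smooth_cont sp'.1).
  + exact: (smooth_cont sh').
  + exact: (smooth_cont sp.1).
- by move=> x /sp.2 ->; rewrite mulr0.
- by move=> x nx; rewrite (sp.2 x nx) (sp'.2 x nx) !mulr0 addr0.
- exact: intgD.
Qed.

Lemma smooth_ibps u h phi (M : R) : 0 <= M -> smooth h -> supported M phi ->
  plane_int (fun x => h x * partials u phi x) =
  (-1) ^+ size u * plane_int (fun x => partials (rev u) h x * phi x).
Proof.
move=> M0; elim: u h => [|i u IH] h sh sp; first by rewrite mul1r.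
rewrite /= (smooth_ibp i M0 sh (supported_partials u sp)) (IH _ (smooth_on_partial i sh) sp).
by rewrite rev_cons partials_rcons exprS mulN1r mulNr.
Qed.

Lemma partials_shift u h y : smooth h ->
  partials u (fun x => h (x - y)) = fun x => partials u h (x - y).
Proof.
move=> sh; elim: u => //= i u ->; apply/funext => x; rewrite /partial /derive.
have -> : (fun t : R => t^-1 *: (((fun x => partials u h (x - y)) \o shift x) (t *: e_ i) - partials u h (x - y))) =
    (fun t : R => t^-1 *: ((partials u h \o shift (x - y)) (t *: e_ i) - partials u h (x - y))).
  by apply/funext => t /=; rewrite addrA.
by [].
Qed.

Lemma smooth_shift h y : smooth h -> smooth (fun x => h (x - y)).
Proof.
move=> sh; have c1 := smooth_onB openT (smooth_on_fst openT) (smooth_on_cst y.1 openT).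
have c2 := smooth_onB openT (smooth_on_snd openT) (smooth_on_cst y.2 openT).
exact: (smooth_on_comp openT openT sh c1 c2 (fun _ _ => I)).
Qed.

Lemma smooth_refl h p : smooth h -> smooth (fun y => h (p - y)).
Proof.
move=> sh; have c1 := smooth_onB openT (smooth_on_cst p.1 openT) (smooth_on_fst openT).
have c2 := smooth_onB openT (smooth_on_cst p.2 openT) (smooth_on_snd openT).
exact: (smooth_on_comp openT openT sh c1 c2 (fun _ _ => I)).
Qed.

Lemma partial_refl i h p : smooth h ->
  partial i (fun y => h (p - y)) = fun y => - partial i h (p - y).
Proof.
move=> sh; have c1 := smooth_onB openT (smooth_on_cst p.1 openT) (smooth_on_fst openT).
have c2 := smooth_onB openT (smooth_on_cst p.2 openT) (smooth_on_snd openT).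
apply/funext => y; have e := partial_comp i openT sh c1 c2 (I : setT y) I.
rewrite [LHS]e.
have d1 : partial i (fun x : R * R => p.1 - x.1) y = - (i == 0)%:R.
  by have [_] := is_deriveB (is_derive_cst p.1 y (e_ i)) (is_derive_fst i y); rewrite sub0r.
have d2 : partial i (fun x : R * R => p.2 - x.2) y = - (i == 1)%:R.
  by have [_] := is_deriveB (is_derive_cst p.2 y (e_ i)) (is_derive_snd i y); rewrite sub0r.
rewrite d1 d2; move: i {e d1 d2}; apply: I2_ind => /=.
- by rewrite oppr0 mulr0 addr0 mulrN1.
- by rewrite oppr0 mulr0 add0r mulrN1.
Qed.

Lemma partials_refl u h p : smooth h ->
  partials u (fun y => h (p - y)) = fun y => (-1) ^+ size u * partials u h (p - y).
Proof.
move=> sh; elim: u => [|i u /= ->]; first by apply/funext => y; rewrite mul1r.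
have sk := smooth_partials u sh; apply/funext => y.
rewrite (partialZ i _ (smooth_refl p sk) I) (partial_refl i p sk) exprS; ring.
Qed.

Lemma partials_rev u f : smooth f -> partials (rev u) f = partials u f.
Proof. by move=> sf; rewrite !(partials_pderiv _ sf) !count_rev. Qed.

Lemma smooth_bounded_on f n (M : R) : smooth f -> exists C : R, 0 <= C /\ bounded_on (box M) n C f.
Proof.
elim: n f => [|n IH] f sf; have [C [C0 HC]] := box_bound M (smooth_cont sf).
  by exists C; split => // u; rewrite leqn0 size_eq0 => /eqP ->; exact: HC.
have [C1 [C10 H1]] := IH _ (smooth_on_partial 0 sf).
have [C2 [C20 H2]] := IH _ (smooth_on_partial 1 sf).
exists (C + (C1 + C2)); split; first by rewrite !addr_ge0.
apply: boundedS => [x bx|]; first by rewrite (le_trans (HC x bx))// lerDl addr_ge0.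
apply: I2_ind.
  by apply: boundedW H1 => //; lra.
by apply: boundedW H2 => //; lra.
Qed.

(** Not normalized: the estimates carry its integral as a factor, positive by [int_bump_gt0] and
    cancelled at the end of [dirac_limit]. *)
Definition ball_bump p (d : R) x : R := flat 0 (d ^+ 2 - sqd p x).

Lemma bump_ge0 p d x : 0 <= ball_bump p d x.
Proof. exact: flat_ge0. Qed.

Lemma bump0 p d x : d ^+ 2 <= sqd p x -> ball_bump p d x = 0.
Proof. by move=> h; rewrite /ball_bump flat_le0// subr_le0. Qed.

Lemma smooth_bump p d : smooth (ball_bump p d).
Proof.
exact: (smooth_on_flat 0 openT (smooth_onB openT (smooth_on_cst (d ^+ 2) openT) (smooth_on_sqd p openT))).
Qed.

Lemma sqd_near p x (d : R) : 0 <= d -> sqd p x <= d ^+ 2 -> `|x.1 - p.1| <= d /\ `|x.2 - p.2| <= d.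
Proof.
rewrite /sqd => d0 h; have h1 := sqr_ge0 (x.1 - p.1); have h2 := sqr_ge0 (x.2 - p.2).
by split; rewrite -ler_sqr ?nnegrE// real_normK ?num_real//; lra.
Qed.

Definition ball_radius p (d : R) : R := `|p.1| + `|p.2| + d.

Lemma sqd_box p x (d : R) : 0 <= d -> sqd p x <= d ^+ 2 -> box (ball_radius p d) x.
Proof.
move=> d0 /(sqd_near d0)[h1 h2]; rewrite /ball_radius; have := normr_ge0 p.1; have := normr_ge0 p.2.
have := ler_normD (x.1 - p.1) p.1; have := ler_normD (x.2 - p.2) p.2; rewrite !subrK.
by move=> *; split; lra.
Qed.

Definition in_ball p (d : R) phi : Prop := smooth phi /\ forall x, d ^+ 2 < sqd p x -> phi x = 0.

Lemma in_ball_bump p d : in_ball p d (ball_bump p d).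
Proof. by split; [exact: smooth_bump|move=> x h; rewrite bump0// ltW]. Qed.

Lemma in_ball_partials p d u phi : in_ball p d phi -> in_ball p d (partials u phi).
Proof.
move=> [sp p0]; split; first exact: smooth_partials.
elim: u => //= i u IH x h.
have -> : partial i (partials u phi) x = partial i (fun=> 0) x.
  exact: (partial_eq_on i (@open_sqd_gt R p (d ^+ 2)) h IH).
by have [_] := is_derive_cst (0 : R) x (e_ i).
Qed.

Lemma in_ball_supported p d phi : 0 <= d -> in_ball p d phi -> supported (ball_radius p d) phi.
Proof.
move=> d0 [sp p0]; split => // x nb; apply: p0; rewrite ltNge; apply/negP => h.
exact: nb (sqd_box d0 h).
Qed.

Lemma in_ball_test (V : set (R * R)) p d phi : 0 <= d -> in_ball p d phi ->
  (forall x, sqd p x <= d ^+ 2 -> V x) -> test_fun V phi.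
Proof.
move=> d0 [sp p0] BV; pose B := [set x | sqd p x <= d ^+ 2].
have cB : closed B.
  have -> : B = ~` [set x | d ^+ 2 < sqd p x].
    by apply/seteqP; split => x; rewrite /B /= leNgt => /negP.
  exact: (open_closedC (@open_sqd_gt R p (d ^+ 2))).
have sB : supp phi `<=` B.
  have e := (closure_id B).1 cB; rewrite e; apply: closure_subset => x /= px.
  by rewrite /B /= leNgt; apply: contra px => h; rewrite p0.
split => //; last by move=> x /sB; exact: BV.
apply: (@subclosed_compact _ _ (box (ball_radius p d))).
- exact: closed_closure.
- exact: compact_box.
- by move=> x /sB; exact: sqd_box.
Qed.

Lemma intg_bump p d : 0 <= d -> intg (ball_bump p d).
Proof.
move=> d0; have sb := in_ball_supported d0 (in_ball_bump p d).
have := intg_supported (smooth_cont (smooth_on_cst 1 openT)) sb.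
by under eq_fun do rewrite mul1r.
Qed.

Lemma int_bump_le q (B : R) p d : 0 <= d -> continuous q ->
  (forall x, sqd p x <= d ^+ 2 -> `|q x| <= B) ->
  `|plane_int (fun x => q x * ball_bump p d x)| <= B * plane_int (ball_bump p d).
Proof.
move=> d0 cq qB; have sb := in_ball_supported d0 (in_ball_bump p d).
have i1 := intg_supported cq sb.
have i0 := intg_bump p d0.
apply: (le_trans (le_normr_Rintegral measurableT i1)).
rewrite -(plane_intZ B i0); apply: le_Rintegral => //.
- by have := integrable_abse i1.
- exact: intgZ.
move=> x _; rewrite normrM (ger0_norm (bump_ge0 p d x)).
have [h|h] := leP (sqd p x) (d ^+ 2); last by rewrite bump0 ?mulr0// ltW.
by apply: ler_wpM2r; [exact: bump_ge0|exact: qB].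
Qed.

Lemma int_bump_gt0 p d : 0 < d -> 0 < plane_int (ball_bump p d).
Proof.
move=> d0; have i0 := intg_bump p (ltW d0).
have bp : 0 < ball_bump p d p.
  by rewrite /ball_bump flat_gt0// /sqd !subrr expr0n addr0 subr0 exprn_gt0.
pose c := ball_bump p d p / 2; have c0 : 0 < c by rewrite divr_gt0.
have [rho rho0 Hrho] := (cont2P _ _).1 (@smooth_cont _ (smooth_bump p d) p) c c0.
pose I1 : set mR := `](p.1 - rho), (p.1 + rho)[%classic.
pose I2 : set mR := `](p.2 - rho), (p.2 + rho)[%classic.
pose B : set (mR * mR) := I1 `*` I2.
have mB : measurable B by apply: measurableX; exact: measurable_itv.
have muI (a : R) : mu `](a - rho), (a + rho)[%classic = (2 * rho)%:E.
  rewrite lebesgue_measure_itv/= lte_fin.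
  have -> : a - rho < a + rho by rewrite ltrD2l gtrN.
  by rewrite -EFinB; congr (_%:E); ring.
have muB : mu2 B = (2 * rho * (2 * rho))%:E.
  rewrite /lebesgue2 product_measure1E; [|exact: measurable_itv..].
  by rewrite EFinM; congr (_ * _)%E; exact: muI.
pose G (x : mR * mR) : R := \1_B x.
have iG : intg G.
  apply: (@intg_bounded _ _ (ball_radius p rho) 1).
  - exact: measurable_indic.
  - by move=> x; rewrite /G indicE; case: (_ \in _); rewrite /= ?normr1 ?normr0.
  - move=> x nb; rewrite /G indicE memNset// => -[]; rewrite /I1 /I2 /= !in_itv/= => /andP[h1 h2] /andP[h3 h4].
    apply: nb; rewrite /ball_radius; split; rewrite ler_norml; apply/andP; split;
      have := ler_norm p.1; have := ler_norm (- p.1); have := ler_norm p.2; have := ler_norm (- p.2); rewrite !normrN;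
      have := normr_ge0 p.1; have := normr_ge0 p.2; lra.
apply: (@lt_le_trans _ _ (plane_int (fun x => c * G x))).
  rewrite (plane_intZ c iG) /plane_int /Rintegral /G integral_indic//; last first.
  by rewrite setIT [X in fine X]muB /= !mulr_gt0.
apply: le_Rintegral => //; first exact: intgZ.
move=> x _; rewrite /G indicE; have [|nb] := pselect (B x); last by rewrite memNset// mulr0 bump_ge0.
move=> bx; rewrite mem_set// mulr1; case: x bx => x1 x2 []; rewrite /I1 /I2 /= !in_itv/= => h1 h2.
have := Hrho x1 x2; rewrite !ltr_norml => /(_ _ _); rewrite /c => H.
have : - (ball_bump p d p / 2) < ball_bump p d p - ball_bump p d (x1, x2) < ball_bump p d p / 2.
  by apply: H; lra.
lra.
Qed.

End Concentration.

(** * Derivatives at a point of a convolution with a distribution *)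

Section DiracLimit.
Context {R : realType}.
Implicit Types (g h q phi psi : R * R -> R) (x y p : R * R) (d : R) (T : @functional R).


(** A cut-off makes g globally smooth without changing its germ at p; for the global function every
    word of derivatives reduces to some [pderiv a b]. *)
Lemma flat_extension (V : set (R * R)) g p : open V -> V p -> smooth_on V g ->
  (forall a b, pderiv a b g p = 0) ->
  exists G (d : R), [/\ 0 < d, smooth G, forall u, partials u G p = 0 &
    forall x, sqd p x <= d ^+ 2 -> V x /\ G x = g x].
Proof.
move=> oV Vp sg g0; have Vp' : V (p.1, p.2) by case: p Vp {g0}.
have [rho rho0 Hrho] := open2P oV Vp'.
pose b := (rho / 2) ^+ 2; pose a := b / 2.
have b0 : 0 < b by rewrite exprn_gt0// divr_gt0.
have ab : a < b by rewrite /a; lra.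
have a0 : 0 < a by rewrite /a; lra.
have BV x : sqd p x <= b -> V x.
  have r2 : 0 <= rho / 2 by lra.
  move=> h; have [h1 h2] := sqd_near r2 h.
  clear h; move: h1 h2.
  by case: x => x1 x2 /= h1 h2; apply: Hrho; rewrite distrC; lra.
pose G x := (1 - cutoff p a b x) * g x.
have sc : smooth (fun x => 1 - cutoff p a b x) := smooth_onB openT (smooth_on_cst 1 openT) (smooth_cutoff p ab).
have sG1 : smooth_on V G := smooth_onM oV (smooth_onS (@subsetT _ V) sc) sg.
have oW := @open_sqd_gt R p b.
have sG2 : smooth_on [set x | b < sqd p x] G.
  apply: (@smooth_on_eq _ _ (fun=> 0)) => //; last exact: smooth_on_cst.
  by move=> x /set_mem /= h; rewrite /G cutoff1 ?subrr ?mul0r// ltW.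
have sG : smooth G.
  have -> : smooth G = smooth_on (V `|` [set x | b < sqd p x]) G; last exact: smooth_onU.
  congr smooth_on; apply/seteqP; split => // x _.
  by have [/BV|h] := leP (sqd p x) b; [left|right].
have Gg x : sqd p x < a -> G x = g x.
  by move=> h; rewrite /G cutoff0 ?subr0 ?mul1r// ltW.
exists G, (Num.min 1 a / 2).
have m0 : 0 < Num.min 1 a by rewrite lt_min ltr01.
have m1 : Num.min 1 a <= 1 by rewrite ge_min lexx.
have ma : Num.min 1 a <= a by rewrite ge_min lexx orbT.
split => //.
- by rewrite divr_gt0.
- move=> u; rewrite (partials_pderiv u sG) -[RHS](g0 (count_mem 0 u) (count_mem 1 u)).
  apply: (@partials_eq_on R [set x | sqd p x < a] _ G g (@open_sqd_lt R p a)).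
    by move=> x /set_mem; exact: Gg.
  by apply/mem_set; rewrite /= /sqd !subrr expr0n addr0.
- move=> x h; have h' : sqd p x < a by rewrite (le_lt_trans h)//; nra.
  by split; [apply: BV; lra|exact: Gg].
Qed.

Lemma hom_pot2 r : (0 < r)%N -> hom (2 * r).-2.+2 (@pot R r).
Proof. by case: r => // r _; have := @hom_pot R r.+1; rewrite mulnS. Qed.

Variables (p0 : R * R) (s t : R).
Hypotheses (s0 : 0 < s) (st : s < t).

(** A smooth stand-in for [pot r], equal to it as soon as sqd 0 z > s / 8, the separation guaranteed
    by [sqd_away]. *)
Definition pot_ext r : R * R -> R := fun z => cutoff 0 (s / 16) (s / 8) z * pot r z.

Lemma extension_radii : s / 16 < s / 8.
Proof. move: s0; lra. Qed.

Lemma smooth_pot_ext r : smooth (pot_ext r).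
Proof.
have s16 : 0 < s / 16 by rewrite divr_gt0.
have c := cutoff_carried 0 extension_radii.
by have [] := carried_mul (@open_neq2 R 0) (@outer_neq R 0 _ s16) (@open_outerC R 0 _) c
  (hom_smooth (hom_pot r)).
Qed.

Lemma pot_extE r z : s / 8 < sqd 0 z -> pot_ext r z = pot r z.
Proof. by move=> h; rewrite /pot_ext cutoff1 ?mul1r ?extension_radii// ltW. Qed.

Lemma pot_ext_partials r u z : s / 8 < sqd 0 z -> partials u (pot_ext r) z = partials u (pot r) z.
Proof.
move=> h; apply: (@partials_eq_on R [set z | s / 8 < sqd 0 z] u _ _ (@open_sqd_gt R 0 _)).
  by move=> x /set_mem; exact: pot_extE.
exact/mem_set.
Qed.

(** From |y - p0|^2 <= 2 |x - y|^2 + 2 |x - p0|^2 follows |x - y|^2 >= s/2 - s/16 > s/8. *)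
Lemma sqd_away x y d : d ^+ 2 <= s / 16 -> sqd p0 x <= d ^+ 2 -> s <= sqd p0 y -> s / 8 < sqd 0 (x - y).
Proof.
move=> hd hx hy; rewrite sqd0E /=; move: hx hy; rewrite /sqd => hx hy.
have := sqr_ge0 (2 * (x.1 - p0.1) - (y.1 - p0.1)); have := sqr_ge0 (2 * (x.2 - p0.2) - (y.2 - p0.2)).
move: s0; nra.
Qed.

(** For such y the bump only meets the kernel away from its singularity. With [pot_ext r] in place
    of [pot r], any number of derivatives can be moved onto the kernel. *)
Lemma conv_pot_off r u d y : (0 < r)%N -> 0 < d -> d ^+ 2 <= s / 16 -> s <= sqd p0 y ->
  conv (pot r) (partials u (ball_bump p0 d)) y =
  (-1) ^+ size u * plane_int (fun x => partials u (pot_ext r) (x - y) * ball_bump p0 d x).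
Proof.
move=> r0 d0 ds ys; have ib := in_ball_bump p0 d; have sb := in_ball_supported (ltW d0) ib.
have sE := smooth_pot_ext r; have sS := smooth_shift y sE.
have M0 : 0 <= ball_radius p0 d by rewrite !addr_ge0// ltW.
transitivity (plane_int (fun x => pot_ext r (x - y) * partials u (ball_bump p0 d) x)).
  congr plane_int; apply/funext => x.
  have [h|h] := leP (sqd p0 x) (d ^+ 2); last by rewrite (in_ball_partials u ib).2// !mulr0.
  by rewrite pot_extE//; exact: sqd_away ds h ys.
rewrite (smooth_ibps u M0 sS sb) (partials_rev u sS); congr (_ * plane_int _).
by apply/funext => x; rewrite (partials_shift u y sE).
Qed.

(* The hypothesis on [T] is tested on the derivatives of bumps concentrating at [p0]: away from
   [p0] the convolutions tend to the derivatives of the kernel, while the flatness of [g] makes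
   the right-hand side negligible. *)
Theorem dirac_limit T r (V : set (R * R)) g (c : R) w : (0 < r)%N -> cs T ->
  (forall phi, smooth phi -> (forall y, t <= sqd p0 y -> phi y = 0) -> T phi = 0) ->
  open V -> V p0 -> smooth_on V g -> (forall a b, pderiv a b g p0 = 0) -> c != 0 ->
  (forall phi, test_fun V phi ->
     c * T (partials w (conv (pot r) phi)) = plane_int (fun x => g x * phi x)) ->
  forall v, T (ext p0 s t (partials (w ++ v) (pot r))) = 0.
Proof.
move=> r0 cT Tloc oV Vp sg g0 c0 HT v.
have [G [d1 [d10 sG G0 HG]]] := flat_extension oV Vp sg g0.
have sE := smooth_pot_ext r.
pose h1 := partials (w ++ v) (pot_ext r); have sh1 : smooth h1 := smooth_partials _ sE.
pose psi y := h1 (p0 - y); have sps : smooth psi := smooth_refl p0 sh1.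
have sx : smooth (ext p0 s t (partials (w ++ v) (pot r))).
  exact: (smooth_ext p0 s0 st (smooth_on_partials _ (hom_smooth (hom_pot r)))).
have -> : T (ext p0 s t (partials (w ++ v) (pot r))) = T psi.
  apply/eqP; rewrite -subr_eq0 -(csTB cT sx sps); apply/eqP; apply: Tloc.
    exact: (smooth_onB openT sx sps).
  move=> y ty; rewrite /ext cutoff1// mul1r /psi /h1 pot_ext_partials ?subrr//.
  by rewrite sqd0_sub; move: s0 st; lra.
have [_ [M [n [CT [M0 CT0 HCT]]]]] := cT.
have id1 := smooth_on_fst (@openT (R * R)%type); have id2 := smooth_on_snd (@openT (R * R)%type).
have cc := cutoff_carried p0 st.
have [Cp [Cp0 HCp]] := pcomp_bounded openT (@subsetT _ _) (@open_outerC R p0 s) id1 id2 n M cc.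
have [L2 [L20 HL2]] := smooth_bounded_on n.+1 (M + `|p0.1| + `|p0.2| + 1) sh1.
have [L1 [L10 HL1]] := smooth_bounded_on 1 (ball_radius p0 1) (smooth_partials (rev v) sG).
pose K := `|c| * (CT * (Cp * (L2 * 2))) + L1 * 2.
have main d : 0 < d -> d <= 1 -> d <= d1 -> d ^+ 2 <= s / 16 -> `|c| * `|T psi| <= K * d.
  move=> d0 dl1 dd1 ds; pose m := plane_int (ball_bump p0 d).
  have m0 : 0 < m := int_bump_gt0 p0 d0.
  have ib := in_ball_bump p0 d; have sb := in_ball_supported (ltW d0) ib.
  have B0 : 0 <= ball_radius p0 d by rewrite !addr_ge0// ltW.
  have hp := hom_pot2 r0.
  pose Phi := conv (pot r) (partials (w ++ v) (ball_bump p0 d)).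
  have sPhi : smooth Phi := conv_smooth B0 hp (supported_partials (w ++ v) sb).
  have PhiE : Phi = partials w (conv (pot r) (partials v (ball_bump p0 d))).
    by rewrite (conv_partials w B0 hp (supported_partials v sb)) -partials_cat.
  have tv : test_fun V (partials v (ball_bump p0 d)).
    apply: (in_ball_test (ltW d0) (in_ball_partials v ib)) => x hx.
    by apply: (HG x _).1; apply: (le_trans hx); nra.
  (* The derivatives v move onto the extension G of g; the resulting derivative of G vanishes at p0
     and is Lipschitz, hence O(d) on the support of the bump. *)
  have est1 : `|c * T Phi| <= L1 * (2 * d) * m.
    rewrite PhiE (HT _ tv).
    have -> : plane_int (fun x => g x * partials v (ball_bump p0 d) x) =
        plane_int (fun x => G x * partials v (ball_bump p0 d) x).
      congr plane_int; apply/funext => x; have [h|h] := leP (sqd p0 x) (d ^+ 2).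
        by rewrite (HG x _).2//; apply: (le_trans h); nra.
      by rewrite (in_ball_partials v ib).2// !mulr0.
    rewrite (smooth_ibps v B0 sG sb) normrM normrX normrN1 expr1n mul1r.
    apply: (int_bump_le (ltW d0) (smooth_cont (smooth_partials _ sG))) => x hx.
    have hx1 : sqd p0 x <= 1 ^+ 2 by rewrite expr1n; apply: (le_trans hx); nra.
    have hp1 : sqd p0 p0 <= 1 ^+ 2 by rewrite /sqd !subrr expr0n addr0 expr1n.
    have sk := smooth_partials (rev v) sG.
    have lip := box_lipschitz (fun i x _ => @smooth_on_derive R setT i _ x sk I)
      (fun i x bx => HL1 [:: i] isT x bx) (sqd_box ler01 hx1) (sqd_box ler01 hp1).
    rewrite G0 subr0 in lip; apply: (le_trans lip); apply: ler_wpM2l => //.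
    have [h2 h3] := sqd_near (ltW d0) hx; lra.
  pose ep : R := (-1) ^+ size (w ++ v).
  (* The error made in replacing the convolution by m times the kernel centred at p0; the sign [ep]
     stems from the integrations by parts. *)
  pose D x := Phi x + (- (ep * m)) * psi x.
  have sD : smooth D := smoothD sPhi (smoothZ _ sps).
  have TD : T D = T Phi - ep * m * T psi.
    by rewrite (csTD cT sPhi (smoothZ _ sps)) (csTZ _ cT sps) mulNr.
  pose chi := cutoff p0 s t; have sk : smooth chi := smooth_cutoff p0 st.
  have scD : smooth (fun x => chi x * D x) := smoothM sk sD.
  (* T only sees values where sqd p0 >= t, so D may be cut off to the region where the kernel is
     smooth; this spares any estimate of Phi near p0. *)
  have TchiD : T D = T (fun x => chi x * D x).
    apply/eqP; rewrite -subr_eq0 -(csTB cT sD scD); apply/eqP; apply: Tloc.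
      exact: (smooth_onB openT sD scD).
    by move=> y ty; rewrite /chi cutoff1// mul1r subrr.
  (* On this region a derivative of D is, up to sign, the integral of k(x - y) - k(p0 - y) against
     the bump, with k a derivative of the smooth kernel [h1]; a Lipschitz bound for k produces the
     factor 2 d. *)
  have Dsmall : bounded_on (outer p0 s `&` box M) n (L2 * (2 * d) * m) D.
    move=> u un y [yo yM].
    rewrite (partialsD u sPhi (smoothZ _ sps)) (partialsZ u _ sps) (partials_refl u p0 sh1).
    rewrite (conv_partials u B0 hp (supported_partials (w ++ v) sb)) -partials_cat.
    rewrite (conv_pot_off (u ++ (w ++ v)) r0 d0 ds yo) partials_cat -/h1.
    set k := partials u h1; have skk : smooth k := smooth_partials u sh1.
    have i1 := intg_supported (smooth_cont (smooth_shift y skk)) sb.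
    have i2 := intg_bump p0 (ltW d0).
    have -> : (-1) ^+ size (u ++ (w ++ v)) * plane_int (fun x => k (x - y) * ball_bump p0 d x) +
        (- (ep * m)) * ((-1) ^+ size u * k (p0 - y)) =
        (-1) ^+ size (u ++ (w ++ v)) *
          plane_int (fun x => (k (x - y) - k (p0 - y)) * ball_bump p0 d x).
      have -> : (fun x => (k (x - y) - k (p0 - y)) * ball_bump p0 d x) =
          (fun x => k (x - y) * ball_bump p0 d x + (- k (p0 - y)) * ball_bump p0 d x).
        by apply/funext => x; rewrite mulrBl mulNr.
      rewrite (plane_intD i1 (intgZ _ i2)) (plane_intZ _ i2) size_cat exprD -/ep -/m; ring.
    rewrite normrM normrX normrN1 expr1n mul1r.
    have sq2 : smooth (fun x => k (x - y) - k (p0 - y)).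
      exact: (smooth_onB openT (smooth_shift y skk) (smooth_on_cst _ openT)).
    apply: (int_bump_le (ltW d0) (smooth_cont sq2)) => x hx.
    have [h2 h3] := sqd_near (ltW d0) hx.
    have bx z : `|z.1 - p0.1| <= 1 -> `|z.2 - p0.2| <= 1 -> box (M + `|p0.1| + `|p0.2| + 1) (z - y).
      case: yM => y1 y2 z1 z2.
      have e1 : (z - y).1 = (z.1 - p0.1) + (p0.1 - y.1) by rewrite /=; ring.
      have e2 : (z - y).2 = (z.2 - p0.2) + (p0.2 - y.2) by rewrite /=; ring.
      have := normr_ge0 p0.1; have := normr_ge0 p0.2 => q2 q1.
      split; rewrite ?e1 ?e2; apply: (le_trans (ler_normD _ _)).
        have := ler_normB p0.1 y.1; lra.
      have := ler_normB p0.2 y.2; lra.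
    have b1 : box (M + `|p0.1| + `|p0.2| + 1) (x - y) by apply: bx; lra.
    have b2 : box (M + `|p0.1| + `|p0.2| + 1) (p0 - y) by apply: bx; rewrite subrr normr0.
    have lip := box_lipschitz (fun i x _ => @smooth_on_derive R setT i k x skk I)
      (fun i x bx => HL2 (i :: u) un x bx) b1 b2.
    apply: (le_trans lip); apply: ler_wpM2l => //=.
    have e (a b e : R) : a - e - (b - e) = a - b by ring.
    by rewrite !e; lra.
  have est2 : `|T D| <= CT * (Cp * (L2 * (2 * d) * m)).
    rewrite TchiD; apply: HCT => //.
    have := HCp D (L2 * (2 * d) * m) (outer p0 s `&` box M) sD.
    (* Multiplication by chi is a weighted pullback by the identity map, so [pcomp_bounded] serves
       as the Leibniz estimate. *)
    have eqp : pcomp fst snd chi D = (fun x => chi x * D x) by apply/funext => -[].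
    rewrite eqp; apply.
    - by rewrite !mulr_ge0// ltW.
    - by case=> x1 x2 /= ox bx; split.
    - exact: Dsmall.
  have ep1 : `|ep| = 1 by rewrite normrX normrN1 expr1n.
  have e : `|c| * `|T psi| * m = `|c * T Phi - c * T D|.
    rewrite TD; have -> : c * T Phi - c * (T Phi - ep * m * T psi) = c * ep * m * T psi by ring.
    by rewrite !normrM ep1 mulr1 (gtr0_norm m0); ring.
  rewrite -(ler_pM2r m0) e (le_trans (ler_normB _ _))//.
  have h4 : `|c| * `|T D| <= `|c| * (CT * (Cp * (L2 * (2 * d) * m))) by apply: ler_wpM2l.
  have -> : K * d * m = L1 * (2 * d) * m + `|c| * (CT * (Cp * (L2 * (2 * d) * m))) by rewrite /K; ring.
  by apply: lerD; [exact: est1|rewrite normrM; exact: h4].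
have K0 : 0 <= K by rewrite addr_ge0// !mulr_ge0.
have K1 : 0 < K + 1 by lra.
apply/eqP; rewrite -normr_eq0 -(mulrI_eq0 _ (lregP (_ : `|c| != 0))) ?normr_eq0//.
apply/eqP/le_anti/andP; split; last by rewrite mulr_ge0.
apply/ler_addgt0Pl => eps e0; rewrite addr0.
(* Since d <= 1, the entry s / 16 also bounds d^2; the last entry gives K d <= eps. *)
pose d := Num.min (Num.min 1 d1) (Num.min (s / 16) (eps / (K + 1))).
have d0 : 0 < d by rewrite !lt_min ltr01 d10 !divr_gt0.
have dl1 : d <= 1 by rewrite !ge_min lexx.
have dld : d <= d1 by rewrite !ge_min lexx orbT.
have dls : d <= s / 16 by rewrite !ge_min lexx !orbT.
have dle : d <= eps / (K + 1) by rewrite !ge_min lexx !orbT.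
apply: (le_trans (main d d0 dl1 dld _)); first by nra.
apply: (@le_trans _ _ ((K + 1) * d)); first by apply: ler_wpM2r; lra.
by rewrite mulrC -ler_pdivlMr.
Qed.

End DiracLimit.

(** * Solving the scalar relation between the antidiagonal sums *)

Section Peeling.
Context {R : realType}.
Implicit Types (h phi psi : R * R -> R) (x : R * R).

Notation e_ := (@basis2 R).

Lemma smooth_op0 A : @smooth_op R A -> A (fun=> 0) = fun=> 0.
Proof.
move=> [_ lA _]; have s0 : smooth (fun=> 0 : R) := smooth_on_cst 0 openT.
have := lA (-1) _ _ s0 s0.
have -> : (fun x : R * R => -1 * 0 + 0 : R) = fun=> 0 by apply/funext => x; rewrite mulr0 addr0.
by move=> e; rewrite [LHS]e; apply/funext => x; rewrite mulN1r addNr.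
Qed.

Lemma pderiv_succ0 a b psi : smooth psi -> pderiv a.+1 b psi = pderiv a b (partial 0 psi).
Proof.
move=> sp; rewrite /pderiv -partials_rcons !(partials_pderiv _ sp).
have /seq.permP pc : perm_eq (rcons (nseq a (0 : 'I_2) ++ nseq b 1) 0) (nseq a.+1 0 ++ nseq b 1).
  by rewrite perm_rcons.
by rewrite !pc.
Qed.

(* V 0 is -G 0 composed with the primitive in x.1: the defect is G 0 on functions of x.2 alone,
   which are derivatives of order r in x.2, hence it vanishes. *)
Theorem peel r (G : nat -> functional) : (forall c, cs (G c)) ->
  (forall psi, smooth psi -> \sum_(c < r.+1) (-1) ^+ c * G c (pderiv c (r - c) psi) = 0) ->
  exists V : nat -> functional, [/\ forall c, cs (V c), forall c phi, (r <= c)%N -> V c phi = 0 &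
    forall c phi, (c <= r)%N -> smooth phi ->
      G c phi = dpartial 0 (V c) phi + (if c is c'.+1 then dpartial 1 (V c') phi else 0)].
Proof.
elim: r G => [|r IH] G cG WG.
  exists (fun _ _ => 0); split => // [c|c phi]; first exact: cs0.
  rewrite leqn0 => /eqP -> sp; have := WG phi sp.
  by rewrite big_ord_recl big_ord0 expr0 mul1r addr0 /dpartial oppr0 addr0.
pose v0 : functional := fun phi => - G 0%N (prim0 0 phi).
have cv0 : cs v0 by apply: csN; exact: (cs_op (cG 0%N) (op_prim0 0)).
have G0vert phi : smooth phi -> G 0%N (fun x => phi (0, x.2)) = 0.
  move=> sp; pose h x := phi (0, x.2).
  have sh : smooth h.
    exact: (smooth_on_comp openT openT sp (smooth_on_cst 0 openT) (smooth_on_snd openT) (fun _ _ => I)).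
  have h0 : partial 0 h = fun=> 0.
    apply/funext => -[a b].
    have D : is_derive (a, b) (e_ 0) h 0 by apply/slice1; exact: (is_derive_cst (phi (0, b))).
    by have [_] := D.
  (* Testing the relation on an (r+1)-fold primitive of h in x.2 isolates the term c = 0: for c > 0
     a derivative in x.1 falls on a function of x.2 alone. *)
  pose H := iter r.+1 (prim1 0) h; have sH : smooth H := iter_prim1_smooth 0 r.+1 sh.
  have := WG H sH; rewrite big_ord_recl expr0 mul1r big1 => [|c _].
    have e : pderiv (@ord0 r.+1) (r.+1 - @ord0 r.+1) H = h.
      by rewrite pderivE subn0 (iter_partial_prim1 0 sh (leqnn r.+1)) subnn.
    by rewrite e addr0.
  rewrite /= /bump /= add1n pderivE iterSr (iter_partial_prim1 0 sh (leq_subr c.+1 r.+1)).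
  have := partial0_iter_prim1 0 1 (r.+1 - (r.+1 - c.+1)) sh; rewrite /= => ->.
  rewrite h0 (smooth_op0 (op_iter _ (op_prim1 0))).
  have -> : iter c (partial 0) (fun=> 0) = fun=> 0 :> R.
    elim: (nat_of_ord c) => //= n ->; apply/funext => x.
    by have [_] := is_derive_cst (0 : R) x (e_ 0).
  by rewrite (csT0 (cG _)) mulr0.
have G0E phi : smooth phi -> G 0%N phi = dpartial 0 v0 phi.
  move=> sp; rewrite /dpartial /v0 opprK (prim0_K 0 sp).
  have sh : smooth (fun x => phi (0, x.2)).
    exact: (smooth_on_comp openT openT sp (smooth_on_cst 0 openT) (smooth_on_snd openT) (fun _ _ => I)).
  by rewrite (csTB (cG 0%N) sp sh) (G0vert _ sp) subr0.
(* With [G 0] expressed through [v0], the share of [v0] in [G 1] is subtracted. The relation of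
   order r for [G'] at psi is, up to sign, that of order r + 1 for [G] at a primitive of psi in
   x.1. *)
pose G' c : functional := if c is 0%N then fun phi => G 1%N phi - dpartial 1 v0 phi else G c.+1.
have cG' c : cs (G' c).
  case: c => [|c]; last exact: cG.
  by apply: csD; [exact: cG|apply: csN; exact: cs_dpartial].
have WG' psi : smooth psi -> \sum_(c < r.+1) (-1) ^+ c * G' c (pderiv c (r - c) psi) = 0.
  move=> ss; pose xi := prim0 0 psi; have sx : smooth xi := prim0_smooth 0 ss.
  have e : psi = partial 0 xi by rewrite /xi (prim0_partial0 0 ss).
  apply/eqP; rewrite -oppr_eq0; apply/eqP; rewrite -[RHS](WG xi sx) [RHS]big_ord_recl.
  have sxp : smooth (pderiv 0 r.+1 xi) := smooth_partials _ sx.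
  have -> : (-1) ^+ @ord0 r.+1 * G (@ord0 r.+1) (pderiv (@ord0 r.+1) (r.+1 - @ord0 r.+1) xi) =
      dpartial 0 v0 (pderiv 0 r.+1 xi) by rewrite -(G0E _ sxp) expr0 mul1r subn0.
  rewrite [in LHS]big_ord_recl [in RHS]big_ord_recl.
  have -> : (-1) ^+ @ord0 r * G' (@ord0 r) (pderiv (@ord0 r) (r - @ord0 r) psi) =
      G 1%N (pderiv 0 r psi) - dpartial 1 v0 (pderiv 0 r psi) by rewrite expr0 mul1r subn0.
  have -> : (-1) ^+ lift ord0 (@ord0 r) * G (lift ord0 (@ord0 r)) (pderiv (lift ord0 (@ord0 r)) (r.+1 - lift ord0 (@ord0 r)) xi) = - G 1%N (pderiv 1 r xi).
    by rewrite /= /bump /= addn0 expr1 mulN1r subSS subn0.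
  rewrite (pderiv_succ0 0 r sx) -e opprD opprB.
  have -> : dpartial 1 v0 (pderiv 0 r psi) = - v0 (pderiv 0 r.+1 psi) by rewrite /dpartial.
  have -> : dpartial 0 v0 (pderiv 0 r.+1 xi) = - v0 (pderiv 0 r.+1 psi).
    rewrite /dpartial; congr (- v0 _).
    by rewrite e -(pderiv_succ0 0 r.+1 sx).
  rewrite -addrA; congr (_ + (_ + _)).
  rewrite -sumrN; apply: eq_bigr => c _; rewrite /= /bump /= !add1n subSS [in LHS]exprS mulN1r mulNr opprK.
  rewrite (pderiv_succ0 c.+1 (r - c.+1) sx) -e !exprS; ring.
have [V' [cV' V'0 HV']] := IH G' cG' WG'.
exists (fun c => if c is c'.+1 then V' c' else v0); split.
- by case.
- by case=> // c phi; exact: V'0.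
- case=> [phi _ sp|[|c] phi cr sp]; first by rewrite addr0 G0E.
    have := HV' 0%N phi isT sp; rewrite /= addr0 => <-.
    by rewrite subrK.
  exact: (HV' c.+1 phi cr sp).
Qed.

End Peeling.

(** * Multi-indices and their permutations *)

Section TupleIndices.

Notation tup k := (k.-tuple 'I_2).

Lemma word2_perm (s s' : seq 'I_2) : count_mem 0%R s = count_mem 0%R s' ->
  count_mem 1%R s = count_mem 1%R s' -> perm_eq s s'.
Proof. by move=> h0 h1; apply/allP => x _ /=; apply/eqP; move: x; apply: I2_ind. Qed.

Lemma perm_idx_perm k (s : 'S_k) (i : tup k) : perm_eq (perm_idx s i) i.
Proof. by apply/tuple_permP; exists s. Qed.

Lemma count2_perm k (s : 'S_k) (i : tup k) : count2 (perm_idx s i) = count2 i.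
Proof. by have /seq.permP := perm_idx_perm s i; apply. Qed.

Lemma count1_perm k (s : 'S_k) (i : tup k) : count1 (perm_idx s i) = count1 i.
Proof. by have /seq.permP := perm_idx_perm s i; apply. Qed.

Lemma count12 k (i : tup k) : (count1 i + count2 i = k)%N.
Proof. by rewrite /count1 /count2 word2_size size_tuple. Qed.

Lemma count2_le k (i : tup k) : (count2 i <= k)%N.
Proof. by have := count12 i; lia. Qed.

Lemma count1_le k (i : tup k) : (count1 i <= k)%N.
Proof. by have := count12 i; lia. Qed.

(** With two letters, the number of 2's fixes the word up to order; components of a symmetric tensor
    therefore depend on counts only. *)
Lemma count2_orbit k (i i' : tup k) : count2 i = count2 i' -> exists s, i = perm_idx s i'.
Proof.
move=> h; have h1 : count1 i = count1 i' by have := count12 i; have := count12 i'; lia.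
have /tuple_permP[s e] : perm_eq i i' by exact: word2_perm.
by exists s; apply: val_inj.
Qed.

Lemma perm_idxM k (s s' : 'S_k) (i : tup k) : perm_idx s (perm_idx s' i) = perm_idx (s * s')%g i.
Proof. by apply: eq_from_tnth => p; rewrite !tnth_mktuple permM. Qed.

Lemma perm_idx1 k (i : tup k) : perm_idx 1 i = i.
Proof. by apply: eq_from_tnth => p; rewrite tnth_mktuple perm1. Qed.

Lemma perm_idx_bij k (s : 'S_k) : bijective (@perm_idx k s).
Proof.
exists (perm_idx (s^-1)%g) => i; rewrite perm_idxM ?mulVg ?mulgV; exact: perm_idx1.
Qed.

Lemma sum_tuple_cons (V : nmodType) k (F : tup k.+1 -> V) :
  \sum_(m : tup k.+1) F m = \sum_(m : tup k) (F [tuple of 0%R :: m] + F [tuple of 1%R :: m]).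
Proof.
rewrite (reindex (fun p : 'I_2 * tup k => [tuple of p.1 :: p.2])) /=; last first.
  exists (fun m : tup k.+1 => (thead m, [tuple of behead m])) => [[a m] _|m _] /=.
    by rewrite theadE; congr pair; apply: val_inj.
  by rewrite [RHS](tuple_eta m); apply: val_inj.
rewrite -(pair_bigA _ (fun (a : 'I_2) (m : tup k) => F [tuple of a :: m])) /= exchange_big /=.
apply: eq_bigr => m _; rewrite !big_ord_recl big_ord0 addr0.
by congr (F _ + F _); apply: val_inj => /=; congr cons; apply: val_inj.
Qed.

Lemma card_count (x : 'I_2) k a : (\sum_(i : tup k | count_mem x i == a) 1 = 'C(k, a))%N.
Proof.
rewrite big_mkcond /=; elim: k a => [|k IH] a.
  rewrite (big_pred1 [tuple]) => [|i]; first by rewrite /= bin0n eq_sym; case: (a == 0%N).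
  by apply/esym/eqP; exact: tuple0.
rewrite (@sum_tuple_cons nat).
have H : (\sum_(m : tup k) ((if count_mem x m == a then 1 else 0)
    + (if (count_mem x m).+1 == a then 1 else 0)) = 'C(k.+1, a))%N.
  rewrite big_split /= IH; case: a => [|a]; last by rewrite binS; congr addn; exact: IH.
  by rewrite !bin0 big1// => m _.
rewrite -[RHS]H; apply: eq_bigr => m _; move: x {IH H}; apply: I2_ind => /=.
  by rewrite addrC.
by [].
Qed.

Lemma count2_behead k (i : tup k.+1) : count2 (behead_tuple i) = (count2 i - (head 0%R i == 1%R))%N.
Proof. by case/tupleP: i => a m; rewrite /count2 /= addKn. Qed.

Lemma count1_behead k (i : tup k.+1) : count1 (behead_tuple i) = (count1 i - (head 0%R i == 0%R))%N.
Proof. by case/tupleP: i => a m; rewrite /count1 /= addKn. Qed.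

End TupleIndices.

(** * Averages over permutations *)

Section Symmetrize.
Context {R : realType}.
Notation tup k := (k.-tuple 'I_2).

Lemma eq_symmetrize k (F F' : tup k -> R) i : (forall s, F (perm_idx s i) = F' (perm_idx s i)) ->
  symmetrize F i = symmetrize F' i.
Proof. by move=> h; congr (_ * _); apply: eq_bigr => s _; exact: h. Qed.

Lemma fact_neq0 k : (k`!%:R : R) != 0.
Proof. by rewrite pnatr_eq0 -lt0n fact_gt0. Qed.

Lemma sum_symmetrize k (F : tup k -> R) : \sum_m symmetrize F m = \sum_m F m.
Proof.
rewrite /symmetrize -mulr_sumr exchange_big /=.
have e (s : 'S_k) : \sum_m F (perm_idx s m) = \sum_m F m.
  by rewrite [RHS](reindex (@perm_idx k s))//; apply: onW_bij; exact: perm_idx_bij.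
under eq_bigr => s _ do rewrite e.
by rewrite sumr_const card_Sn -[X in _ * X]mulr_natl mulKf// fact_neq0.
Qed.

Lemma symmetrize_mull k (a : nat -> R) (F : tup k -> R) m :
  a (count2 m) * symmetrize F m = symmetrize (fun i => a (count2 i) * F i) m.
Proof.
rewrite /symmetrize mulrCA; congr (_ * _); rewrite mulr_sumr; apply: eq_bigr => s _.
by rewrite count2_perm.
Qed.

(** Composition with a transposition shows that every position is equally likely to come first, so
    the average is the mean of K over the entries. *)
Lemma symmetrize_head k (K : 'I_2 -> R) (i : tup k.+1) :
  symmetrize (fun i' => K (head 0 i')) i =
  ((count1 i)%:R * K 0 + (count2 i)%:R * K 1) / k.+1%:R.
Proof.
pose Z (q : 'I_k.+1) := \sum_(s : 'S_k.+1) K (tnth i (s q)).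
have ZE q : Z q = Z ord0.
  rewrite /Z (reindex_inj (mulgI (tperm ord0 q))) /=; apply: eq_bigr => s _.
  by rewrite permM tpermR.
have e0 : k.+1%:R * Z ord0 = k.+1`!%:R * \sum_p K (tnth i p).
  have <- : \sum_q Z q = k.+1%:R * Z ord0.
    by under eq_bigr => q _ do rewrite ZE; rewrite sumr_const card_ord mulr_natl.
  rewrite exchange_big /=; have e (s : 'S_k.+1) : \sum_p K (tnth i (s p)) = \sum_p K (tnth i p).
    by rewrite [RHS](reindex_inj (@perm_inj _ s)).
  under eq_bigr => s _ do rewrite e.
  by rewrite sumr_const card_Sn mulr_natl.
have e1 : \sum_p K (tnth i p) = (count1 i)%:R * K 0 + (count2 i)%:R * K 1.
  rewrite -(big_tuple _ _ _ xpredT) /= /count1 /count2; elim: (tval i) => [|x s IH].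
    by rewrite big_nil /= !mul0r addr0.
  rewrite big_cons IH /= !natrD; move: x; apply: I2_ind => /=; ring.
rewrite /symmetrize -e1.
have -> : \sum_s K (head 0 (perm_idx s i)) = Z ord0.
  apply: eq_bigr => s _; congr K.
  by rewrite -[head _ _]/(nth 0 (perm_idx s i) (ord0 : 'I_k.+1)) -tnth_nth tnth_mktuple.
have k0 : k.+1%:R != 0 :> R by rewrite pnatr_eq0.
apply: (mulfI k0); rewrite mulrCA e0 mulKf ?fact_neq0//.
by rewrite mulrCA mulfV// mulr1.
Qed.

End Symmetrize.

(** * Symmetric tensors as arrays indexed by two counts *)

Section TensorComponents.
Context {R : realType}.
Notation tup k := (k.-tuple 'I_2).
Implicit Types (phi psi : R * R -> R) (E : nat -> nat -> @functional R).

Lemma bin_neq0 n m : (m <= n)%N -> ('C(n, m)%:R : R) != 0.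
Proof. by move=> h; rewrite pnatr_eq0 -lt0n bin_gt0. Qed.

(** Together with [invbin_diag], turns the proportions of 1's and 2's produced by [symmetrize_head]
    into the change of binomial weight from k to k + 1. *)
Lemma invbin_down k a : (a <= k)%N ->
  (k.+1 - a)%:R / k.+1%:R * 'C(k, a)%:R^-1 = ('C(k.+1, a)%:R)^-1 :> R.
Proof.
move=> ak; have n0 := bin_neq0 ak; have n1 := bin_neq0 (leqW ak).
have k0 : k.+1%:R != 0 :> R by rewrite pnatr_eq0.
have e : k.+1%:R * 'C(k, a)%:R = (k.+1 - a)%:R * 'C(k.+1, a)%:R :> R.
  by rewrite -!natrM (mul_bin_down k.+1 a).
apply: (mulIf n1); apply: (mulfI n0); apply: (mulfI k0).
rewrite mulVf// mulr1 e; field.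
by rewrite n0 nat1r k0.
Qed.

Lemma invbin_diag k a : (a <= k)%N ->
  a.+1%:R / k.+1%:R * 'C(k, a)%:R^-1 = ('C(k.+1, a.+1)%:R)^-1 :> R.
Proof.
move=> ak; have n0 := bin_neq0 ak; have n1 := @bin_neq0 k.+1 a.+1 ak.
have k0 : k.+1%:R != 0 :> R by rewrite pnatr_eq0.
have e : k.+1%:R * 'C(k, a)%:R = a.+1%:R * 'C(k.+1, a.+1)%:R :> R.
  by rewrite -!natrM (mul_bin_diag k.+1 a).
apply: (mulIf n1); apply: (mulfI n0); apply: (mulfI k0).
rewrite mulVf// mulr1 e; field.
by rewrite n0 nat1r k0.
Qed.

(* A symmetric tensor is a function of a = number of 2's in i and b = number of 1's in j. With
   the normalization [ten], d' and lambda become mere shifts of (a, b), see [ten_dprime] and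
   [ten_lambda]. *)
Definition weight k l a b : R := (-1) ^+ b / ('C(k, a)%:R * 'C(l, b)%:R).

Definition ten k l E : tensor R k l :=
  fun i j phi => E (count2 i) (count1 j) phi * weight k l (count2 i) (count1 j).

Lemma ten_cs k l E : (forall a b, cs (E a b)) -> cs_sym_tensor (@ten k l E).
Proof.
move=> cE; split=> [i j|s t i j phi _]; last by rewrite /ten count2_perm count1_perm.
by apply/csP; have := csZ (weight k l (count2 i) (count1 j)) (cE (count2 i) (count1 j));
  under eq_fun do rewrite mulrC.
Qed.

(** Symmetrization differentiates along 1 with proportion (k + 1 - a) / (k + 1) and along 2 with
    proportion a / (k + 1); the binomial weights absorb both. At a = k + 1 the first proportion is
    0, matched on the right by the vanishing of [E k.+1]. *)
Lemma ten_dprime k l E (i : tup k.+1) (j : tup l) phi : (forall b psi, E k.+1 b psi = 0) ->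
  @dprime R k.+1 l (ten E) i j phi = ten (fun a b phi => - E a b (partial 0 phi) -
    (if a is a'.+1 then E a' b (partial 1 phi) else 0)) i j phi.
Proof.
move=> E0; rewrite /dprime.
pose K (x : 'I_2) := - (E (count2 i - (x == 1%R))%N (count1 j) (partial x phi) *
  weight k l (count2 i - (x == 1%R))%N (count1 j)).
rewrite (@eq_symmetrize _ _ _ (fun i' => K (head 0 i'))); last first.
  by move=> s; rewrite /dpartial /ten count2_behead count2_perm.
rewrite symmetrize_head /K /= subn0 subn1 /ten.
have -> : count1 i = (k.+1 - count2 i)%N by have := count12 i; lia.
have := count2_le i; move: (count2 i) (count1 j) => a b ak; rewrite /weight.
rewrite mulrDl ![_ * _ / k.+1%:R]mulrAC !mulrN.
have h1 : (k.+1 - a)%:R / k.+1%:R * (E a b (partial 0 phi) * ((-1) ^+ b / ('C(k, a)%:R * 'C(l, b)%:R))) =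
    E a b (partial 0 phi) * ((-1) ^+ b / ('C(k.+1, a)%:R * 'C(l, b)%:R)) :> R.
  move: ak; rewrite leq_eqVlt => /orP[/eqP ->|ak]; first by rewrite E0 !mul0r mulr0.
  by rewrite !invfM -(invbin_down (ltnSE ak)); ring.
rewrite h1 mulrBl mulNr; congr (_ - _); case: a ak {h1} => [|a] ak; first by rewrite !mul0r.
by rewrite !invfM -(invbin_diag (ltnSE ak)) /=; ring.
Qed.

(** The Kronecker delta retains the first indices 1, 1, which lowers b, or 2, 2, which lowers a. The
    sign (-1)^b in [weight] makes the two contributions opposite: along an antidiagonal, lambda is a
    discrete difference. *)
Lemma ten_lambda k l E (i : tup k.+1) (j : tup l.+1) phi :
  @lambda R k.+1 l.+1 (ten E) i j phi = ten (fun a b phi =>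
    (if (a <= k)%N then (if b is b'.+1 then - E a b' phi else 0) else 0) +
    (if a is a'.+1 then (if (b <= l)%N then E a' b phi else 0) else 0)) i j phi.
Proof.
rewrite /lambda; pose W a b := E a b phi * weight k l a b.
pose K (x : 'I_2) := ((count1 j)%:R * ((x == 0%R)%:R * W (count2 i - (x == 1%R))%N (count1 j).-1) +
  (count2 j)%:R * ((x == 1%R)%:R * W (count2 i - (x == 1%R))%N (count1 j))) / l.+1%:R.
rewrite (@eq_symmetrize _ _ _ (fun i' => K (head 0 i'))); last first.
  move=> s; set x := head 0 _.
  pose K' (y : 'I_2) := (x == y)%:R * W (count2 i - (x == 1%R))%N (count1 j - (y == 0%R))%N.
  rewrite (@eq_symmetrize _ _ _ (fun j' => K' (head 0 j'))); last first.
    by move=> t; rewrite /K' /W /ten count2_behead count2_perm count1_behead count1_perm.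
  by rewrite symmetrize_head /K' /K /= subn0 subn1.
rewrite symmetrize_head /K /= subn0 subn1 /ten.
have -> : count1 i = (k.+1 - count2 i)%N by have := count12 i; lia.
have -> : count2 j = (l.+1 - count1 j)%N by have := count12 j; lia.
have := count2_le i; have := count1_le j; move: (count2 i) (count1 j) => a b bl ak.
rewrite !mul1r !mul0r !mulr0 addr0 add0r mulrDl [RHS]mulrDl; congr (_ + _).
  case: b bl => [|b] bl; first by rewrite !mul0r !mulr0 !mul0r; case: ifP; rewrite mul0r.
  case: leqP => ak'; last first.
    have -> : (k.+1 - a = 0)%N by lia.
    by rewrite !mul0r.
  by rewrite /W /weight /= !invfM -(invbin_down ak') -(invbin_diag (ltnSE bl)) exprS; ring.
case: a ak => [|a] ak; first by rewrite !mul0r.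
case: leqP => bl'; last first.
  have -> : (l.+1 - b = 0)%N by lia.
  by rewrite !mul0r mulr0 !mul0r.
by rewrite /W /weight /= !invfM -(invbin_diag (ltnSE ak)) -(invbin_down bl'); ring.
Qed.

Section Components.
Variables (k l : nat) (f : tensor R k l).

(** Inverse to [ten] on symmetric tensors: the sum over an orbit of indices multiplies by its
    cardinality, a product of binomials, which [weight] divides out. *)
Definition fhat a b : @functional R := fun phi =>
  (-1) ^+ b * \sum_(i : tup k | count2 i == a) \sum_(j : tup l | count1 j == b) f i j phi.

Lemma fhat0 a b phi : (k < a)%N || (l < b)%N -> fhat a b phi = 0.
Proof.
move=> h; rewrite /fhat big1 ?mulr0// => i /eqP ia; rewrite big1// => j /eqP jb.
by have := count2_le i; have := count1_le j; lia.
Qed.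

Lemma fhat_cs a b : (forall i j, cs (f i j)) -> cs (fhat a b).
Proof. by move=> cf; apply: csZ; apply: cs_sum => i _; apply: cs_sum => j _. Qed.

Lemma fhatE i j phi : cs_sym_tensor f -> smooth phi -> f i j phi = ten fhat i j phi.
Proof.
move=> [_ sf] sp; rewrite /ten /fhat /weight.
have e i' j' : count2 i' == count2 i -> count1 j' == count1 j -> f i' j' phi = f i j phi.
  move=> /eqP /count2_orbit[s ->] /eqP h.
  have /count2_orbit[t ->] : count2 j' = count2 j by have := count12 j; have := count12 j'; lia.
  exact: sf.
rewrite (eq_bigr (fun=> f i j phi *+ 'C(l, count1 j))) => [|i' hi]; last first.
  rewrite (eq_bigr (fun=> f i j phi)) => [|j' hj]; last exact: e.
  by rewrite -(card_count 0 l (count1 j)) sumr_const sum1_card.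
rewrite sumr_const -sum1_card [X in _ *+ X](card_count 1 k (count2 i)).
rewrite -[X in _ * X * _]mulr_natl -[f i j phi *+ _]mulr_natl; have := bin_neq0 (count2_le i); have := bin_neq0 (count1_le j).
move: ('C(_, _)%:R) ('C(_, _)%:R) => u v v0 u0.
have s1 : (-1) ^+ count1 j * (-1) ^+ count1 j = 1 :> R by rewrite -expr2 sqrr_sign.
have -> : (-1) ^+ count1 j * (u * (v * f i j phi)) * ((-1) ^+ count1 j / (u * v)) =
  ((-1) ^+ count1 j * (-1) ^+ count1 j) * f i j phi :> R by field; rewrite u0 v0.
by rewrite s1 mul1r.
Qed.

End Components.

End TensorComponents.

(** * The compatibility operator and its kernel *)

Section SaintVenant.
Context {R : realType}.
Notation tup k := (k.-tuple 'I_2).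
Implicit Types (phi psi : R * R -> R) (E : nat -> nat -> @functional R).

Lemma sum_shrink (F : nat -> R) m n : (m <= n)%N -> (forall i, (m <= i)%N -> F i = 0) ->
  \sum_(i < n) F i = \sum_(i < m) F i.
Proof.
move=> mn F0; rewrite (big_ord_widen n F mn) [LHS](bigID (fun i : 'I_n => (i < m)%N)) /=.
by rewrite [X in _ + X]big1 ?addr0// => i; rewrite -leqNgt => /F0.
Qed.

(** The rectangle a <= k, b <= l lies in the triangle a + b <= k + l, and F vanishes on the rest of
    the triangle. *)
Lemma sum_triangle k l (F : nat -> nat -> R) : (forall a b, (k < a)%N || (l < b)%N -> F a b = 0) ->
  \sum_(c < (k + l).+1) \sum_(a < c.+1) F a (c - a)%N = \sum_(a < k.+1) \sum_(b < l.+1) F a b.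
Proof.
move=> F0; pose r := (k + l)%N; rewrite -/r.
transitivity (\sum_(c < r.+1) \sum_(a < r.+1 | (a < c.+1)%N) F a (c - a)%N).
  apply: eq_bigr => c _.
  exact: (big_ord_widen r.+1 (fun a => F a (c - a)%N) (ltn_ord c)).
rewrite (exchange_big_dep xpredT) //=.
transitivity (\sum_(a < r.+1) \sum_(b < l.+1) F a b); last first.
  apply: (@sum_shrink (fun a => \sum_(b < l.+1) F a b)); first by rewrite ltnS leq_addr.
  by move=> a ka; rewrite big1// => b _; rewrite F0// ka.
apply: eq_bigr => a _; have [ak|ka] := leqP a k; last first.
  by rewrite !big1// => c _; rewrite F0// ka.
rewrite -(big_geq_mkord a r.+1 xpredT (fun c => F a (c - a)%N)) -{1}[nat_of_ord a]add0n big_addn big_mkord.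
under eq_bigr => b _ do rewrite addnK.
by apply: (@sum_shrink (F a)); [move: ak; rewrite /r; move: (nat_of_ord a); lia|move=> b lb; rewrite F0// lb orbT].
Qed.

Definition layer r e psi : R * R -> R := pderiv e (r - e) psi.

Lemma layer_succ r e psi : smooth psi -> (e < r)%N ->
  partial 1 (layer r e.+1 psi) = partial 0 (layer r e psi).
Proof.
move=> sp er; have -> : partial 0 (layer r e psi) = pderiv e.+1 (r - e) psi by [].
have -> : (r - e = (r - e.+1).+1)%N by lia.
by apply/funext => x; rewrite (@pderivS2 R setT _ _ _ _ openT sp I).
Qed.

Lemma signs_cancel (n : nat) (c : R) : (-1) ^+ n * c + (-1) ^+ n.+1 * c = 0.
Proof. by rewrite exprS mulN1r mulNr subrr. Qed.

Lemma count_cons k (m : tup k) : [/\ count2 [tuple of 0 :: m] = count2 m,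
  count2 [tuple of 1 :: m] = (count2 m).+1, count1 [tuple of 0 :: m] = (count1 m).+1 &
  count1 [tuple of 1 :: m] = count1 m].
Proof. by []. Qed.

Lemma behead_cons k x (m : tup k) : behead_tuple [tuple of x :: m] = m.
Proof. exact: val_inj. Qed.

(** The words 1m and 2m carry opposite signs, while the derivative of d', in x1 for the former and
    in x2 for the latter, completes their layers to the same derivative by [layer_succ]. *)
Lemma dprime_annihilated k l (u : tensor R k l) (n : tup l) psi : smooth psi ->
  \sum_(m : tup k.+1) (-1) ^+ count2 m *
     @dprime R k.+1 l u m n (layer (k.+1 + l) (count2 m + count1 n) psi) = 0.
Proof.
move=> sp.
pose F (m : tup k.+1) := (-1) ^+ count2 m *
  dpartial (head 0 m) (u (behead_tuple m) n) (layer (k.+1 + l) (count2 m + count1 n) psi).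
rewrite (eq_bigr (symmetrize F)) => [|m _]; last first.
  rewrite /dprime (symmetrize_mull (fun a => (-1) ^+ a)); apply: eq_symmetrize => s.
  by rewrite /F count2_perm.
rewrite sum_symmetrize sum_tuple_cons big1// => m _; have [c20 c21 _ _] := count_cons m.
rewrite /F c20 c21 !behead_cons.
have -> : head 0 [tuple of 0 :: m] = 0 :> 'I_2 by [].
have -> : head 0 [tuple of 1 :: m] = 1 :> 'I_2 by [].
rewrite /dpartial [((count2 m).+1 + _)%N]addSn layer_succ//; first exact: signs_cancel.
have := count2_le m; have := count1_le n; lia.
Qed.

(** The delta leaves the pairs (1m, 1n) and (2m, 2n): one raises [count1] of the second word, the
    other [count2] of the first, so both meet the same layer, with opposite signs. *)
Lemma lambda_annihilated k l (w : tensor R k l) psi :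
  \sum_(m : tup k.+1) \sum_(n : tup l.+1) (-1) ^+ count2 m *
     @lambda R k.+1 l.+1 w m n (layer (k.+1 + l.+1) (count2 m + count1 n) psi) = 0.
Proof.
pose X (m : tup k.+1) (n : tup l.+1) := (-1) ^+ count2 m * ((head 0 m == head 0 n)%:R *
  w (behead_tuple m) (behead_tuple n) (layer (k.+1 + l.+1) (count2 m + count1 n) psi)).
transitivity (\sum_(m : tup k.+1) \sum_(n : tup l.+1) symmetrize (fun i => symmetrize (X i) n) m).
  apply: eq_bigr => m _; apply: eq_bigr => n _.
  rewrite /lambda (symmetrize_mull (fun a => (-1) ^+ a)); apply: eq_symmetrize => s.
  rewrite /symmetrize mulrCA; congr (_ * _); rewrite mulr_sumr; apply: eq_bigr => t _.
  by rewrite /X count2_perm count1_perm.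
rewrite exchange_big /=; under eq_bigr => n _ do rewrite sum_symmetrize.
rewrite exchange_big /=; under eq_bigr => m _ do rewrite sum_symmetrize.
rewrite sum_tuple_cons big1// => m _; rewrite -big_split /= sum_tuple_cons big1// => n _.
have [c20 c21 _ _] := count_cons m; have [_ _ c10 c11] := count_cons n.
rewrite /X c20 c21 c10 c11 !behead_cons.
have h0 j (q : tup j) : head 0 [tuple of 0 :: q] = 0 :> 'I_2 by [].
have h1 j (q : tup j) : head 0 [tuple of 1 :: q] = 1 :> 'I_2 by [].
rewrite !h0 !h1 !eqxx (_ : (0 == 1 :> 'I_2) = false)// (_ : (1 == 0 :> 'I_2) = false)//.
rewrite !mul0r !mulr0 addr0 add0r !mul1r [(count2 m + _)%N]addnS [((count2 m).+1 + _)%N]addSn.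
exact: signs_cancel.
Qed.

Section Symbol.
Variables (k l : nat) (f : tensor R k l).

(* The compatibility operator annihilating d'u and lambda w; the components of the normal
   operator are, up to constants, its derivatives of order k + l convolved with [pot (k + l)],
   see [normal_opE]. *)
Definition saint_venant : @functional R := fun psi =>
  \sum_(m : tup k) \sum_(n : tup l) (-1) ^+ count2 m *
    f m n (layer (k + l) (count2 m + count1 n) psi).

Definition antidiagonal c : @functional R := fun phi => \sum_(a < c.+1) fhat f a (c - a) phi.

Lemma op_partials u : @smooth_op R (partials u).
Proof. by elim: u => [|i u IH]; [exact: op_id|exact: (smooth_op_comp (op_partial i) IH)]. Qed.

Lemma saint_venant_cs : (forall i j, cs (f i j)) -> cs saint_venant.
Proof.
move=> cf; apply: cs_sum => m _; apply: cs_sum => n _; apply: csZ.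
exact: (cs_op (cf m n) (op_partials _)).
Qed.

Lemma antidiagonal_cs c : (forall i j, cs (f i j)) -> cs (antidiagonal c).
Proof. by move=> cf; apply: cs_sum => a _; exact: fhat_cs. Qed.

(** The layer depends on c = a + b only, and (-1)^a = (-1)^c (-1)^b, where the last factor belongs
    to [fhat]. *)
Lemma saint_venant_antidiagonal psi : saint_venant psi =
  \sum_(c < (k + l).+1) (-1) ^+ c * antidiagonal c (pderiv c (k + l - c) psi).
Proof.
pose F a b := (-1) ^+ (a + b) * fhat f a b (layer (k + l) (a + b) psi).
transitivity (\sum_(c < (k + l).+1) \sum_(a < c.+1) F a (c - a)%N); last first.
  apply: eq_bigr => c _; rewrite /antidiagonal mulr_sumr; apply: eq_bigr => a _.
  by rewrite /F subnKC// -ltnS.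
rewrite sum_triangle; last by move=> a b h; rewrite /F fhat0// mulr0.
rewrite /saint_venant (partition_big (fun m : tup k => inord (count2 m) : 'I_k.+1) xpredT) //=.
apply: eq_bigr => a _; rewrite exchange_big /=.
rewrite (partition_big (fun n : tup l => inord (count1 n) : 'I_l.+1) xpredT) //=.
apply: eq_bigr => b _; rewrite /F /fhat exchange_big /= mulr_sumr mulr_sumr.
have e2 (m : tup k) : (inord (count2 m) == a) = (count2 m == a).
  by rewrite -val_eqE /= inordK// ltnS count2_le.
have e1 (n : tup l) : (inord (count1 n) == b) = (count1 n == b).
  by rewrite -val_eqE /= inordK// ltnS count1_le.
apply: eq_big => [m|m]; first exact: e2.
rewrite e2 => /eqP hm; rewrite !mulr_sumr; apply: eq_big => [n|n]; first exact: e1.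
rewrite e1 => /eqP hn; rewrite hm hn mulrA -exprD -addnA exprD.
by rewrite exprD -expr2 sqrr_sign mulr1.
Qed.

End Symbol.

(** [peel] provides potentials for the antidiagonal sums. Once d' of these is subtracted, every
    antidiagonal of the remainder sums to 0, so the remainder is a discrete difference, namely
    lambda of its negated partial sums. *)
Theorem saint_venant_compatible k l (f : tensor R k.+1 l.+1) : cs_sym_tensor f ->
  (forall psi, smooth psi -> saint_venant f psi = 0) ->
  exists (u : tensor R k l.+1) (w : tensor R k l),
    [/\ cs_sym_tensor u, cs_sym_tensor w & forall i j phi, smooth phi ->
        f i j phi = @dprime R k.+1 l.+1 u i j phi + @lambda R k.+1 l.+1 w i j phi].
Proof.
move=> hf S0; have cf i j : cs (f i j) by apply/csP; exact: hf.1.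
pose r := (k.+1 + l.+1)%N.
have [V [cV V0 HV]] : exists V : nat -> functional, [/\ forall c, cs (V c),
    forall c phi, (r <= c)%N -> V c phi = 0 &
    forall c phi, (c <= r)%N -> smooth phi ->
      antidiagonal f c phi = dpartial 0 (V c) phi + (if c is c'.+1 then dpartial 1 (V c') phi else 0)].
  apply: peel => [c|psi sp]; first exact: antidiagonal_cs.
  by rewrite -saint_venant_antidiagonal S0.
(* The potential of each antidiagonal a + b = c is placed in a single component. *)
pose U a b : functional := fun phi => (a == minn (a + b) k)%:R * V (a + b)%N phi.
have cU a b : cs (U a b) by exact: csZ.
(* The chosen component has a <= k; that [V] vanishes from c = r on keeps it within b <= l + 1 as
   well. *)
have U0 a b psi : (k < a)%N || (l.+1 < b)%N -> U a b psi = 0.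
  move=> h; rewrite /U; have [e|ne] := eqVneq a (minn (a + b) k); last by rewrite mul0r.
  by rewrite V0 ?mulr0// /r; lia.
pose E a b : functional := fun phi => fhat f a b phi + (U a b (partial 0 phi) +
  (if a is a'.+1 then U a' b (partial 1 phi) else 0)).
have cE a b : cs (E a b).
  apply: csD; first exact: fhat_cs.
  apply: csD; first exact: (cs_op (cU a b) (op_partial 0)).
  by case: a => [|a]; [exact: cs0|exact: (cs_op (cU a b) (op_partial 1))].
have E0 a b psi : (k.+1 < a)%N || (l.+1 < b)%N -> E a b psi = 0.
  move=> h; rewrite /E fhat0//; case: a h => [|a] h; first by rewrite U0 ?addr0//; lia.
  by rewrite !U0 ?addr0//; lia.
have sumU c psi : \sum_(a < c.+1) U a (c - a)%N psi = V c psi.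
  have h : (minn c k < c.+1)%N by rewrite ltnS geq_minl.
  rewrite (bigD1 (Ordinal h))//= big1 => [|a ne].
    by rewrite /U subnKC ?geq_minl// eqxx mul1r addr0.
  have ac : (a <= c)%N by rewrite -ltnS.
  have e : (nat_of_ord a == minn c k) = false by apply/negbTE; move: ne; rewrite -val_eqE.
  by rewrite /U (subnKC ac) e mul0r.
have Esum c phi : smooth phi -> \sum_(a < c.+1) E a (c - a)%N phi = 0.
  move=> sp; have [cr|rc] := leqP c r; last first.
    rewrite big1// => a _; apply: E0; have := ltn_ord a; rewrite /r in rc; lia.
  rewrite /E big_split /= big_split /= sumU -/(antidiagonal f c phi) HV//.
  have -> : \sum_(a < c.+1) (if nat_of_ord a is a'.+1 then U a' (c - a)%N (partial 1 phi) else 0) =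
      if c is c'.+1 then V c' (partial 1 phi) else 0.
    rewrite big_ord_recl add0r; case: (c) => [|c']; first by rewrite big_ord0.
    by rewrite -sumU; apply: eq_bigr => a _; rewrite /= /bump /= add1n subSS.
  by rewrite /dpartial; case: (c) => [|c']; ring.
(* Partial sums along the antidiagonal c: telescoping recovers E, and the vanishing of the full sum
   settles the end of the antidiagonal. *)
pose P a c : functional := fun phi => \sum_(a' < a) E a' (c - a')%N phi.
have cP a c : cs (P a c) by apply: cs_sum => a' _; exact: cE.
pose w a b : functional := fun phi => - P a.+1 (a + b).+1 phi.
have cw a b : cs (w a b) by exact: csN.
exists (ten U), (ten w); split; [exact: ten_cs|exact: ten_cs|].
move=> i j phi sp.
rewrite (fhatE i j hf sp) ten_lambda ten_dprime; last by move=> b psi; apply: U0; rewrite ltnSn.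
rewrite /ten -mulrDl; congr (_ * _).
have := count2_le i; have := count1_le j; move: (count2 i) (count1 j) => a b bl ak.
suff e : E a b phi = (if (a <= k)%N then (if b is b'.+1 then - w a b' phi else 0) else 0) +
    (if a is a'.+1 then (if (b <= l)%N then w a' b phi else 0) else 0).
  by rewrite -e /E -opprD addrC addrK.
have full c n : (c < n)%N -> (forall a', (c < a')%N -> (a' < n)%N -> E a' (c - a')%N phi = 0) -> 
    P n c phi = 0.
  move=> cn h; rewrite -(Esum c phi sp) /P (big_ord_widen n (fun a' => E a' (c - a')%N phi) cn).
  rewrite [LHS](bigID (fun i : 'I_n => (i < c.+1)%N)) /= [X in _ + X]big1 ?addr0// => a'.
  by rewrite -leqNgt => ca; exact: h.
have step : E a b phi = P a.+1 (a + b)%N phi - P a (a + b)%N phi.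
  by rewrite /P big_ord_recr /= addKn addrC addrK.
rewrite step; congr (_ + _).
  case: leqP => ak'.
    case: b bl step => [|b] bl step; last by rewrite /w opprK addnS.
    by rewrite addn0; apply: full => // a'; rewrite ltnS => h1 /(leq_trans h1); rewrite ltnn.
  have -> : a = k.+1 by lia.
  rewrite -[RHS](Esum (k.+1 + b)%N phi sp) /P; apply/esym.
  apply: (@sum_shrink (fun a' => E a' (k.+1 + b - a')%N phi)); first by lia.
  by move=> a' h; apply: E0; rewrite h.
case: a ak {step} => [|a] ak; first by rewrite /P big_ord0 oppr0.
case: leqP => bl'; first by rewrite /w addSn.
rewrite /P big1 ?oppr0// => a' _; apply: E0; have := ltn_ord a'; lia.
Qed.

End SaintVenant.

(** * The normal operator through the compatibility operator, and the conclusion *)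

Section NormalOperator.
Context {R : realType}.
Notation tup k := (k.-tuple 'I_2).
Implicit Types (h phi : R * R -> R).

Lemma exists_count (x : 'I_2) k a : (a <= k)%N -> exists i : tup k, count_mem x i = a.
Proof.
move=> ak; have := card_count x k a; have := bin_gt0 k a; rewrite ak => h e.
have [/existsP[i /eqP]|/existsPn n] := boolP [exists i : tup k, count_mem x i == a]; first by exists i.
by move: h; rewrite -e big_pred0// => i; apply/negbTE/n.
Qed.

(** The origin of the kernel is met only on the null line left out of [hset]. The lemma is applied
    to derivatives of [pot], whose value at the origin carries no meaning. *)
Lemma conv_eq_off0 d h h' phi (M : R) : 0 <= M -> hom d h -> (forall x, x != 0 -> h x = h' x) ->
  supported M phi -> conv h phi = conv h' phi.
Proof.
move=> M0 H hh sp; have H' : hom d h' := hom_eq hh H; apply/funext => y.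
rewrite /conv (plane_int_hset 0 y (conv_intg y M0 H sp)) (plane_int_hset 0 y (conv_intg y M0 H' sp)).
apply: eq_Rintegral => x /set_mem hx; congr (_ * _); apply: hh.
by rewrite subr_eq0; exact: hyper_neq hx.
Qed.

(** The exponents depend on the four words only through a sum of one count for (i, j) and one for
    (m, n); this additivity lets the kernel split into one layer for each pair. *)
Lemma normal_kernelE k l (i m : tup k) (j n : tup l) (x : R * R) :
  normal_kernel i j m n x = (-1) ^+ (count1 j + count1 n) *
    ker (2 * (k + l) - (count2 i + count1 j + (count2 m + count1 n)))
        (count2 i + count1 j + (count2 m + count1 n)) (2 * (k + l) + 1) x.
Proof.
rewrite /normal_kernel /ker; have := count12 i; have := count12 j; have := count12 m; have := count12 n.
move=> e1 e2 e3 e4.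
have -> : (2 * (k + l) - (count2 i + count1 j + (count2 m + count1 n)) =
  count1 i + count2 j + count1 m + count2 n)%N by lia.
have -> : (count2 i + count1 j + (count2 m + count1 n) = count2 i + count1 j + count2 m + count1 n)%N by lia.
by have -> : (2 * (k + l) + 1 = 2 * k + 2 * l + 1)%N by lia.
Qed.

(** The kernel is a derivative of order 2r of [pot r], which splits into two layers of order r.
    Moving it off the singular kernel costs the sign (-1)^(2r) = 1. *)
Lemma conv_normal_kernel k l (i m : tup k) (j n : tup l) phi (M : R) : (0 < k + l)%N ->
  0 <= M -> supported M phi ->
  conv (normal_kernel i j m n) phi = fun y =>
    (-1) ^+ (count1 j + (count2 i + count1 j)) / pot_cst (k + l) * (-1) ^+ count2 m *
    layer (k + l) (count2 m + count1 n)
      (layer (k + l) (count2 i + count1 j) (conv (pot (k + l)) phi)) y.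
Proof.
move=> r0 M0 sp; set r := (k + l)%N; pose d := (count2 i + count1 j)%N; pose c := (count2 m + count1 n)%N.
have dr : (d <= r)%N by have := count2_le i; have := count1_le j; rewrite /d /r; lia.
have cr : (c <= r)%N by have := count2_le m; have := count1_le n; rewrite /c /r; lia.
pose W := nseq (d + c) (0 : 'I_2) ++ nseq (2 * r - (d + c)) 1.
have sW : size W = (2 * r)%N by rewrite size_cat !size_nseq; lia.
pose C : R := (-1) ^+ (count1 j + count1 n) * (-1) ^+ (d + c) / pot_cst r.
have hW : hom (size W + 0) (@pot R r) by rewrite sW addn0; exact: hom_pot.
have H0 : hom 0 (fun x => C * partials W (pot r) x) by apply: hom_scale; exact: hom_partials hW.
have e x : x != 0 -> C * partials W (pot r) x = normal_kernel i j m n x.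
  move=> x0; rewrite normal_kernelE -/d -/c -/r.
  have ab : (d + c + (2 * r - (d + c)) = 2 * r)%N by lia.
  rewrite -[partials W _ x]/(pderiv (d + c) (2 * r - (d + c)) (pot r) x) (pderiv_pot ab x0) /C.
  have p0 := @pot_cst_neq0 R r.
  have s1 : (-1) ^+ (d + c) * (-1) ^+ (d + c) = 1 :> R by rewrite -expr2 sqrr_sign.
  move: p0 s1; move: (pot_cst r) ((-1) ^+ (d + c)) ((-1) ^+ (count1 j + count1 n)) (ker _ _ _ x).
  move=> p q u z p0 qq; have -> : u * q / p * (p * q * z) = u * (q * q) * z by field.
  by rewrite qq mulr1.
rewrite -(conv_eq_off0 M0 H0 e sp); apply/funext => y.
have -> : conv (fun x => C * partials W (pot r) x) phi y = C * conv (partials W (pot r)) phi y.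
  rewrite /conv -(plane_intZ C (conv_intg y M0 (hom_partials hW) sp)).
  by congr plane_int; apply/funext => x; rewrite mulrA.
rewrite (conv_kernel_partials M0 hW sp) sW exprM sqrrN !expr1n mul1r.
have sP := conv_smooth M0 (hom_pot2 r0) sp.
rewrite -(conv_partials (rev W) M0 (hom_pot2 r0) sp) (partials_rev _ sP).
(* The sign of the kernel in [count1 n] cancels against that of the layer (m, n), leaving the sign
   that defines [saint_venant]. *)
have -> : C = (-1) ^+ (count1 j + d) / pot_cst r * (-1) ^+ count2 m.
  have s1 : (-1) ^+ count1 n * (-1) ^+ count1 n = 1 :> R by rewrite -expr2 sqrr_sign.
  rewrite /C /c !exprD; move: s1; move: ((-1) ^+ count1 n) (pot_cst r) => u p uu.
  rewrite -[RHS]mulr1 -uu; ring.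
congr (_ * _); rewrite /layer -/c -/d -/r /pderiv -partials_cat !(partials_pderiv _ sP).
rewrite /W !count_cat !count_nseq /= !mul1n !mul0n !addn0 !add0n.
by congr (pderiv _ _ _ y); lia.
Qed.

Lemma normal_opE k l (f : tensor R k l) (i : tup k) (j : tup l) phi (M : R) : (0 < k + l)%N ->
  (forall i j, cs (f i j)) -> 0 <= M -> supported M phi ->
  normal_op f i j phi = 2 * ((-1) ^+ (count1 j + (count2 i + count1 j)) / pot_cst (k + l)) *
    saint_venant f (layer (k + l) (count2 i + count1 j) (conv (pot (k + l)) phi)).
Proof.
move=> r0 cf M0 sp; rewrite /normal_op -mulrA; congr (2 * _).
rewrite /saint_venant mulr_sumr; apply: eq_bigr => m _; rewrite mulr_sumr; apply: eq_bigr => n _.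
have sP := conv_smooth M0 (hom_pot2 r0) sp.
have sL : smooth (layer (k + l) (count2 m + count1 n)
  (layer (k + l) (count2 i + count1 j) (conv (pot (k + l)) phi))).
  exact: (smooth_partials _ (smooth_partials _ sP)).
rewrite /convolution -[X in f m n X]/(conv (normal_kernel i j m n) phi).
by rewrite (conv_normal_kernel i m j n r0 M0 sp) (csTZ _ (cf m n) sL) mulrA.
Qed.

(** Near x the kernel coincides with the globally smooth [pot_ext], for which the order of
    derivatives is immaterial; s is adapted to x. *)
Lemma partials_pot_count r u v x : count_mem 0%R u = count_mem 0%R v -> count_mem 1%R u = count_mem 1%R v ->
  x != 0 -> partials u (@pot R r) x = partials v (pot r) x.
Proof.
move=> h0 h1 x0; pose s := sqd 0 x * 4; have q0 : 0 < sqd 0 x by rewrite sqd0_gt0.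
have s0 : 0 < s by rewrite mulr_gt0.
have h : s / 8 < sqd 0 x by rewrite /s; lra.
have sE := smooth_pot_ext s0 r.
by rewrite -!(pot_ext_partials s0 _ _ h) !(partials_pderiv _ sE) h0 h1.
Qed.

End NormalOperator.

Unset Implicit Arguments.

Theorem theorem2p4 (R : realType) (k l : nat) (hk : (1 <= k)%N) (hl : (1 <= l)%N)
  (U : set (R * R)) (hU : open U) (hU0 : U !=set0)
  (f : tensor R k l) (hf : cs_sym_tensor f)
  (u : tensor R k.-1 l) (hu : cs_sym_tensor u)
  (w' : tensor R k.-1 l.-1) (hw' : cs_sym_tensor w')
  (hfU : forall i j phi, test_fun U phi ->
     f i j phi = dprime u i j phi + lambda w' i j phi)
  (x0 : R * R) (hx0 : U x0)
  (hN : forall i j, vanishes_infinite_order (normal_op f i j) x0) :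
  exists (u' : tensor R k.-1 l) (w : tensor R k.-1 l.-1),
    [/\ cs_sym_tensor u', cs_sym_tensor w &
        forall i j phi, smooth phi ->
          f i j phi = dprime u' i j phi + lambda w i j phi].
Proof.
case: k hk f hf u hu w' hw' hfU hN => // k _; case: l hl => // l _ f hf u hu w' hw' hfU hN.
rewrite /= in u hu w' hw' hfU *.
have cf i j : cs (f i j) by apply/csP; exact: hf.1.
apply: (saint_venant_compatible hf).
pose r := (k.+1 + l.+1)%N; have r0 : (0 < r)%N by [].
have cS := saint_venant_cs cf.
have Ux : U (x0.1, x0.2) by case: x0 hx0 {hN}.
have [rho rho0 Hrho] := open2P hU Ux.
pose d := rho / 2; have d0 : 0 < d by rewrite divr_gt0.
have BU x : sqd x0 x <= d ^+ 2 -> U x.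
  move=> /(sqd_near (ltW d0)); case: x => x1 x2 /= [h1 h2].
  by apply: Hrho; rewrite distrC; rewrite /d in h1 h2; lra.
pose t := d ^+ 2; pose s := t / 2.
have t0 : 0 < t by rewrite exprn_gt0.
have s0 : 0 < s by rewrite divr_gt0.
have st : s < t by rewrite /s; lra.
(* Layers of phi are test functions on a disc inside U, where f is d'u + lambda w', and
   [saint_venant] annihilates both terms. *)
have Sloc phi : smooth phi -> (forall y, t <= sqd x0 y -> phi y = 0) -> saint_venant f phi = 0.
  move=> sp p0; have ib : in_ball x0 d phi by split => // x h; apply: p0; exact: ltW.
  have tl e : test_fun U (layer r e phi).
    exact: (in_ball_test (ltW d0) (in_ball_partials _ ib) BU).
  rewrite /saint_venant.
  rewrite (eq_bigr (fun m : k.+1.-tuple 'I_2 =>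
      \sum_(n : l.+1.-tuple 'I_2) (-1) ^+ count2 m *
        @dprime R k.+1 l.+1 u m n (layer r (count2 m + count1 n) phi) +
      \sum_(n : l.+1.-tuple 'I_2) (-1) ^+ count2 m *
        @lambda R k.+1 l.+1 w' m n (layer r (count2 m + count1 n) phi))) => [|m _]; last first.
    by rewrite -big_split /=; apply: eq_bigr => n _; rewrite (hfU m n _ (tl _)) mulrDr.
  rewrite big_split /= exchange_big /= big1 => [|n _]; last exact: (dprime_annihilated u n sp).
  by rewrite add0r; exact: lambda_annihilated.
apply: (inversion_kills s0 st cS Sloc).
apply: (kernel_family s0 st (r := r) cS) => v rv.
(* Of the letters of v, at least r in number, r are attributed to a component of N f, c of them
   derivatives in x1, and the rest to derivatives of that component at x0. As a + b >= r, the choice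
   of c leaves r - c <= b. *)
pose a := count_mem 0%R v; pose b := count_mem 1%R v; pose c := minn a r.
have ab : (a + b = size v)%N := word2_size v.
(* Any splitting of c into [count2 i] <= k + 1 and [count1 j] <= l + 1 yields a suitable component;
   this one fills i first. *)
pose c2 := minn c k.+1.
have [i hi] := @exists_count 1 k.+1 c2 (geq_minr _ _).
have cl : (c - c2 <= l.+1)%N by rewrite /c2 /c /r; lia.
have [j hj] := @exists_count 0 _ _ cl.
have hij : (count2 i + count1 j = c)%N by rewrite /count2 /count1 hi hj /c2; lia.
pose W := nseq c (0 : 'I_2) ++ nseq (r - c) 1.
have -> : ext x0 s t (partials v (pot r)) =
    ext x0 s t (partials (W ++ (nseq (a - c) 0 ++ nseq (b - (r - c)) 1)) (pot r)).
  have e0 : count_mem 0%R v = count_mem 0%R (W ++ (nseq (a - c) 0 ++ nseq (b - (r - c)) 1)).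
    by rewrite /W !count_cat !count_nseq /= !mul1n !mul0n -/a /c; lia.
  have e1 : count_mem 1%R v = count_mem 1%R (W ++ (nseq (a - c) 0 ++ nseq (b - (r - c)) 1)).
    by rewrite /W !count_cat !count_nseq /= !mul1n !mul0n -/b /c; lia.
  by apply: (ext_eq x0 t s0) => x xn; exact: partials_pot_count.
have [V [g [oV Vx sg HT g0]]] := hN i j.
have c0 : (2 * ((-1) ^+ (count1 j + (count2 i + count1 j)) / pot_cst r) : R) != 0.
  by rewrite mulf_neq0// mulf_neq0 ?signr_eq0// invr_neq0// pot_cst_neq0.
apply: (dirac_limit s0 st r0 cS Sloc oV Vx sg g0 c0) => phi tp.
have [M [M0 sM]] := test_fun_supported tp.
have := normal_opE i j r0 cf M0 sM; rewrite hij => e.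
by rewrite -[RHS](HT _ tp) e.
Qed.
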